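(* Let $h\ge 0$, $h\ne1$, and let $m:\mathbb{R}\to\mathbb{S}^1$ be a critical point of $E_h$ with $E_h(m)<\infty$. Then $$\int_{\mathbb{R}}|m'|^2\,dx_1=2\int_{\mathbb{R}}W(m)\,dx_1.$$
   Context: Fix $h\ge 0$ with $h\neq 1$ and set $k=\min\{h,1\}$. $\mathbb{S}^1$ is the unit circle in $\mathbb{R}^2$, and $W(m)=\frac12(m_1^2-2hm_1+2hk-k^2)$ for $m=(m_1,m_2)\in\mathbb{S}^1$. Let $\mathbb{R}^2_+=\mathbb{R}\times(0,\infty)$ and let $\dot H^1(\mathbb{R}^2_+)$ be the completion of $C_0^\infty(\overline{\mathbb{R}^2_+})$ with respect to the inner product $\int_{\mathbb{R}^2_+}\nabla\phi\cdot\nabla\psi\,dx$. For $m:\mathbb{R}\to\mathbb{S}^1$ with $m_1-k\in H^1(\mathbb{R})$, let $u\in\dot H^1(\mathbb{R}^2_+)$ be the unique solution of $\Delta u=0$ in $\mathbb{R}^2_+$, $\partial u/\partial x_2=-m_1'$ on $\mathbb{R}\times\{0\}$, i.e. $\int_{\mathbb{R}^2_+}\nabla u\cdot\nabla\zeta\,dx=\int_{\mathbb{R}}m_1'\,\zeta(\cdot,0)\,dx_1$ for all $\zeta\in C_0^\infty(\mathbb{R}^2)$. Equivalently $\int_{\mathbb{R}^2_+}|\nabla u|^2dx=\int_{\mathbb{R}}|\xi|\,|\mathcal{F}(m_1-k)(\xi)|^2d\xi$, with unitary Fourier transform $\mathcal{F}$. Energy: $E_h(m)=\frac12\int_{-\infty}^\infty(|m'|^2+2W(m))\,dx_1+\frac12\int_{\mathbb{R}^2_+}|\nabla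 u|^2\,dx$. For $m\in H^1_{loc}(\mathbb{R};\mathbb{S}^1)$, $E_h(m)<\infty$ means that $m_1-k\in H^1(\mathbb{R})$, $m_2'\in L^2(\mathbb{R})$ and, if $h>1$, also $m_1-1\in L^1(\mathbb{R})$. Critical point: writing $m=(\cos\phi,\sin\phi)$ with a continuous lifting $\phi$, $m$ is a critical point of $E_h$ if $\frac{d}{dt}\big|_{t=0}E_h(\cos(\phi+t\zeta),\sin(\phi+t\zeta))=0$ for every $\zeta\in C_0^\infty(\mathbb{R})$; equivalently, $\phi$ solves (in the sense of distributions) the Euler–Lagrange equation $\phi''=(h-\cos\phi+u')\sin\phi$ in $\mathbb{R}$, where $u'(x_1)=\frac{\partial u}{\partial x_1}(x_1,0)$. *)

(* Defs.v *)
From HB Require Import structures.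
From mathcomp Require Import all_boot all_order all_algebra.
From mathcomp Require Import all_classical all_reals all_analysis.

Set Implicit Arguments.
Unset Strict Implicit.
Unset Printing Implicit Defensive.
Import Order.TTheory GRing.Theory Num.Theory.
Import numFieldNormedType.Exports.
Local Open Scope classical_set_scope.
Local Open Scope ring_scope.

(* All iterated directional derivatives exist and are continuous; for
   finite-dimensional V this is C^oo. *)
Definition smooth (R : realType) (V : normedModType R) (f : V -> R) : Prop :=
  forall vs : seq V,
    let g := foldr (fun v (k : V -> R) => fun x => 'D_v k x) f vs in
    continuous g /\ forall x v, derivable g x v.

Definition test_function (R : realType) (V : normedModType R) (f : V -> R) :
    Prop :=
  smooth f /\ compact (closure [set x | f x != 0]).

Section OneDimensional.
Context {R : realType}.
Let mu := @lebesgue_measure R.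
Implicit Types f g : R -> R.

Definition L2 f : Prop := f \in Lfun mu 2%:E.

Definition L2loc f : Prop :=
  measurable_fun setT f /\ locally_integrable setT (fun x => f x ^+ 2).

Definition is_weak_derivative f g : Prop :=
  [/\ locally_integrable setT f, locally_integrable setT g &
      forall zeta : R -> R, test_function zeta ->
        \int[mu]_x (f x * derive1 zeta x) = - \int[mu]_x (g x * zeta x)].

(* A weak derivative of f if there is one (it is then unique almost
   everywhere), an unspecified function otherwise. *)
Definition weak_derivative f : R -> R := get [set g | is_weak_derivative f g].

Definition H1 f : Prop :=
  L2 f /\ exists g, is_weak_derivative f g /\ L2 g.

Definition H1loc f : Prop :=
  L2loc f /\ exists g, is_weak_derivative f g /\ L2loc g.

End OneDimensional.

Notation lebesgue2 := (@lebesgue_measure _ \x @lebesgue_measure _)%E.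

Section Plane.
Context {R : realType}.
Implicit Types (v w : R * R) (G : R * R -> R * R).

(* The library norm on R * R is the sup norm, hence these definitions. *)
Definition dotp v w : R := v.1 * w.1 + v.2 * w.2.
Definition sqnorm v : R := dotp v v.

Definition unit_circle : set (R * R) := [set v | sqnorm v = 1].

Definition half_plane : set (R * R) := [set z | 0 < z.2].

Definition gradient (f : R * R -> R) (z : R * R) : R * R :=
  ('D_((1, 0) : R * R) f z, 'D_((0, 1) : R * R) f z).

(* The elements of the completion of C_0^oo(closed half plane) for the inner
   product \int grad phi . grad psi, each represented by its gradient: phi |->
   grad phi is an isometry into L^2(half_plane; R^2), so the completion is the
   closure of its range.  The functions of C_0^oo(closed half plane) are the
   restrictions of the test functions of the plane. *)
Definition dotH1_gradient G : Prop :=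
  [/\ measurable_fun half_plane (fun z => (G z).1),
      measurable_fun half_plane (fun z => (G z).2) &
      exists phi : nat -> R * R -> R,
        (forall n, test_function (phi n)) /\
        ((\int[lebesgue2]_(z in half_plane)
            (sqnorm (gradient (phi n) z - G z)%R)%:E)%E @[n --> \oo] --> 0%E)].

End Plane.

Section Energy.
Context {R : realType}.
Let mu := @lebesgue_measure R.
Implicit Types (h : R) (m : R -> R * R).

Definition component1 m : R -> R := fun x => (m x).1.
Definition component2 m : R -> R := fun x => (m x).2.

Definition mderiv m (x : R) : R * R :=
  (weak_derivative (component1 m) x, weak_derivative (component2 m) x).

(* G is the gradient of the solution u in dot H^1 of: u is harmonic in the half
   plane and du/dx_2 = - m_1' on its boundary. *)
Definition is_stray_gradient m (G : R * R -> R * R) : Prop :=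
  dotH1_gradient G /\
  forall zeta : R * R -> R, test_function zeta ->
    \int[lebesgue2]_(z in half_plane) dotp (G z) (gradient zeta z) =
    \int[mu]_x ((mderiv m x).1 * zeta (x, 0)).

Definition stray_gradient m : R * R -> R * R :=
  get [set G | is_stray_gradient m G].

Definition kpar h : R := Num.min h 1.

Definition W h (p : R * R) : R :=
  2^-1 * (p.1 ^+ 2 - 2 * h * p.1 + 2 * h * kpar h - kpar h ^+ 2).

Definition energy h m : \bar R :=
  ((2^-1)%:E * \int[mu]_x (sqnorm (mderiv m x) + 2 * W h (m x))%:E +
   (2^-1)%:E *
     \int[lebesgue2]_(z in half_plane) (sqnorm (stray_gradient m z))%:E)%E.

(* The meaning of E_h(m) < oo for m in H^1_loc(R; S^1). *)
Definition finite_energy h m : Prop :=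
  [/\ H1 (fun x => (m x).1 - kpar h),
      exists g, is_weak_derivative (component2 m) g /\ L2 g &
      1 < h -> (fun x => (m x).1 - 1) \in Lfun mu 1].

Definition angle_map (phi : R -> R) (x : R) : R * R :=
  (cos (phi x), sin (phi x)).

(* An H^1_loc map is determined up to a null set only, hence the lifting phi
   lifts its continuous representative. *)
Definition critical_point h m : Prop :=
  exists phi : R -> R,
    [/\ continuous phi, {ae mu, forall x, m x = angle_map phi x} &
        forall zeta : R -> R, test_function zeta ->
          is_derive (0 : R) (1 : R)
            (fun t : R =>
               fine (energy h (angle_map (fun x => phi x + t * zeta x)))) 0].

End Energy.

(* Main.v *)
Require Import Defs.
From HB Require Import structures.
From mathcomp Require Import all_boot all_order all_algebra.
From mathcomp Require Import all_classical all_reals all_analysis.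
From mathcomp Require Import measurable_realfun borel_hierarchy ess_sup_inf gauss_integral.
From mathcomp Require Import ring lra.
Import Order.TTheory GRing.Theory Num.Theory.
Import numFieldNormedType.Exports.
Set Implicit Arguments.
Unset Strict Implicit.
Unset Printing Implicit Defensive.
Local Open Scope classical_set_scope.
Local Open Scope ring_scope.

(** The identity is the stationarity of the energy under dilations of the line.
    Write [m = (cos phi, sin phi)], [p = phi'], and let [G] be the gradient of the
    stray field potential.  Under [x |-> (1 + s) x] the exchange energy
    [1/2 \int p^2] is divided by [1 + s], the term [\int W] is multiplied by [1 + s],
    and the stray field energy does not change, because the Dirichlet integral in
    two dimensions is invariant under dilations.  A map at which the derivative in
    [s] vanishes therefore satisfies [1/2 \int p^2 = \int W].

    Dilations are not perturbations of compact support, so the vector field [x] is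
    replaced by [X x = x chi (x / n)] with a cutoff function [chi]; the flow is
    [Psi = id + s X], and [phi] is compared with [phi \o Psi^-1].  The change
    [zeta = phi \o Psi^-1 - phi] has compact support, but it is not smooth in [s]:
    its derivative does not tend to 0 at a rate that the mere square integrability
    of [p] controls.  The argument therefore compares two one-sided bounds and never
    differentiates along [s].

    From above ([dil_upper]): the stray field energy is the largest value of
    [2 \int m_1' xi - \int |grad xi|^2] over test functions [xi], and composing [xi]
    with the plane map [(x, y) |-> (Psi x, (1 + s) y)] bounds the energy of the
    transported profile by a weighted Dirichlet integral of [G]
    ([transport_bound]).  Hence the energy of [phi \o Psi^-1] is at most
    [E(phi) + s T + O(s^2)], where [T] ([dilation_derivative]) is
    [- 1/2 \int X' p^2 + \int X' W + 1/2 \int (X' - 1) (G_1^2 - G_2^2)].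

    From below ([energy_lower]): the stray field energy is convex in the profile, and
    the first component of the map changes by [- sin phi zeta + r] with
    [|r| <= zeta^2].  The linear part contributes to the first variation; the part
    [r] is estimated by an explicit field [exp_field] with boundary flux [r'], whose
    decay rate [1 / t] balances [r] against [r'].  So the energy of
    [phi + zeta] is at least [E(phi) + L(zeta) - o(s)], where [L] is the first
    variation.  The bounds on [zeta] that this needs, namely [zeta^2 = o(s)]
    uniformly and [\int zeta^2 = O(s^2)], come from the increments of a primitive of
    [p^2].

    Criticality gives [L = 0] on test functions.  As [L(zeta)] is an integral of
    [A zeta' + B zeta], this says that [B] is the weak derivative of [A], and [L]
    vanishes on every absolutely continuous [zeta] of compact support with square
    integrable derivative ([critical_first_variation]).  Comparing the two bounds
    for both signs of [s] gives [T = 0] ([dilation_identity]), and letting [n] tend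
    to infinity, so that [X'] tends to 1 boundedly, gives the theorem
    ([equipartition]).

    Absolutely continuous functions are treated as primitives: [prim F f] says that
    [F] is an integral of [f].  Weak derivatives reduce to primitives by the lemma of
    du Bois-Reymond.  The stray field is obtained as an orthogonal projection onto
    the closure of the gradients of test functions, which rests on the completeness
    of the space of square integrable functions. *)

(** * Integrable and square integrable functions *)

(** The discriminant of a nonnegative binary quadratic form, in a homogeneous
    version, so that it also covers vanishing coefficients. *)
Lemma discriminant_le (R : realFieldType) (A B C : R) : 0 <= A -> 0 <= B ->
  (forall s t, 0 <= s ^+ 2 * A + 2 * (s * t) * C + t ^+ 2 * B) ->
  C ^+ 2 <= A * B.
Proof.
move=> A0 B0 key; have [A1|A1] := eqVneq A 0.
  rewrite A1 mul0r; have [->|C0] := eqVneq C 0; first by rewrite expr0n.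
  have := key (- (B + 1) / (2 * C)) 1; rewrite A1 mulr0 add0r mulr1.
  rewrite expr1n mul1r (_ : 2 * _ * C = - (B + 1)); last by field.
  by move=> h; exfalso; lra.
have Ap : 0 < A by rewrite lt0r A1.
have := key (- C) A => h.
have : 0 <= A * (A * B - C ^+ 2) by nra.
by rewrite pmulr_rge0// subr_ge0.
Qed.

Section SquareIntegrable.
Context {d} {T : measurableType d} {R : realType}.
Variables (mu : {measure set T -> \bar R}) (D : set T).
Hypothesis mD : measurable D.
Implicit Types f g : T -> R.

(** Integrability of a real function; the library integral is extended real
    valued. *)
Definition rint f := mu.-integrable D (EFin \o f).

Definition sqint f := measurable_fun D f /\ rint (fun x => f x ^+ 2).

Lemma rint_measurable f : rint f -> measurable_fun D f.
Proof. by move=> /measurable_int/measurable_EFinP. Qed.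

Lemma rintD f g : rint f -> rint g -> rint (fun x => f x + g x).
Proof.
move=> hf hg; rewrite /rint.
rewrite (_ : _ \o _ = ((EFin \o f) \+ (EFin \o g))%E); first exact: integrableD.
by apply/funext => x.
Qed.

Lemma rintZ c f : rint f -> rint (fun x => c * f x).
Proof.
move=> hf; rewrite /rint.
rewrite (_ : _ \o _ = (fun x => c%:E * (EFin \o f) x)%E); first exact: integrableZl.
by apply/funext => x.
Qed.

Lemma rintN f : rint f -> rint (fun x => - f x).
Proof.
by move=> /(rintZ (-1)); congr rint; apply/funext => x; rewrite mulN1r.
Qed.

Lemma rintB f g : rint f -> rint g -> rint (fun x => f x - g x).
Proof. by move=> hf hg; apply: rintD => //; exact: rintN. Qed.

Lemma le_rint f g : measurable_fun D f -> (forall x, D x -> `|f x| <= g x) ->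
  rint g -> rint f.
Proof.
move=> mf fg; apply: le_integrable => //; first exact/measurable_EFinP.
move=> x Dx /=; rewrite lee_fin (le_trans (fg _ Dx))//.
exact: ler_norm.
Qed.

(** Young: the product is dominated by the sum of the squares. *)
Lemma rint_sqM f g : sqint f -> sqint g -> rint (fun x => f x * g x).
Proof.
move=> [mf hf] [mg hg].
apply: (@le_rint _ (fun x => f x ^+ 2 + g x ^+ 2)); last exact: rintD.
  exact: measurable_funM.
move=> x _; rewrite normrM -(real_normK (num_real (f x))).
rewrite -(real_normK (num_real (g x))).
have := normr_ge0 (f x); have := normr_ge0 (g x); nra.
Qed.

Lemma sqintD f g : sqint f -> sqint g -> sqint (fun x => f x + g x).
Proof.
move=> sf sg; split; first by apply: measurable_funD; [case: sf|case: sg].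
have := rintD (rintD sf.2 (rintZ 2 (rint_sqM sf sg))) sg.2.
by congr rint; apply/funext => x; ring.
Qed.

Lemma sqintZ c f : sqint f -> sqint (fun x => c * f x).
Proof.
move=> sf; split; first by apply: measurable_funM => //; case: sf.
have := rintZ (c ^+ 2) sf.2.
by congr rint; apply/funext => x; rewrite exprMn.
Qed.

Lemma sqintB f g : sqint f -> sqint g -> sqint (fun x => f x - g x).
Proof.
move=> sf sg; have := sqintD sf (sqintZ (-1) sg).
by congr sqint; apply/funext => x; rewrite mulN1r.
Qed.

Lemma sqintN f : sqint f -> sqint (fun x => - f x).
Proof. by move=> /(sqintZ (-1)); congr sqint; apply/funext => x; rewrite mulN1r. Qed.

Lemma rint_norm f : rint f -> rint (fun x => `|f x|).
Proof. by move=> ?; exact: integrable_norm. Qed.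

Lemma rintMb C f g : measurable_fun D f -> (forall x, D x -> `|f x| <= C) ->
  rint g -> rint (fun x => f x * g x).
Proof.
move=> mf fC ig; apply: (@le_rint _ (fun x => C * `|g x|)).
- by apply: measurable_funM => //; exact: rint_measurable.
- by move=> x Dx; rewrite normrM ler_wpM2r// fC.
- exact/rintZ/rint_norm.
Qed.

Lemma sqintMb C f g : measurable_fun D f -> (forall x, D x -> `|f x| <= C) ->
  sqint g -> sqint (fun x => f x * g x).
Proof.
move=> mf fC [mg ig]; split; first exact: measurable_funM.
have := @rintMb (C ^+ 2) (fun x => f x ^+ 2) (fun x => g x ^+ 2).
move=> /(_ (measurable_funX 2 mf) _ ig) h.
suff: rint (fun x => f x ^+ 2 * g x ^+ 2).
  by congr rint; apply/funext => x; rewrite exprMn.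
apply: h => x Dx; rewrite normrX lerXn2r ?nnegrE// ?fC//.
by rewrite (le_trans (normr_ge0 _) (fC _ Dx)).
Qed.

Lemma RintD f g : rint f -> rint g ->
  \int[mu]_(x in D) (f x + g x) = \int[mu]_(x in D) f x + \int[mu]_(x in D) g x.
Proof. by move=> *; exact: RintegralD. Qed.

Lemma RintB f g : rint f -> rint g ->
  \int[mu]_(x in D) (f x - g x) = \int[mu]_(x in D) f x - \int[mu]_(x in D) g x.
Proof. by move=> *; exact: RintegralB. Qed.

Lemma RintZ c f : rint f ->
  \int[mu]_(x in D) (c * f x) = c * \int[mu]_(x in D) f x.
Proof. by move=> *; exact: RintegralZl. Qed.

Lemma eq_Rint f g : (forall x, D x -> f x = g x) ->
  \int[mu]_(x in D) f x = \int[mu]_(x in D) g x.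
Proof. by move=> fg; apply: eq_Rintegral => x /set_mem /fg. Qed.

Lemma RintN f : rint f ->
  \int[mu]_(x in D) (- f x) = - \int[mu]_(x in D) f x.
Proof.
by move=> hf; rewrite -mulN1r -RintZ//; apply: eq_Rint => x _; rewrite mulN1r.
Qed.

Lemma le_Rint f g : rint f -> rint g -> (forall x, D x -> f x <= g x) ->
  \int[mu]_(x in D) f x <= \int[mu]_(x in D) g x.
Proof. by move=> *; exact: le_Rintegral. Qed.

Lemma Rint_sq_ge0 f : 0 <= \int[mu]_(x in D) (f x ^+ 2).
Proof. by apply: Rintegral_ge0 => x _; exact: sqr_ge0. Qed.

Lemma EFin_Rint f : rint f ->
  (\int[mu]_(x in D) (f x)%:E)%E = (\int[mu]_(x in D) f x)%:E.
Proof. by move=> hf; rewrite fineK//; exact: integrable_fin_num. Qed.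

Lemma Rint_sqD f g : sqint f -> sqint g ->
  \int[mu]_(x in D) ((f x + g x) ^+ 2) = \int[mu]_(x in D) (f x ^+ 2) +
  2 * \int[mu]_(x in D) (f x * g x) + \int[mu]_(x in D) (g x ^+ 2).
Proof.
move=> sf sg; have fg := rint_sqM sf sg; have [_ f2] := sf; have [_ g2] := sg.
have fg2 := rintZ 2 fg.
rewrite -RintZ// -RintD// -RintD//; last exact: rintD.
by apply: eq_Rint => x _; ring.
Qed.

Lemma cauchy_schwarz f g : sqint f -> sqint g ->
  (\int[mu]_(x in D) (f x * g x)) ^+ 2 <=
  (\int[mu]_(x in D) (f x ^+ 2)) * (\int[mu]_(x in D) (g x ^+ 2)).
Proof.
move=> sf sg.
have A0 := Rint_sq_ge0 f; have B0 := Rint_sq_ge0 g.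
apply: discriminant_le => // s t.
have := Rint_sq_ge0 (fun x => s * f x + t * g x).
rewrite Rint_sqD; [|exact: sqintZ|exact: sqintZ].
have fg := rint_sqM sf sg; have [_ f2] := sf; have [_ g2] := sg.
rewrite (_ : \int[mu]_(x in D) (s * f x * (t * g x)) =
   (s * t) * \int[mu]_(x in D) (f x * g x)); last first.
  by rewrite -RintZ//; apply: eq_Rint => x _; ring.
rewrite (_ : \int[mu]_(x in D) ((s * f x) ^+ 2) =
   s ^+ 2 * \int[mu]_(x in D) (f x ^+ 2)); last first.
  by rewrite -RintZ//; apply: eq_Rint => x _; ring.
rewrite (_ : \int[mu]_(x in D) ((t * g x) ^+ 2) =
   t ^+ 2 * \int[mu]_(x in D) (g x ^+ 2)); last first.
  by rewrite -RintZ//; apply: eq_Rint => x _; ring.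
by rewrite !mulrA.
Qed.

End SquareIntegrable.

(** * Completeness of the space of square integrable functions *)

Section Completeness.
Context {d} {T : measurableType d} {R : realType}.
Variables (mu : {measure set T -> \bar R}) (D : set T).
Hypothesis mD : measurable D.

Lemma sum_half_le2 (n : nat) : \sum_(0 <= j < n) (2^-1 : R) ^+ j <= 2.
Proof.
have -> : \sum_(0 <= j < n) (2^-1 : R) ^+ j = 2 - 2 * 2^-1 ^+ n.
  elim: n => [|n IHn]; first by rewrite big_geq// expr0 mulr1 subrr.
  rewrite big_nat_recr//= IHn exprS; lra.
have : 0 <= (2^-1 : R) ^+ n by rewrite exprn_ge0.
lra.
Qed.

(** Weighted by powers of 2, summable squares of increments control the
    increments themselves: a <= 2^-j + 2^j a^2. *)
Lemma summable_increments_cvg (u : nat -> R) (L : R) :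
  (forall n, \sum_(0 <= j < n) (2 ^+ j * (u j.+1 - u j) ^+ 2) <= L) ->
  cvgn u.
Proof.
move=> hL.
have ca : cvgn [normed series (telescope u)].
  apply: nondecreasing_is_cvgn.
    by apply: nondecreasing_series => j _ _; exact: normr_ge0.
  exists (2 + L) => _ [n _ <-] /=.
  apply: (@le_trans _ _ (\sum_(0 <= j < n) (2^-1 ^+ j + 2 ^+ j * (u j.+1 - u j) ^+ 2))).
    apply: ler_sum => j _; rewrite /telescope/=.
    rewrite -[in leRHS](real_normK (num_real (u j.+1 - u j))).
    have := normr_ge0 (u j.+1 - u j); move: (`|u j.+1 - u j|) => a a0.
    have c0 : (0 : R) < 2 ^+ j by rewrite exprn_gt0.
    rewrite exprVn; move: c0; move: (2 ^+ j) => c c0.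
    rewrite -(ler_pM2l c0) mulrDr divff ?gt_eqF//; nra.
  by rewrite big_split/= lerD// sum_half_le2.
have /cvg_ex[l] := normed_cvg ca.
rewrite telescopeK => hl; apply/cvg_ex; exists (l + u 0%N).
have h := cvgD hl (cvg_cst (u 0%N)).
have E : [sequence u n - u 0%N]_n + cst (u 0%N) = u.
  by apply/funext => n; rewrite fctE /= subrK.
rewrite E in h; exact: h.
Qed.

(** The series of the weighted squared increments has a finite integral, hence
    is finite almost everywhere, and where it is finite the sequence converges. *)
Lemma ae_cvg_fast (u : nat -> T -> R) :
  (forall n, sqint mu D (u n)) ->
  (forall j, \int[mu]_(x in D) ((u j.+1 x - u j x) ^+ 2) <= (4^-1) ^+ j) ->
  {ae mu, forall x, D x -> cvgn (u ^~ x)}.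
Proof.
move=> su hu.
pose b j x := 2 ^+ j * (u j.+1 x - u j x) ^+ 2.
have ib j : rint mu D (b j).
  by apply: rintZ => //; have [] := sqintB mD (su j.+1) (su j).
pose H x := (\sum_(0 <= j <oo) (b j x)%:E)%E.
have b0 j x : 0 <= b j x by rewrite mulr_ge0// ?sqr_ge0// exprn_ge0.
have mb j : measurable_fun D (EFin \o b j) by exact: measurable_int (ib j).
have mH : measurable_fun D H.
  by apply: ge0_emeasurable_sum => *; [rewrite lee_fin|exact: mb].
have H0 x : (0 <= H x)%E by apply: nneseries_ge0 => *; rewrite lee_fin.
have iH : mu.-integrable D H.
  apply/integrableP; split => //.
  under eq_integral do rewrite gee0_abs ?H0//.
  rewrite integral_nneseries//; last by move=> j x _; rewrite lee_fin.
  apply: (@le_lt_trans _ _ 2%:E); last exact: ltry.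
  apply: lime_le.
    by apply: is_cvg_nneseries => j _ _; apply: integral_ge0 => x _; rewrite lee_fin.
  apply: nearW => n; apply: (le_trans _ (_ : (\sum_(0 <= j < n) (2^-1 : R) ^+ j)%:E <= _)%E); last first.
    by rewrite lee_fin sum_half_le2.
  rewrite -sumEFin; apply: lee_sum => j _.
  rewrite EFin_Rint// lee_fin RintZ//; last first.
    by have [] := sqintB mD (su j.+1) (su j).
  apply: (le_trans (ler_wpM2l _ (hu j))); first by rewrite exprn_ge0.
  have -> : (2^-1 : R) ^+ j = 2 ^+ j * 4^-1 ^+ j.
    by rewrite -exprMn; congr (_ ^+ _); field.
  exact: lexx.
have := integrable_ae mD iH; apply: filterS => x hx Dx.
have := hx Dx => Hfin.
apply: (@summable_increments_cvg _ (fine (H x))) => n.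
rewrite -lee_fin fineK// -sumEFin.
by apply: (@nneseries_lim_ge _ (fun j => (b j x)%:E) xpredT 0%N n) => *; rewrite lee_fin.
Qed.

(** Riesz-Fischer. A fast subsequence converges almost everywhere, and Fatou
    turns this into convergence in norm of the whole Cauchy sequence. *)
Lemma L2_complete (g : nat -> T -> R) :
  (forall n, sqint mu D (g n)) ->
  (forall e, 0 < e -> exists N, forall n m, (N <= n)%N -> (N <= m)%N ->
     \int[mu]_(x in D) ((g n x - g m x) ^+ 2) <= e) ->
  exists G, sqint mu D G /\
   forall e, 0 < e -> exists N, forall n, (N <= n)%N ->
     \int[mu]_(x in D) ((g n x - G x) ^+ 2) <= e.
Proof.
move=> sg hg.
have e0 j : (0 : R) < (4^-1) ^+ j by rewrite exprn_gt0.
pose N j := projT1 (cid (hg _ (e0 j))).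
have hN j := projT2 (cid (hg _ (e0 j))).
(* indices that increase and exceed N j, so that u is a fast subsequence *)
pose k j := (\sum_(0 <= i < j.+1) (N i).+1)%N.
have kS j : (k j <= k j.+1)%N by rewrite /k (big_nat_recr j.+1)//= leq_addr.
have kN j : (N j <= k j)%N by rewrite /k (big_nat_recr j)//= (leq_trans (leqnSn _))// leq_addl.
pose u j := g (k j).
have mon : {homo k : i j / (i <= j)%N >-> (i <= j)%N}.
  by apply: homo_leq => // a b c; exact: leq_trans.
have ge j n : (j <= n)%N -> (N j <= k n)%N.
  by move=> jn; rewrite (leq_trans (kN j))// mon.
have aeu : {ae mu, forall x, D x -> cvgn (u ^~ x)}.
  apply: ae_cvg_fast => [n|j]; first exact: sg.
  by apply: hN; [exact: ge|exact: kN].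
pose G x := fine (limn_esup (fun j => (u j x)%:E)).
have mG : measurable_fun D G.
  apply: measurableT_comp => //; apply: measurable_fun_limn_esup => j.
  by apply/measurable_EFinP; case: (sg (k j)).
have Glim : {ae mu, forall x, D x -> u ^~ x @ \oo --> G x}.
  apply: filterS aeu => x hx Dx; have /cvg_ex[l hl] := hx Dx.
  suff -> : G x = l by [].
  rewrite /G; have hl' : (fun j => (u j x)%:E) @ \oo --> l%:E.
    by apply: cvg_EFin; [exact: nearW|exact: hl].
  by have [_ ->] := cvg_limn_einf_sup hl'.
have key e : 0 < e -> exists N, forall n, (N <= n)%N ->
    (\int[mu]_(x in D) ((g n x - G x) ^+ 2)%:E <= e%:E)%E.
  move=> ep; have [N0 hN0] := hg _ ep; exists N0 => n Nn.
  have mgu j : measurable_fun D (fun x => ((g n x - u j x) ^+ 2)%:E).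
    apply/measurable_EFinP/measurable_funX/measurable_funB.
      by case: (sg n).
    by case: (sg (k j)).
  have -> : (\int[mu]_(x in D) ((g n x - G x) ^+ 2)%:E =
      \int[mu]_(x in D) limn_einf (fun j => ((g n x - u j x) ^+ 2)%:E))%E.
    apply: ae_eq_integral => //.
    - apply/measurable_EFinP/measurable_funX/measurable_funB => //.
      by case: (sg n).
    - rewrite (_ : (fun x => _) = (fun x => - limn_esup (fun j => - ((g n x - u j x) ^+ 2)%:E)))%E//.
      apply: measurableT_comp => //; apply: measurable_fun_limn_esup => j.
      exact: measurableT_comp.
    - apply: filterS Glim => x hx Dx; apply/esym.
      have h : (fun j => ((g n x - u j x) ^+ 2)%:E) @ \oo --> ((g n x - G x) ^+ 2)%:E.
        apply: cvg_EFin; first exact: nearW.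
        have hB : (fun j => g n x - u j x) @ \oo --> g n x - G x.
          by apply: cvgB; [exact: cvg_cst|exact: hx].
        exact: (cvgM hB hB).
      by have [-> _] := cvg_limn_einf_sup h.
  apply: le_trans (fatou mu mD mgu _) _.
    by move=> j x _; rewrite lee_fin sqr_ge0.
  rewrite limn_einf_lim; apply: lime_le; first exact: is_cvg_einfs.
  apply: nearW => i /=; apply: (@le_trans _ _
     (\int[mu]_(x in D) ((g n x - u (i + N0)%N x) ^+ 2)%:E)%E).
    by apply: ereal_inf_lbound; exists (i + N0)%N => //=; rewrite leq_addr.
  rewrite EFin_Rint//; last by case: (sqintB mD (sg n) (sg (k (i + N0)%N))).
  rewrite lee_fin; apply: hN0 => //.
  have kid j : (j <= k j)%N.
    elim: j => // j IHj; rewrite /k (big_nat_recr j.+1)//= addnS ltnS.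
    by apply: (leq_trans IHj); exact: leq_addr.
  by rewrite (leq_trans _ (kid _))// leq_addl.
have fin_sq n N1 e : (N1 <= n)%N ->
    (forall n, (N1 <= n)%N -> (\int[mu]_(x in D) ((g n x - G x) ^+ 2)%:E <= e%:E)%E) ->
    sqint mu D (fun x => g n x - G x).
  move=> Nn /(_ n Nn) h; split.
    by apply: measurable_funB => //; case: (sg n).
  apply/integrableP; split.
    apply/measurable_EFinP/measurable_funX/measurable_funB => //.
    by case: (sg n).
  apply: le_lt_trans (ltry e); apply: le_trans h.
  rewrite le_eqVlt; apply/orP; left; apply/eqP; apply: eq_integral => x _ /=.
  by rewrite ger0_norm ?sqr_ge0.
have sG : sqint mu D G.
  have [N1 hN1] := key 1 ltr01.
  have := sqintB mD (sg N1) (fin_sq N1 N1 1 (leqnn _) hN1).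
  by congr sqint; apply/funext => x; ring.
exists G; split => // e ep; have [N1 hN1] := key e ep; exists N1 => n Nn.
rewrite -lee_fin -EFin_Rint ?hN1//.
by case: (sqintB mD (sg n) sG).
Qed.

End Completeness.

(** * Square integrable fields and orthogonal projection *)

Lemma norm_le_sqr (R : realDomainType) (x e : R) : 0 <= e -> x ^+ 2 <= e ^+ 2 ->
  `|x| <= e.
Proof.
move=> e0; rewrite -(real_normK (num_real x)).
by rewrite ler_pXn2r ?nnegrE.
Qed.

Section Fields.
Context {d} {T : measurableType d} {R : realType}.
Variables (mu : {measure set T -> \bar R}) (D : set T).
Hypothesis mD : measurable D.
Implicit Types (G H K : T -> R * R).

Definition sq2 G := sqint mu D (fun z => (G z).1) /\ sqint mu D (fun z => (G z).2).

Definition ip G H : R := \int[mu]_(z in D) dotp (G z) (H z).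

Lemma sq2D G H : sq2 G -> sq2 H -> sq2 (fun z => G z + H z).
Proof. by move=> [? ?] [? ?]; split; exact: sqintD. Qed.

Lemma sq2B G H : sq2 G -> sq2 H -> sq2 (fun z => G z - H z).
Proof. by move=> [? ?] [? ?]; split; exact: sqintB. Qed.

Lemma sq2Z c G : sq2 G -> sq2 (fun z => c *: G z).
Proof. by move=> [? ?]; split; exact: sqintZ. Qed.

Lemma rint_dot G H : sq2 G -> sq2 H -> rint mu D (fun z => dotp (G z) (H z)).
Proof. by move=> [? ?] [? ?]; apply: rintD => //; exact: rint_sqM. Qed.

Lemma dotpC (u v : R * R) : dotp u v = dotp v u.
Proof. by rewrite /dotp mulrC [in X in _ + X]mulrC. Qed.

Lemma ipC G H : ip G H = ip H G.
Proof. by apply: eq_Rint => z _; exact: dotpC. Qed.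

Lemma ipDl G H K : sq2 G -> sq2 H -> sq2 K ->
  ip (fun z => G z + H z) K = ip G K + ip H K.
Proof.
move=> *; rewrite /ip -RintD//; [|exact: rint_dot|exact: rint_dot].
by apply: eq_Rint => z _; rewrite /dotp /=; ring.
Qed.

Lemma ipZl c G K : sq2 G -> sq2 K -> ip (fun z => c *: G z) K = c * ip G K.
Proof.
move=> *; rewrite /ip -RintZ//; last exact: rint_dot.
by apply: eq_Rint => z _; rewrite /dotp /= mulrDr !mulrA.
Qed.

Lemma ipBl G H K : sq2 G -> sq2 H -> sq2 K ->
  ip (fun z => G z - H z) K = ip G K - ip H K.
Proof.
move=> *; rewrite /ip -RintB//; [|exact: rint_dot|exact: rint_dot].
by apply: eq_Rint => z _; rewrite /dotp /=; ring.
Qed.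

Lemma ipDr G H K : sq2 G -> sq2 H -> sq2 K ->
  ip K (fun z => G z + H z) = ip K G + ip K H.
Proof. by move=> *; rewrite ipC ipDl// !(ipC K). Qed.

Lemma ipBr G H K : sq2 G -> sq2 H -> sq2 K ->
  ip K (fun z => G z - H z) = ip K G - ip K H.
Proof. by move=> *; rewrite ipC ipBl// !(ipC K). Qed.

Lemma ipZr c G K : sq2 G -> sq2 K -> ip K (fun z => c *: G z) = c * ip K G.
Proof. by move=> *; rewrite ipC ipZl// (ipC K). Qed.

Lemma ip_ge0 G : 0 <= ip G G.
Proof. by apply: Rintegral_ge0 => z _; rewrite /dotp -!expr2 addr_ge0// sqr_ge0. Qed.

Lemma ip_sqint G : sq2 G -> ip G G =
  \int[mu]_(z in D) ((G z).1 ^+ 2) + \int[mu]_(z in D) ((G z).2 ^+ 2).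
Proof. by move=> [[_ ?] [_ ?]]; rewrite -RintD. Qed.

Lemma ip_sqB G H : sq2 G -> sq2 H ->
  ip (fun z => G z - H z) (fun z => G z - H z) = ip G G - 2 * ip G H + ip H H.
Proof.
move=> sG sH; rewrite ipBl ?ipBr//; last exact: sq2B.
by rewrite (ipC H G); ring.
Qed.

Lemma ip_cauchy_schwarz G H : sq2 G -> sq2 H -> ip G H ^+ 2 <= ip G G * ip H H.
Proof.
move=> sG sH; apply: discriminant_le; [exact: ip_ge0|exact: ip_ge0|].
move=> s t; have := ip_ge0 (fun z => s *: G z + t *: H z).
have h1 := sq2Z s sG; have h2 := sq2Z t sH.
rewrite ipDl ?ipDr//; last exact: sq2D.
by rewrite !ipZl ?ipZr// (ipC H G); lra.
Qed.

(** Convexity of the square norm: the tangent at G lies below it. *)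
Lemma ip_convex G H : sq2 G -> sq2 H -> ip G G + 2 * ip G (fun z => H z - G z) <= ip H H.
Proof.
move=> sG sH; have := ip_ge0 (fun z => H z - G z).
by rewrite ip_sqB// ipBr// (ipC H G); lra.
Qed.

Definition L2lim (A : nat -> T -> R * R) G :=
  forall e, 0 < e -> exists N, forall n, (N <= n)%N ->
    ip (fun z => A n z - G z) (fun z => A n z - G z) <= e.

Lemma L2lim_ip A G K : (forall n, sq2 (A n)) -> sq2 G -> sq2 K ->
  L2lim A G -> (fun n => ip (A n) K) @ \oo --> ip G K.
Proof.
move=> sA sG sK hA; apply/cvgrPdist_le => e e0.
have e1 : 0 < e ^+ 2 / (ip K K + 1).
  by rewrite divr_gt0 ?exprn_gt0// ltr_wpDl// ip_ge0.
have [N hN] := hA _ e1; exists N => // n /= Nn.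
rewrite distrC -ipBl//; apply: norm_le_sqr; first exact: ltW.
apply: (le_trans (ip_cauchy_schwarz _ sK)); first exact: sq2B.
have := hN _ Nn; have := ip_ge0 (fun z => A n z - G z).
have := ip_ge0 K; set k := ip K K; set a := ip _ _; move=> k0 a0.
rewrite ler_pdivlMr ?ltr_wpDl// => h; nra.
Qed.

Lemma L2lim_sq A G : (forall n, sq2 (A n)) -> sq2 G ->
  L2lim A G -> (fun n => ip (A n) (A n)) @ \oo --> ip G G.
Proof.
move=> sA sG hA.
have h1 := L2lim_ip sA sG sG hA.
have h2 : (fun n => ip (fun z => A n z - G z) (fun z => A n z - G z)) @ \oo --> (0 : R).
  apply/cvgrPdist_le => e /hA[N hN]; exists N => // n /= Nn.
  by rewrite sub0r normrN ger0_norm ?ip_ge0// hN.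
have h4 : (fun n => 2 * ip (A n) G) @ \oo --> 2 * ip G G by exact: cvgMl_tmp.
have h3 := cvgB (cvgD h2 h4) (cvg_cst (ip G G)).
have E : 0 + 2 * ip G G - ip G G = ip G G by ring.
rewrite E in h3; rewrite (_ : (fun n => ip (A n) (A n)) = (fun n => ip (fun z => A n z - G z) (fun z => A n z - G z)) +
  (fun n => 2 * ip (A n) G) - cst (ip G G)); first exact: h3.
by apply/funext => n; rewrite !fctE ip_sqB//; ring.
Qed.

Variable S : set (T -> R * R).
Hypothesis S0 : S (fun=> 0).
Hypothesis SD : forall c A B, S A -> S B -> S (fun z => c *: A z + B z).
Hypothesis Ssq : forall A, S A -> sq2 A.

Let nrm K A := ip (fun z => K z - A z) (fun z => K z - A z).

(** Orthogonal projection onto the closure of the linear space S. The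
    parallelogram identity makes a minimizing sequence a Cauchy sequence; its
    limit is orthogonal to S because moving along B cannot decrease the
    distance. *)
Lemma projection_exists K : sq2 K -> exists G, [/\ sq2 G,
  exists A, (forall n, S (A n)) /\ L2lim A G &
  forall A, S A -> ip K A = ip G A].
Proof.
move=> sK.
pose I := inf [set nrm K A | A in S].
have hI : has_inf [set nrm K A | A in S].
  split; first by exists (nrm K (fun=> 0)), (fun=> 0).
  by exists 0 => _ [A _ <-]; exact: ip_ge0.
have Ilb A : S A -> I <= nrm K A.
  by move=> SA; apply: inf_lbound; [exact: hI.2|exists A].
have Iad (n : nat) : exists A, S A /\ nrm K A < I + n.+1%:R^-1.
  have n0 : (0 : R) < n.+1%:R^-1 by rewrite invr_gt0.
  by have [_ [A SA <-] hA] := inf_adherent n0 hI; exists A.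
pose A n := projT1 (cid (Iad n)).
have SA n : S (A n) := (projT2 (cid (Iad n))).1.
have hA n : nrm K (A n) < I + n.+1%:R^-1 := (projT2 (cid (Iad n))).2.
have sA n := Ssq (SA n).
have par n m : ip (fun z => A n z - A m z) (fun z => A n z - A m z) <=
    2 * n.+1%:R^-1 + 2 * m.+1%:R^-1.
  (* the midpoint of A n and A m *)
  have SM : S (fun z => 2^-1 *: (A n z - A m z) + A m z).
    have h1 : S (fun z => (-1) *: A m z + A n z) by exact: SD.
    have := SD (2^-1) h1 (SA m); congr S; apply/funext => z.
    by rewrite scaleN1r addrC [- _ + _]addrC addrC.
  have := Ilb _ SM; have := hA n; have := hA m; rewrite /nrm.
  have s1 := sq2B (sA n) (sA m); have s2 := sq2D (sq2Z (2^-1) s1) (sA m).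
  rewrite !ip_sqB// (ipDr (sq2Z (2^-1) s1))//.
  rewrite (ipDl (sq2Z (2^-1) s1))// (ipDr (sq2Z (2^-1) s1))//; last exact: sq2Z.
  rewrite (ipDr (sq2Z (2^-1) s1))//.
  have sz := sq2Z (2^-1) s1.
  rewrite !ipZl// !ipZr// !ipBl// !ipBr// (ipC (A m) (A n)).
  by move: (_ ^-1) (m.+1%:R^-1) => a b; lra.
have small e : 0 < e -> exists N, forall n, (N <= n)%N -> n.+1%:R^-1 <= e :> R.
  move=> e0; have [N _ hN] := @near_infty_natSinv_lt R (PosNum e0).
  by exists N => n /hN /ltW.
have cauchy e : 0 < e -> exists N, forall n m, (N <= n)%N -> (N <= m)%N ->
    ip (fun z => A n z - A m z) (fun z => A n z - A m z) <= e.
  move=> e0; have [|N hN] := small (e / 4); first by rewrite divr_gt0.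
  exists N => n m /hN hn /hN hm; apply: (le_trans (par n m)).
  by move: hn hm; move: (_ ^-1) (m.+1%:R^-1) => a b; lra.
have [G1 [sG1 hG1]] : exists G1 : T -> R, sqint mu D G1 /\
   forall e, 0 < e -> exists N, forall n, (N <= n)%N ->
     \int[mu]_(z in D) (((A n z).1 - G1 z) ^+ 2) <= e.
  apply: (L2_complete mD (fun n => (sA n).1)) => e /cauchy[N hN].
  exists N => n m Nn Nm; apply: le_trans (hN n m Nn Nm).
  rewrite ip_sqint; last exact: sq2B.
  by rewrite lerDl Rint_sq_ge0.
have [G2 [sG2 hG2]] : exists G2 : T -> R, sqint mu D G2 /\
   forall e, 0 < e -> exists N, forall n, (N <= n)%N ->
     \int[mu]_(z in D) (((A n z).2 - G2 z) ^+ 2) <= e.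
  apply: (L2_complete mD (fun n => (sA n).2)) => e /cauchy[N hN].
  exists N => n m Nn Nm; apply: le_trans (hN n m Nn Nm).
  rewrite ip_sqint; last exact: sq2B.
  by rewrite lerDr Rint_sq_ge0.
pose G z := (G1 z, G2 z).
have sG : sq2 G by split.
have AG : L2lim A G.
  move=> e e0; have e2 : 0 < e / 2 by rewrite divr_gt0.
  have [N1 h1] := hG1 _ e2; have [N2 h2] := hG2 _ e2.
  exists (maxn N1 N2) => n; rewrite geq_max => /andP[/h1 {}h1 /h2 {}h2].
  rewrite ip_sqint; last exact: sq2B.
  by apply: (le_trans (lerD h1 h2)); rewrite -splitr.
exists G; split => //; first by exists A.
move=> B SB; have sB := Ssq SB.
have lim_x : (fun n => ip K B - ip (A n) B) @ \oo --> ip K B - ip G B.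
  by apply: cvgB; [exact: cvg_cst|exact: L2lim_ip].
have lim_i : (fun n : nat => n.+1%:R^-1 : R) @ \oo --> (0 : R).
  apply/cvgrPdist_le => e /small[N hN]; exists N => // n /= /hN.
  by rewrite sub0r normrN ger0_norm.
have key c : 0 <= - (2 * c) * (ip K B - ip G B) + c ^+ 2 * ip B B.
  have h : (fun n => - (2 * c) * (ip K B - ip (A n) B) + c ^+ 2 * ip B B + n.+1%:R^-1) @ \oo -->
      - (2 * c) * (ip K B - ip G B) + c ^+ 2 * ip B B + 0.
    apply: cvgD => //; apply: cvgD; last exact: cvg_cst.
    exact: cvgMl_tmp.
  rewrite addr0 in h; apply: (cvgr_to_ge h); apply: nearW => n.
  have SAB : S (fun z => c *: B z + A n z) by exact: SD.
  have := Ilb _ SAB; have := hA n; rewrite /nrm.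
  have sc := sq2Z c sB.
  rewrite !ip_sqB//; last exact: sq2D.
  rewrite (ipDr sc (sA n) sK) (ipDl sc (sA n)); last exact: sq2D.
  rewrite !(ipDr sc (sA n))// !ipZl// !ipZr// (ipC B (A n)).
  by move: (_ ^-1) => a; lra.
have : ip K B - ip G B = 0.
  (* close to the minimizer c of the quadratic polynomial; the denominator is
     positive also when B = 0 *)
  have := key ((ip K B - ip G B) / (ip B B + 1)).
  have b0 := ip_ge0 B; move: b0 (ip K B - ip G B) => b0 x; move: (ip B B) b0 => b b0.
  have b1 : b + 1 != 0 by rewrite gt_eqF// ltr_wpDl.
  rewrite (_ : _ + _ = - x ^+ 2 * (b + 2) / (b + 1) ^+ 2); last by field.
  rewrite pmulr_lge0 ?invr_gt0 ?exprn_gt0 ?ltr_wpDl// mulNr oppr_ge0.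
  rewrite pmulr_lle0; last by rewrite ltr_wpDl.
  by move=> h; apply/eqP; rewrite -sqrf_eq0 eq_le h sqr_ge0.
by move/eqP; rewrite subr_eq0 => /eqP.
Qed.

End Fields.

(** * Absolutely continuous functions *)

Lemma compact_norm_le (R : realType) (V : normedModType R) (K : set V) :
  compact K -> exists M, forall x, K x -> `|x| <= M.
Proof.
move=> /compact_bounded[M [_ hM]]; exists (M + 1) => x Kx.
by apply: hM => //; rewrite ltrDl.
Qed.

Section Primitives.
Context {R : realType}.
Notation mu := (@lebesgue_measure R).
Implicit Types (f g F G : R -> R) (a b : R).

(** Integrability on every segment. This is local integrability
    (linc_locally_integrable), in the form that integrals over segments use. *)
Definition linc f := forall a b : R, rint mu `[a, b] f.

Lemma mitv a b : measurable (`[a, b]%classic : set (measurableTypeR R)).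
Proof. exact: measurable_itv. Qed.
Local Hint Resolve mitv : core.

Lemma bigcup_itvT : \bigcup_n `[- n%:R, n%:R]%classic = [set: R].
Proof.
rewrite -subTset => x _; exists (Num.bound `|x|) => //=.
rewrite in_itv/= -ler_norml ltW// (lt_le_trans (archi_boundP _))//.
Qed.

Lemma linc_measurable f : linc f -> measurable_fun setT f.
Proof.
move=> h; rewrite -bigcup_itvT; apply/measurable_fun_bigcup => //.
by move=> n; exact: rint_measurable (h _ _).
Qed.

Lemma linc_locally_integrable f : linc f <-> locally_integrable setT f.
Proof.
split=> [h|[mf _ h] a b].
  split; [exact: linc_measurable|exact: openT|move=> K _ cK].
  have [M hM] := compact_norm_le cK.
  have KM : K `<=` `[- M, M].
    by move=> x /hM; rewrite /= in_itv/= ler_norml.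
  have /integrableP[_ //] : mu.-integrable K (EFin \o f).
    apply: (@integrableS _ _ _ mu `[- M, M]%classic K) => //; last exact: h.
    exact: compact_measurable.
apply/integrableP; split.
  by apply/measurable_EFinP; exact: measurable_funS mf.
by apply: h => //; exact: segment_compact.
Qed.

Lemma linc_bounded f C : measurable_fun setT f -> (forall x, `|f x| <= C) -> linc f.
Proof.
move=> mf hC a b; apply: (@le_rint _ _ _ _ _ (mitv a b) _ (cst C)).
- exact: measurable_funS mf.
- by move=> x _; exact: hC.
apply: continuous_compact_integrable; first exact: segment_compact.
by apply: continuous_subspaceT; exact: cst_continuous.
Qed.

Lemma continuous_linc f : continuous f -> linc f.
Proof.
move=> cf a b; apply: continuous_compact_integrable; first exact: segment_compact.
exact: continuous_subspaceT.
Qed.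

Lemma continuous_bounded_itv f a b : continuous f ->
  exists M, forall x, x \in `[a, b] -> `|f x| <= M.
Proof.
move=> cf; have : compact (f @` `[a, b]).
  apply: continuous_compact; last exact: segment_compact.
  exact: continuous_subspaceT.
move=> /compact_norm_le[M hM]; exists M => x xab.
by apply: hM; exists x.
Qed.

Lemma linc_contM f g : continuous f -> linc g -> linc (fun x => f x * g x).
Proof.
move=> cf lg a b; have [M hM] := continuous_bounded_itv a b cf.
apply: (@rintMb _ _ _ mu _ (mitv a b) M); [|by move=> x /= /hM|exact: lg].
by apply: measurable_funTS; exact: continuous_measurable_fun.
Qed.

Lemma lincD f g : linc f -> linc g -> linc (fun x => f x + g x).
Proof. by move=> hf hg a b; exact: rintD. Qed.

Lemma lincZ c f : linc f -> linc (fun x => c * f x).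
Proof. by move=> hf a b; exact: rintZ. Qed.

Lemma lincB f g : linc f -> linc g -> linc (fun x => f x - g x).
Proof. by move=> hf hg a b; exact: rintB. Qed.

Lemma linc_norm f : linc f -> linc (fun x => `|f x|).
Proof. by move=> hf a b; exact: rint_norm. Qed.

Lemma rint_linc f : rint mu setT f -> linc f.
Proof. by move=> hf a b; exact: (@integrableS _ _ _ mu setT). Qed.

Lemma Rint_itvD f a b c : linc f -> a <= b -> b <= c ->
  \int[mu]_(x in `[a, c]) f x =
  \int[mu]_(x in `[a, b]) f x + \int[mu]_(x in `[b, c]) f x.
Proof.
move=> lf ab bc.
have := @Rintegral_itvB R f (BLeft a) (BRight c) b (lf a c).
rewrite !bnd_simp => /(_ ab bc) h.
rewrite -(@Rintegral_itv_obnd_cbnd _ b (BRight c)); last first.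
  apply: integrableS (lf b c) => //; exact: subset_itv_oc_cc.
by rewrite -h addrC subrK.
Qed.

Lemma Rint_itv1 f a : \int[mu]_(x in `[a, a]) f x = 0.
Proof. by rewrite set_itv1 Rintegral_set1. Qed.

(** F is absolutely continuous with derivative f almost everywhere. The
    fundamental theorem of calculus serves as the definition, so f matters only
    up to null sets and no pointwise derivative of F is involved. *)
Definition prim F f := linc f /\
  forall a b, a <= b -> F b - F a = \int[mu]_(x in `[a, b]) f x.

Lemma prim_exists f : linc f -> exists F, prim F f /\ F 0 = 0.
Proof.
move=> lf; exists (fun x => if 0 <= x then \int[mu]_(t in `[0, x]) f t
                    else - \int[mu]_(t in `[x, 0]) f t).
split; last by rewrite lexx Rint_itv1.
split => // a b ab; case: ifPn => [b0|]; last rewrite -ltNge => b0.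
  case: ifPn => [a0|]; first by rewrite (Rint_itvD lf a0 ab) addrC addKr.
  rewrite -ltNge => /ltW a0; rewrite opprK addrC -Rint_itvD//.
rewrite leNgt (le_lt_trans ab b0)/= (Rint_itvD lf ab (ltW b0)).
by rewrite opprK addrC addrK.
Qed.

Lemma eq_prim F G f : prim F f -> F =1 G -> prim G f.
Proof. by move=> h /funext <-. Qed.

Lemma primD F G f g : prim F f -> prim G g ->
  prim (fun x => F x + G x) (fun x => f x + g x).
Proof.
move=> [lf hF] [lg hG]; split; first exact: lincD.
by move=> a b ab; rewrite RintD// -hF// -hG//; ring.
Qed.

Lemma primZ c F f : prim F f -> prim (fun x => c * F x) (fun x => c * f x).
Proof.
move=> [lf hF]; split; first exact: lincZ.
by move=> a b ab; rewrite RintZ// -hF//; ring.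
Qed.

Lemma primB F G f g : prim F f -> prim G g ->
  prim (fun x => F x - G x) (fun x => f x - g x).
Proof.
move=> [lf hF] [lg hG]; split; first exact: lincB.
by move=> a b ab; rewrite RintB// -hF// -hG//; ring.
Qed.

Lemma prim_cst c : prim (cst c) (cst 0).
Proof.
split; first by apply: continuous_linc => x; exact: cvg_cst.
by move=> a b _; rewrite subrr Rintegral_cst// mul0r.
Qed.

Lemma prim_le F f a b : prim F f -> (forall x, 0 <= f x) -> a <= b -> F a <= F b.
Proof.
by move=> [_ h] f0 ab; rewrite -subr_ge0 h//; apply: Rintegral_ge0.
Qed.

Lemma prim_norm_le F f A a b : prim F f -> prim A (fun x => `|f x|) -> a <= b ->
  `|F b - F a| <= A b - A a.
Proof.
move=> [lf hF] [_ hA] ab; rewrite hF// hA//.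
by apply: le_normr_Rintegral => //; exact: lf.
Qed.

Lemma prim_continuous F f : prim F f -> continuous F.
Proof.
move=> [lf hF] x.
have xx : x \in `]x - 1, x + 1[ by rewrite in_itv/= ltrBlDr ltrDl ltr01.
have lt1 : x - 1 < x + 1 by lra.
have h := parameterized_integral_continuous (ltW lt1) (lf (x - 1) (x + 1)).
have hw : {within `[x - 1, x + 1], continuous F}.
  apply: (@subspace_eq_continuous _ _ _ (fun y => \int[mu]_(t in `[x - 1, y]) f t + F (x - 1))).
    move=> y /set_mem /=; rewrite in_itv/= => /andP[xy _].
    by rewrite -hF// subrK.
  by apply: within_continuousD => //; apply: continuous_subspaceT => y; exact: cvg_cst.
exact: (within_continuous_continuous lt1 hw).
Qed.

End Primitives.

(** * Product and chain rules *)

Section ProductRule.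
Context {R : realType}.
Notation mu := (@lebesgue_measure R).
Implicit Types (f g F G A B h : R -> R) (a b : R).
Local Hint Resolve mitv : core.

(** Continuous induction: P propagates from a to b if it propagates within a
    neighbourhood of every point. *)
Lemma real_induction (P : R -> Prop) a b : a <= b -> P a ->
  (forall c, a <= c <= b -> exists2 d, 0 < d & forall t u,
     c - d < t -> t <= u -> u < c + d -> a <= t -> u <= b -> P t -> P u) ->
  P b.
Proof.
move=> ab Pa step.
pose E := [set t | a <= t <= b /\ P t].
have Ea : E a by rewrite /E /= lexx ab.
have hE : has_sup E by split; [exists a|exists b => t [/andP[]]].
have ac : a <= sup E by apply: sup_ubound => //; exact: hE.2.
have cb : sup E <= b by apply: ge_sup; [exists a|move=> t [/andP[]]].
have [|d d0 hd] := step (sup E); first by rewrite ac cb.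
have [t [/andP[at_ tb] Pt] ct] := sup_adherent d0 hE.
have tc : t <= sup E by apply: sup_ubound; [exact: hE.2|split; rewrite ?at_].
have [bs|bs] := leP b (sup E + d / 2).
  by apply: (hd t b) => //; lra.
exfalso; have : E (sup E + d / 2).
  split; first by apply/andP; split; lra.
  by apply: (hd t) => //; lra.
move=> /(sup_ubound hE.2); lra.
Qed.

(** F differs from an integral of h by an additive function of intervals. If
    this function is bounded by a product of increments of nondecreasing
    functions, one of them continuous, it vanishes: on short intervals the
    increment of A is at most e, so by continuous induction the difference is at
    most e times the increment of B, for every e. The product and chain rules
    follow from it. *)
Lemma prim_of_bound F h A B : linc h -> continuous A ->
  {homo B : x y / x <= y} -> {homo A : x y / x <= y} ->
  (forall a b, a <= b ->
    `|F b - F a - \int[mu]_(x in `[a, b]) h x| <= (A b - A a) * (B b - B a)) ->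
  prim F h.
Proof.
move=> lh cA mB mA hb; split => // a b ab.
pose H a b := F b - F a - \int[mu]_(x in `[a, b]) h x.
have HD x y z : x <= y -> y <= z -> H x z = H x y + H y z.
  by move=> xy yz; rewrite /H (Rint_itvD lh xy yz); ring.
suff key e : 0 < e -> `|H a b| <= e * (B b - B a).
  apply/eqP; rewrite -subr_eq0 -/(H a b) -normr_le0.
  have B0 : 0 <= B b - B a by rewrite subr_ge0 mB.
  apply/ler_addgt0Pr => e e0; rewrite add0r.
  have c0 : 0 < B b - B a + 1 by rewrite ltr_wpDl.
  apply: (le_trans (key (e / (B b - B a + 1)) _)); first by rewrite divr_gt0.
  by rewrite mulrAC ler_pdivrMr// ler_pM2l// lerDl.
move=> e0; apply: (@real_induction (fun t => `|H a t| <= e * (B t - B a)) a b ab).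
  by rewrite /H Rint_itv1 !subrr normr0 mulr0.
move=> c _; have e2 : 0 < e / 2 by rewrite divr_gt0.
have /cvgrPdist_lt/(_ _ e2)[d d0 hd] := cA c.
exists d => // t u ct tu uc at_ ub Pt.
rewrite (HD a t u)//; apply: (le_trans (ler_normD _ _)).
have ht : `|A c - A t| < e / 2.
  by apply: hd => /=; rewrite ltr_distlC; lra.
have hu : `|A c - A u| < e / 2.
  by apply: hd => /=; rewrite ltr_distlC; lra.
have Atu : A u - A t <= e by move: ht hu; rewrite !ltr_distlC; lra.
have := hb _ _ tu; rewrite -/(H t u) => htu.
have B1 : 0 <= B u - B t by rewrite subr_ge0 mB.
have := ler_wpM2r B1 Atu; lra.
Qed.

Lemma prim_abs F f : prim F f -> exists A, [/\ prim A (fun x => `|f x|),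
  continuous A, {homo A : x y / x <= y} &
  forall a b, a <= b -> `|F b - F a| <= A b - A a].
Proof.
move=> hF; have [A [hA _]] := prim_exists (linc_norm hF.1).
exists A; split => //; first exact: prim_continuous hA.
  by move=> a b; apply: prim_le hA _ => x.
by move=> a b; exact: prim_norm_le hF hA.
Qed.

(** After subtraction of F a and G a, all the terms are integrals over an
    interval of products of increments, which prim_of_bound absorbs. *)
Lemma primM F G f g : prim F f -> prim G g ->
  prim (fun x => F x * G x) (fun x => f x * G x + F x * g x).
Proof.
move=> hF hG; have [A [hA cA mA nA]] := prim_abs hF.
have [B [hB cB mB nB]] := prim_abs hG.
have cF := prim_continuous hF; have cG := prim_continuous hG.
have lfG : linc (fun x => f x * G x).
  rewrite (_ : (fun _ => _) = (fun x => G x * f x)).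
    exact: linc_contM cG hF.1.
  by apply/funext => x; rewrite mulrC.
have lFg : linc (fun x => F x * g x) by exact: linc_contM cF hG.1.
apply: (@prim_of_bound _ _ A (fun x => 3 * B x)) => //; first exact: lincD.
  by move=> x y xy; rewrite ler_pM2l// mB.
move=> a b ab; rewrite RintD//.
have e1 : \int[mu]_(x in `[a, b]) (f x * G x) =
   G a * (F b - F a) + \int[mu]_(x in `[a, b]) ((G x - G a) * f x).
  rewrite (hF.2 _ _ ab) -RintZ//; last exact: hF.1.
  rewrite -RintD//; [|exact: (lincZ _ hF.1)|]; last first.
    by apply: linc_contM hF.1 _ _ => x; apply: cvgB; [exact: cG|exact: cvg_cst].
  by apply: eq_Rint => x _; ring.
have e2 : \int[mu]_(x in `[a, b]) (F x * g x) =
   F a * (G b - G a) + \int[mu]_(x in `[a, b]) ((F x - F a) * g x).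
  rewrite (hG.2 _ _ ab) -RintZ//; last exact: hG.1.
  rewrite -RintD//; [|exact: (lincZ _ hG.1)|]; last first.
    by apply: linc_contM hG.1 _ _ => x; apply: cvgB; [exact: cF|exact: cvg_cst].
  by apply: eq_Rint => x _; ring.
have small (K k L : R -> R) C : continuous K -> linc k -> prim L (fun x => `|k x|) ->
   (forall x, x \in `[a, b] -> `|K x| <= C) ->
   `|\int[mu]_(x in `[a, b]) (K x * k x)| <= C * (L b - L a).
  move=> cK lk hL hC.
  have lKk : linc (fun x => K x * k x) by exact: linc_contM.
  apply: (le_trans (le_normr_Rintegral _ (lKk a b))) => //.
  rewrite (hL.2 _ _ ab) -RintZ//; last exact: (linc_norm lk).
  apply: le_Rint => //; [exact: (linc_norm lKk)|exact: (lincZ _ (linc_norm lk))|].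
  by move=> x xab; rewrite normrM ler_wpM2r// hC.
have i1 := @small (fun x => G x - G a) f A (B b - B a) _ hF.1 hA _.
have i2 := @small (fun x => F x - F a) g B (A b - A a) _ hG.1 hB _.
have {}i1 : `|\int[mu]_(x in `[a, b]) ((G x - G a) * f x)| <= (B b - B a) * (A b - A a).
  apply: i1 => [x|x]; first by apply: cvgB; [exact: cG|exact: cvg_cst].
  rewrite in_itv/= => /andP[ax xb]; apply: (le_trans (nB _ _ ax)).
  by rewrite lerB// mB.
have {}i2 : `|\int[mu]_(x in `[a, b]) ((F x - F a) * g x)| <= (A b - A a) * (B b - B a).
  apply: i2 => [x|x]; first by apply: cvgB; [exact: cF|exact: cvg_cst].
  rewrite in_itv/= => /andP[ax xb]; apply: (le_trans (nA _ _ ax)).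
  by rewrite lerB// mA.
rewrite e1 e2; set I1 := \int[mu]_(x in `[a, b]) _ in i1 *.
set I2 := \int[mu]_(x in `[a, b]) _ in i2 *.
have -> : F b * G b - F a * G a - (G a * (F b - F a) + I1 + (F a * (G b - G a) + I2)) =
   (F b - F a) * (G b - G a) - I1 - I2 by ring.
apply: (le_trans (ler_normB _ _)); apply: (le_trans (lerD (ler_normB _ _) (lexx _))).
have i3 : `|(F b - F a) * (G b - G a)| <= (A b - A a) * (B b - B a).
  by rewrite normrM ler_pM// ?nA ?nB.
have -> : (A b - A a) * (3 * B b - 3 * B a) = 3 * ((A b - A a) * (B b - B a)) by ring.
by move: i1 i2 i3; rewrite (mulrC (B b - B a)); lra.
Qed.

(** The chain rule for u with Lipschitz derivative: the error is of second order
    in the increments of a primitive of |f|. *)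
Lemma prim_comp F f (u u' : R -> R) C : prim F f -> continuous u' ->
  (forall x y, `|u y - u x - u' x * (y - x)| <= C * (y - x) ^+ 2) ->
  (forall x y, `|u' y - u' x| <= C * `|y - x|) ->
  prim (fun x => u (F x)) (fun x => u' (F x) * f x).
Proof.
move=> hF cu' hu hu'; have [A [hA cA mA nA]] := prim_abs hF.
have cF := prim_continuous hF.
have cuF : continuous (fun x => u' (F x)).
  by move=> x; apply: (@continuous_comp _ _ _ F u'); [exact: cF|exact: cu'].
have C0 : 0 <= C.
  by have := hu' 0 1; rewrite subr0 normr1 mulr1; exact: le_trans (normr_ge0 _).
have luf : linc (fun x => u' (F x) * f x) by exact: linc_contM cuF hF.1.
apply: (@prim_of_bound _ _ A (fun x => 2 * C * A x)) => //.
  by move=> x y xy; rewrite ler_wpM2l// ?mA// mulr_ge0.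
move=> a b ab.
have e1 : \int[mu]_(x in `[a, b]) (u' (F x) * f x) =
   u' (F a) * (F b - F a) + \int[mu]_(x in `[a, b]) ((u' (F x) - u' (F a)) * f x).
  rewrite (hF.2 _ _ ab) -RintZ//; last exact: hF.1.
  rewrite -RintD//; [|exact: (lincZ _ hF.1)|]; last first.
    by apply: linc_contM hF.1 _ _ => x; apply: cvgB; [exact: cuF|exact: cvg_cst].
  by apply: eq_Rint => x _; ring.
have lk : linc (fun x => (u' (F x) - u' (F a)) * f x).
  by apply: linc_contM hF.1 => x; apply: cvgB; [exact: cuF|exact: cvg_cst].
have i1 : `|\int[mu]_(x in `[a, b]) ((u' (F x) - u' (F a)) * f x)| <=
    C * (A b - A a) * (A b - A a).
  apply: (le_trans (le_normr_Rintegral _ (lk a b))) => //.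
  rewrite {2}(hA.2 _ _ ab) -RintZ//; last exact: (linc_norm hF.1).
  apply: le_Rint => //; [exact: (linc_norm lk)|exact: (lincZ _ (linc_norm hF.1))|].
  move=> x /=; rewrite in_itv/= => /andP[ax xb]; rewrite normrM ler_wpM2r//.
  apply: (le_trans (hu' _ _)); rewrite ler_wpM2l//.
  by rewrite (le_trans (nA _ _ ax))// lerB// mA.
rewrite e1; set I1 := \int[mu]_(x in `[a, b]) _ in i1 *.
have := hu (F a) (F b); set J := _ - _ - _ => hJ.
have -> : u (F b) - u (F a) - (u' (F a) * (F b - F a) + I1) = J - I1.
  by rewrite /J; ring.
apply: (le_trans (ler_normB _ _)).
have i3 : C * (F b - F a) ^+ 2 <= C * (A b - A a) ^+ 2.
  rewrite ler_wpM2l// -(real_normK (num_real (F b - F a))).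
  by rewrite ler_pXn2r ?nnegrE ?nA// subr_ge0 mA.
have -> : (A b - A a) * (2 * C * A b - 2 * C * A a) =
  C * (A b - A a) ^+ 2 + C * (A b - A a) * (A b - A a) by ring.
by apply: lerD => //; exact: le_trans i3.
Qed.

End ProductRule.

(** * Primitives, derivatives and null sets *)

Section FundamentalTheorem.
Context {R : realType}.
Notation mu := (@lebesgue_measure R).
Implicit Types (f g F G : R -> R) (a b : R).
Local Hint Resolve mitv : core.

Lemma aeS (P Q : R -> Prop) : (forall x, P x -> Q x) ->
  {ae mu, forall x, P x} -> {ae mu, forall x, Q x}.
Proof. by move=> PQ; apply: (@filterS _ _ (ae_filter_ringOfSetsType mu)). Qed.

Lemma aeS2 (P Q S : R -> Prop) : (forall x, P x -> Q x -> S x) ->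
  {ae mu, forall x, P x} -> {ae mu, forall x, Q x} -> {ae mu, forall x, S x}.
Proof. by move=> PQ; apply: (@filterS2 _ _ (ae_filter_ringOfSetsType mu)). Qed.

Lemma is_derive_continuous F f : (forall x : R, is_derive x 1 F (f x)) -> continuous F.
Proof.
move=> hF x; apply: differentiable_continuous; apply/derivable1_diffP.
by case: (hF x).
Qed.

Lemma prim_C1 F f : (forall x : R, is_derive x 1 F (f x)) -> continuous f -> prim F f.
Proof.
move=> hF cf; have cF := is_derive_continuous hF.
split; first exact: continuous_linc.
move=> a b; rewrite le_eqVlt => /predU1P[->|ab]; first by rewrite subrr Rint_itv1.
have h := @continuous_FTC2 R f F a b ab.
apply: EFin_inj; rewrite EFinB -h ?EFin_Rint//.
- exact: continuous_linc.
- exact: continuous_subspaceT.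
- split; first by move=> x _; case: (hF x).
  + by apply: cvg_at_right_filter; exact: cF.
  + by apply: cvg_at_left_filter; exact: cF.
- by move=> x _; rewrite derive1E; case: (hF x).
Qed.

Lemma prim_ae_is_derive F f : prim F f -> {ae mu, forall x : R, is_derive x 1 F (f x)}.
Proof.
move=> [lf hF].
have key n : {ae mu, forall x : R, - n%:R < x -> is_derive x 1 F (f x)}.
  have := @FTC1 R f (BLeft (- n%:R)) (fun y => lf _ y) ((linc_locally_integrable f).1 lf).
  apply: aeS => x h nx; have [dF1 vF1] := h nx.
  pose F1 (y : R) := \int[mu]_(t in `[- n%:R, y]) f t + F (- n%:R).
  have near_eq : {near x, F1 =1 F}.
    near=> y; rewrite /F1 -hF ?subrK//; apply: ltW; near: y.
    exact: lt_nbhsr.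
  have d1 : is_derive x 1 F1 (f x).
    apply: is_derive_eq; first apply: is_deriveD.
      by apply: DeriveDef; [exact: dF1|rewrite -derive1E vF1; reflexivity].
    by rewrite addr0.
  exact: near_eq_is_derive d1.
have := ae_foralln key; apply: aeS => x h.
by apply: (h (Num.bound `|x|)); rewrite ltrNl (le_lt_trans _ (archi_boundP _))// -normrN ler_norm.
Unshelve. all: end_near. Qed.

(** Both are the derivative of F almost everywhere, by Lebesgue's
    differentiation theorem. *)
Lemma prim_unique F f g : prim F f -> prim F g -> {ae mu, forall x, f x = g x}.
Proof.
move=> /prim_ae_is_derive hf /prim_ae_is_derive hg.
apply: aeS2 hf hg => x hf hg.
by rewrite -(@derive_val _ _ _ _ _ _ _ hf) -(@derive_val _ _ _ _ _ _ _ hg).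
Qed.

Lemma Rint_ae_eq f g (D : set R) : measurable D -> measurable_fun setT f -> measurable_fun setT g ->
  {ae mu, forall x, f x = g x} -> \int[mu]_(x in D) f x = \int[mu]_(x in D) g x.
Proof.
move=> mD mf mg fg; congr fine; apply: ae_eq_integral => //.
- by apply/measurable_EFinP; exact: measurable_funS mf.
- by apply/measurable_EFinP; exact: measurable_funS mg.
- by apply: aeS fg => x -> _.
Qed.

Lemma rint_ae_eq f g (D : set R) : measurable D -> measurable_fun setT f -> measurable_fun setT g ->
  {ae mu, forall x, f x = g x} -> rint mu D f -> rint mu D g.
Proof.
move=> mD mf mg fg /integrableP[m1 i1]; apply/integrableP; split.
  by apply/measurable_EFinP; exact: measurable_funS mg.
rewrite (_ : (\int[mu]_(x in D) _ = \int[mu]_(x in D) `|(EFin \o f) x|)%E)//.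
apply: ae_eq_integral => //.
- by apply: measurableT_comp => //; apply/measurable_EFinP; exact: measurable_funS mg.
- by apply: measurableT_comp.
- by apply: aeS fg => x h _ /=; rewrite h.
Qed.

Lemma prim_ae_eq F f g : measurable_fun setT g -> {ae mu, forall x, f x = g x} ->
  prim F f -> prim F g.
Proof.
move=> mg fg [lf hF]; have mf := linc_measurable lf; split.
  by move=> a b; apply: rint_ae_eq (lf a b).
by move=> a b ab; rewrite hF//; exact: Rint_ae_eq.
Qed.

Lemma cos_lip (x y : R) : `|cos y - cos x| <= `|y - x|.
Proof.
wlog xy : x y / x <= y => [h|].
  by have [/h//|/ltW/h] := leP x y; rewrite distrC (distrC x).
have [z _ ->] := @MVT_segment _ (@cos R) (fun x => - sin x) x y xy (fun x _ => is_derive_cos x)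
  (continuous_subspaceT (@continuous_cos R)).
by rewrite normrM normrN ler_piMl// ler_norml sin_geN1 sin_le1.
Qed.

Lemma sin_lip (x y : R) : `|sin y - sin x| <= `|y - x|.
Proof.
wlog xy : x y / x <= y => [h|].
  by have [/h//|/ltW/h] := leP x y; rewrite distrC (distrC x).
have [z _ ->] := @MVT_segment _ (@sin R) (fun x => cos x) x y xy (fun x _ => is_derive_sin x)
  (continuous_subspaceT (@continuous_sin R)).
by rewrite normrM ler_piMl// ler_norml cos_geN1 cos_le1.
Qed.

Lemma taylor2 (u u' : R -> R) C : 0 <= C -> (forall x : R, is_derive x 1 u (u' x)) ->
  (forall x y, `|u' y - u' x| <= C * `|y - x|) ->
  forall x y, `|u y - u x - u' x * (y - x)| <= C * (y - x) ^+ 2.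
Proof.
move=> C0 hu hu' x y.
have cu : continuous u by exact: is_derive_continuous hu.
suff [z xz hz] : exists2 z, `|z - x| <= `|y - x| & u y - u x = u' z * (y - x).
  rewrite hz -mulrBl normrM (le_trans (ler_wpM2r _ (hu' _ _)))//.
  rewrite -(real_normK (num_real (y - x))) expr2 mulrA ler_wpM2r//.
  by rewrite ler_wpM2l.
have [xy|/ltW yx] := leP x y.
  have [z] := @MVT_segment _ u u' x y xy (fun x _ => hu x) (continuous_subspaceT cu).
  rewrite in_itv/= => /andP[xz zy] ->; exists z => //.
  by rewrite !ger0_norm ?subr_ge0// lerB.
have [z] := @MVT_segment _ u u' y x yx (fun x _ => hu x) (continuous_subspaceT cu).
rewrite in_itv/= => /andP[yz zx] h; exists z.
  by rewrite !ler0_norm ?subr_le0// !opprB lerB.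
by rewrite -[LHS]opprB h -mulrN opprB.
Qed.

Lemma cos_taylor (x y : R) : `|cos y - cos x + sin x * (y - x)| <= (y - x) ^+ 2.
Proof.
have := @taylor2 (@cos R) (fun x => - sin x) 1 ler01 (@is_derive_cos R) _ x y.
rewrite mulNr opprK mul1r; apply => a b.
by rewrite mul1r -opprD normrN sin_lip.
Qed.

Lemma prim_cos F f : prim F f -> prim (fun x => cos (F x)) (fun x => - sin (F x) * f x).
Proof.
move=> hF; apply: (@prim_comp _ F f (@cos R) (fun x => - sin x) 1 hF).
- by move=> x; apply: continuousN; exact: continuous_sin.
- by move=> x y; rewrite mul1r mulNr opprK cos_taylor.
- by move=> x y; rewrite mul1r -opprD normrN sin_lip.
Qed.

Lemma prim_sin F f : prim F f -> prim (fun x => sin (F x)) (fun x => cos (F x) * f x).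
Proof.
move=> hF; apply: (@prim_comp _ F f (@sin R) (@cos R) 1 hF).
- exact: continuous_cos.
- apply: (@taylor2 _ (@cos R)) => // z t; by rewrite mul1r cos_lip.
- by move=> x y; rewrite mul1r cos_lip.
Qed.

Lemma Rint_support f K : linc f -> (forall x, K < `|x| -> f x = 0) ->
  rint mu setT f /\ \int[mu]_x f x = \int[mu]_(x in `[- K, K]) f x.
Proof.
move=> lf f0; have E : f = f \_ `[- K, K].
  apply/funext => x; rewrite patchE; case: ifPn => // /negP xK.
  apply: f0; rewrite ltNge; apply/negP; rewrite ler_norml => xK'.
  by apply: xK; rewrite inE/= in_itv.
split; last by rewrite [in RHS]Rintegral_mkcond -E.
rewrite /rint E (_ : _ \o _ = (EFin \o f) \_ `[- K, K]); last first.
  by rewrite restrict_EFin.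
by apply/(integrable_mkcond _ (mitv _ _)); exact: lf.
Qed.

(** Integration by parts, when F is a product one factor of which has compact
    support. *)
Lemma prim_support_int0 F f K : prim F f -> (forall x, K < `|x| -> F x = 0 /\ f x = 0) ->
  \int[mu]_x f x = 0.
Proof.
move=> hF h0; pose L := `|K| + 1.
have KL : K < L by rewrite (le_lt_trans (ler_norm _))// ltrDl.
have L0 : 0 <= L by rewrite addr_ge0.
have h x : L < `|x| -> f x = 0 by move=> hx; apply: (h0 x _).2; exact: lt_trans hx.
have [_ ->] := Rint_support hF.1 h.
rewrite -hF.2; last by rewrite ge0_cp.
by rewrite (h0 L _).1 ?(h0 (- L) _).1 ?subrr// ?normrN ger0_norm.
Qed.

End FundamentalTheorem.

(** * Smooth functions *)

Section Smooth.
Context {R : realType} {V : normedModType R}.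
Implicit Types f g : V -> R.

(** Coinduction principle: a class of continuous functions that have all
    directional derivatives in the class consists of smooth functions. *)
Lemma smooth_class (P : (V -> R) -> Prop) :
  (forall f, P f -> [/\ continuous f, forall x v, derivable f x v &
     forall v, P (fun x => 'D_v f x)]) ->
  forall f, P f -> smooth f.
Proof.
move=> hP f Pf vs /=.
suff : P (foldr (fun v (k : V -> R) => fun x => 'D_v k x) f vs).
  by move=> /hP[? ? _].
by elim: vs => //= v vs /hP[_ _]; exact.
Qed.

Lemma smoothP f : smooth f -> [/\ continuous f, forall x v, derivable f x v &
  forall v, smooth (fun x => 'D_v f x)].
Proof.
move=> sf; split; [exact: (sf [::]).1|exact: (sf [::]).2|move=> v vs].
have := sf (rcons vs v).
by rewrite foldr_rcons.
Qed.

Lemma smooth_cst c : smooth (cst c : V -> R).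
Proof.
apply: (@smooth_class (fun f => exists c, f = cst c)); last by exists c.
move=> _ [d ->]; split; [by move=> x; exact: cvg_cst|by move=> *; exact: derivable_cst|].
by move=> v; exists 0; apply/funext => x; rewrite derive_cst.
Qed.

Lemma smoothD f g : smooth f -> smooth g -> smooth (fun x => f x + g x).
Proof.
move=> sf sg.
apply: (@smooth_class (fun h => exists f g, [/\ smooth f, smooth g & h = fun x => f x + g x]));
  last by exists f, g.
move=> _ [{sf}f [{sg}g [/smoothP[cf df sf] /smoothP[cg dg sg] ->]]]; split.
- by move=> x; apply: cvgD; [exact: cf|exact: cg].
- by move=> x v; apply: derivableD.
- move=> v; exists (fun x => 'D_v f x), (fun x => 'D_v g x); split => //.
  by apply/funext => x; rewrite (deriveD (df _ _) (dg _ _)).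
Qed.

(** Sums of products of smooth functions are stable under differentiation by the
    Leibniz rule, whereas products are not. *)
Inductive prod_sum : (V -> R) -> Prop :=
| PSM f g : smooth f -> smooth g -> prod_sum (fun x => f x * g x)
| PSD a b : prod_sum a -> prod_sum b -> prod_sum (fun x => a x + b x).

Lemma smoothM f g : smooth f -> smooth g -> smooth (fun x => f x * g x).
Proof.
move=> sf sg; apply: (@smooth_class prod_sum); last exact: PSM.
move=> h; elim=> {h} [{sf}f {sg}g sf sg|a b _ [ca da pa] _ [cb db pb]].
  have [cf df sf'] := smoothP sf; have [cg dg sg'] := smoothP sg; split.
  - by move=> x; apply: cvgM; [exact: cf|exact: cg].
  - by move=> x v; apply: derivableM.
  - move=> v; rewrite (_ : (fun x => _) = (fun x => 'D_v g x * f x + 'D_v f x * g x)).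
      exact: (PSD (PSM (sg' v) sf) (PSM (sf' v) sg)).
    apply/funext => x; rewrite (deriveM (df _ _) (dg _ _)) /GRing.scale/=.
    by rewrite mulrC [X in _ + X]mulrC.
split.
- by move=> x; apply: cvgD; [exact: ca|exact: cb].
- by move=> x v; apply: derivableD.
- move=> v; rewrite (_ : (fun x => _) = (fun x => 'D_v a x + 'D_v b x)); first exact: PSD.
  by apply/funext => x; rewrite (deriveD (da _ _) (db _ _)).
Qed.

Lemma smoothZ c f : smooth f -> smooth (fun x => c * f x).
Proof. exact: (smoothM (smooth_cst c)). Qed.

Lemma test_functionD f g : test_function f -> test_function g ->
  test_function (fun x => f x + g x).
Proof.
move=> [sf cf] [sg cg]; split; first exact: smoothD.
apply: (@subclosed_compact _ _ (closure [set x | f x != 0] `|` closure [set x | g x != 0])).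
- exact: closed_closure.
- exact: compactU.
- rewrite -closureU; apply: closure_subset => x /=.
  by case: (eqVneq (f x) 0) => [->|]; [rewrite add0r; right|left].
Qed.

Lemma test_functionZ c f : test_function f -> test_function (fun x => c * f x).
Proof.
move=> [sf cf]; split; first exact: smoothZ.
apply: (@subclosed_compact _ _ (closure [set x | f x != 0])) => //.
  exact: closed_closure.
apply: closure_subset => x /=; apply: contraNN => /eqP ->.
by rewrite mulr0.
Qed.

Lemma test_function0 : test_function (cst 0 : V -> R).
Proof.
split; first exact: smooth_cst.
rewrite (_ : [set x | _] = set0) ?closure0; first exact: compact0.
by rewrite -subset0 => x /=; rewrite eqxx.
Qed.

Lemma derive_out_support f x v : ~ closure [set x | f x != 0] x -> 'D_v f x = 0.
Proof.
move=> hx; have : nbhs x (~` closure [set x | f x != 0]).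
  by apply: open_nbhs_nbhs; split => //; apply: closed_openC; exact: closed_closure.
move=> /filterS h; rewrite (@near_eq_derive _ _ _ f (cst 0)) ?derive_cst//.
apply: h => y /= hy; apply/eqP; apply: contrapT => /negP fy; apply: hy.
exact: subset_closure.
Qed.

Lemma test_function_bound f : test_function f -> exists K, forall x, K < `|x| ->
  f x = 0 /\ forall v, 'D_v f x = 0.
Proof.
move=> [_ /compact_norm_le[K hK]]; exists K => x Kx.
have nx : ~ closure [set x | f x != 0] x by move=> /hK; rewrite leNgt Kx.
split; last by move=> v; exact: derive_out_support.
by apply/eqP; apply: contrapT => /negP fx; apply: nx; exact: subset_closure.
Qed.

End Smooth.

Section SmoothLine.
Context {R : realType}.
Implicit Types f g : R -> R.

Lemma is_derive_scale f (x df v : R) : is_derive x 1 f df -> is_derive x v f (v * df).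
Proof.
move=> [dvf <-]; have df' : differentiable f x by apply/derivable1_diffP.
apply: DeriveDef; first exact: diff_derivable.
rewrite deriveE// [in RHS]deriveE//.
by rewrite -[in LHS](mulr1 v) -[v * 1]/(v *: (1 : R)) linearZ.
Qed.

Lemma is_der_add f g (x a b : R) : is_derive x 1 f a -> is_derive x 1 g b ->
  is_derive x 1 (fun y => f y + g y) (a + b).
Proof. by move=> hf hg; exact: is_deriveD. Qed.

Lemma is_der_mul f g (x a b : R) : is_derive x 1 f a -> is_derive x 1 g b ->
  is_derive x 1 (fun y => f y * g y) (a * g x + f x * b).
Proof.
move=> hf hg; have : is_derive x 1 (fun y => f y * g y) (f x *: b + g x *: a).
  exact: is_deriveM.
by rewrite /GRing.scale/= addrC mulrC.
Qed.

Lemma is_der_scale f (c x a : R) : is_derive x 1 f a ->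
  is_derive x 1 (fun y => c * f y) (c * a).
Proof.
move=> hf; have := is_der_mul (is_derive_cst c x 1) hf.
by rewrite mul0r add0r.
Qed.

Lemma is_der_affine (a b x : R) : is_derive x 1 (fun y : R => a * y + b) a.
Proof.
have := is_der_add (is_der_scale a (is_derive_id x 1)) (is_derive_cst b x 1).
by rewrite mulr1 addr0.
Qed.

Lemma is_der_comp f g (x a b : R) : is_derive (g x) 1 f a -> is_derive x 1 g b ->
  is_derive x 1 (fun y => f (g y)) (a * b).
Proof. by move=> hf hg; have := is_derive1_comp hf hg. Qed.

(** On the line the directional derivatives are multiples of the derivative, so
    the class needs to be stable under scaling and differentiation only. *)
Lemma smooth_class1 (P : (R -> R) -> Prop) :
  (forall c f, P f -> P (fun x => c * f x)) ->
  (forall f, P f -> exists2 f', P f' & forall x : R, is_derive x 1 f (f' x)) ->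
  forall f, P f -> smooth f.
Proof.
move=> PZ Pd; apply: smooth_class => f /Pd[f' Pf' hf]; split.
- exact: is_derive_continuous hf.
- by move=> x v; case: (is_derive_scale v (hf x)).
- move=> v; rewrite (_ : (fun x => _) = (fun x => v * f' x)); first exact: PZ.
  by apply/funext => x; case: (is_derive_scale v (hf x)).
Qed.

Lemma smooth_is_derive f : smooth f -> exists2 f', smooth f' &
  forall x : R, is_derive x 1 f (f' x).
Proof.
move=> /smoothP[_ df sf]; exists (fun x => 'D_1 f x); first exact: sf.
by move=> x; exact: derivableP.
Qed.

Lemma smooth_affine f (a b : R) : smooth f -> smooth (fun x : R => f (a * x + b)).
Proof.
move=> sf; apply: (@smooth_class1 (fun h => exists c g, smooth g /\ h = fun x => c * g (a * x + b))).
- move=> c _ [d [g [sg ->]]]; exists (c * d), g; split => //.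
  by apply/funext => x; rewrite mulrA.
- move=> _ [c [g [sg ->]]]; have [g' sg' hg] := smooth_is_derive sg.
  exists (fun x => c * a * g' (a * x + b)); first by exists (c * a), g'.
  move=> x; rewrite -mulrA (mulrC a); apply: is_der_scale.
  exact: is_der_comp (hg _) (is_der_affine a b x).
- by exists 1, f; split => //; apply/funext => x; rewrite mul1r.
Qed.

End SmoothLine.

(** * Bump functions *)

Section Bump.
Context {R : realType}.

(** All derivatives of exp (- 1 / x), extended by 0, are of this form; hence
    this class is stable under differentiation and consists of smooth functions. *)
Definition flat (p : {poly R}) (x : R) : R :=
  if 0 < x then p.[x^-1] * expR (- x^-1) else 0.

Lemma pow_exp_le (n : nat) (y : R) : 0 <= y -> y ^+ n * expR (- y) <= n%:R ^+ n.
Proof.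
move=> y0; case: n => [|n]; first by rewrite !expr0 mul1r expR_le1 oppr_le0.
have n0 : (0 : R) < n.+1%:R by [].
have -> : expR (- y) = expR (- (y / n.+1%:R)) ^+ n.+1.
  by rewrite -expRM_natr mulNr mulfVK// gt_eqF.
have -> : y ^+ n.+1 = n.+1%:R ^+ n.+1 * (y / n.+1%:R) ^+ n.+1.
  by rewrite -exprMn; congr (_ ^+ _); rewrite mulrC mulfVK// gt_eqF.
rewrite -mulrA -exprMn ler_piMr ?exprn_ge0// exprn_ile1 ?mulr_ge0 ?divr_ge0 ?expR_ge0//.
rewrite expRN ler_pdivrMr ?expR_gt0// mul1r.
by apply: le_trans (expR_ge1Dx _); rewrite lerDr.
Qed.

Lemma poly_exp_bound (p : {poly R}) : exists C, forall y, 0 <= y ->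
  `|p.[y] * expR (- y)| <= C.
Proof.
exists (\sum_(i < size p) `|p`_i| * i%:R ^+ i) => y y0.
rewrite horner_coef mulr_suml (le_trans (ler_norm_sum _ _ _))//.
apply: ler_sum => i _; rewrite -mulrA normrM ler_wpM2l//.
by rewrite ger0_norm ?pow_exp_le// mulr_ge0 ?exprn_ge0 ?expR_ge0.
Qed.

(** The bound by C |x| gives the derivative 0 at the origin, for every p:
    applied to X * p it bounds the difference quotient by C |x|. *)
Lemma flat_bound (p : {poly R}) : exists C, forall x, `|flat p x| <= C * `|x|.
Proof.
have [C hC] := poly_exp_bound ('X * p).
have C0 : 0 <= C by apply: (le_trans (normr_ge0 _) (hC 0 _)).
exists C => x; rewrite /flat; case: ifPn => [x0|_]; last by rewrite normr0 mulr_ge0.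
have := hC x^-1; rewrite invr_ge0 (ltW x0) => /(_ isT).
rewrite hornerM hornerX -mulrA normrM (gtr0_norm x0) [`|x^-1|]gtr0_norm ?invr_gt0//.
by rewrite mulrC ler_pdivrMr.
Qed.

Lemma flat_is_derive (p : {poly R}) (x : R) :
  is_derive x 1 (flat p) (flat ('X^2 * (p - p^`())) x).
Proof.
have [x0|x0|->] := ltgtP x 0.
- have -> : flat ('X^2 * (p - p^`())) x = 0 by rewrite /flat ltNge (ltW x0).
  have h0 : is_derive x 1 (cst 0 : R -> R) 0 := is_derive_cst 0 x 1.
  apply: near_eq_is_derive h0.
  near=> y; rewrite /flat ltNge (_ : y <= 0)//; apply: ltW; near: y.
  exact: lt_nbhsl.
- suff hh : is_derive x 1 (fun y => p.[y^-1] * expR (- y^-1)) (flat ('X^2 * (p - p^`())) x).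
    apply: near_eq_is_derive hh; near=> y; rewrite /flat (_ : 0 < y)//; near: y.
    exact: lt_nbhsr.
  rewrite /flat x0.
  have hV : is_derive x 1 (fun y : R => y^-1) (- x ^- 2).
    by apply: is_derive_eq; [apply: is_deriveV; rewrite gt_eqF|rewrite /GRing.scale/= mulr1].
  have hN := is_der_scale (-1) hV.
  have hE := is_der_comp (is_derive_expR _) hN.
  have hp := is_der_comp (is_derive_poly p _) hV.
  have := is_der_mul hp hE.
  rewrite (_ : (fun y => _) = (fun y => p.[y^-1] * expR (- y^-1))); last first.
    by apply/funext => y; rewrite mulN1r.
  rewrite !mulN1r !hornerE/= exprVn => h.
  by apply: is_derive_eq h _; ring.
- have -> : flat ('X^2 * (p - p^`())) 0 = 0 by rewrite /flat ltxx.
  have [C hC] := flat_bound ('X * p).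
  have lim0 : (fun h => h^-1 *: ((flat p \o shift 0) (h *: (1 : R)) - flat p 0)) @ 0^' --> (0 : R).
    apply/cvgrPdist_le => e e0; near=> h.
    rewrite sub0r normrN /= /GRing.scale/= mulr1 addr0 {2}/flat ltxx subr0.
    have -> : h^-1 * flat p h = flat ('X * p) h.
      by rewrite /flat; case: ifP => _; rewrite ?mulr0// hornerM hornerX mulrA.
    apply: (le_trans (hC _)).
    have C1 : 0 < `|C| + 1 by rewrite ltr_wpDl.
    apply: (@le_trans _ _ ((`|C| + 1) * `|h|)).
      by rewrite ler_wpM2r// (le_trans (ler_norm _))// lerDl.
    rewrite -ler_pdivlMl// ltW//; near: h.
    apply: dnbhs0_lt; by rewrite mulr_gt0// invr_gt0.
  apply: DeriveDef; first by apply/cvg_ex; exists 0.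
  by apply/cvg_lim.
Unshelve. all: end_near. Qed.

Lemma smooth_flat p : smooth (flat p).
Proof.
apply: (@smooth_class1 _ (fun f => exists p, f = flat p)); last by exists p.
  move=> c _ [q ->]; exists (c *: q); apply/funext => x; rewrite /flat.
  by case: ifP => _; rewrite ?mulr0// hornerZ mulrA.
move=> _ [q ->]; exists (flat ('X^2 * (q - q^`()))); first by eexists.
exact: flat_is_derive.
Qed.

Definition sexp : R -> R := flat 1.

Lemma sexpE x : sexp x = if 0 < x then expR (- x^-1) else 0.
Proof. by rewrite /sexp /flat hornerC mul1r. Qed.

Lemma sexp_ge0 x : 0 <= sexp x.
Proof. by rewrite sexpE; case: ifP => // _; exact: expR_ge0. Qed.

Lemma sexp_le1 x : sexp x <= 1.
Proof. by rewrite sexpE; case: ifP => // x0; rewrite expR_le1 oppr_le0 invr_ge0 ltW. Qed.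

Lemma sexp_le0 x : x <= 0 -> sexp x = 0.
Proof. by rewrite sexpE ltNge => ->. Qed.

Lemma sexp_gt0 x : 0 < x -> 0 < sexp x.
Proof. by rewrite sexpE => ->; exact: expR_gt0. Qed.

Lemma sexp_cvg1 x : 0 < x -> (fun n : nat => sexp (n.+1%:R * x)) @ \oo --> (1 : R).
Proof.
move=> x0.
have -> : (fun n : nat => sexp (n.+1%:R * x)) = (fun n => expR (- (x^-1 * n.+1%:R^-1))).
  by apply/funext => n; rewrite sexpE pmulr_rgt0// x0 invfM mulrC.
have h1 : (fun n : nat => x^-1 * n.+1%:R^-1) @ \oo --> x^-1 * 0.
  by apply: cvgMl_tmp; exact: cvg_harmonic.
have h := cvg_comp _ _ (cvgN h1) (@continuous_expR R _).
rewrite mulr0 oppr0 expR0 in h; exact: h.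
Qed.

(** As n grows, the bumps increase to the indicator function of the open
    interval. *)
Definition bump (n : nat) (a b x : R) := sexp (n.+1%:R * (x - a)) * sexp (n.+1%:R * (b - x)).

Lemma bump_out n a b x : x \notin `]a, b[ -> bump n a b x = 0.
Proof.
rewrite in_itv/= negb_and -!leNgt /bump => /orP[xa|bx].
  by rewrite sexp_le0 ?mul0r// pmulr_rle0// subr_le0.
by rewrite [X in _ * X]sexp_le0 ?mulr0// pmulr_rle0// subr_le0.
Qed.

Lemma bump_ge0 n a b x : 0 <= bump n a b x.
Proof. by rewrite mulr_ge0// sexp_ge0. Qed.

Lemma bump_le1 n a b x : bump n a b x <= 1.
Proof. by rewrite mulr_ile1// ?sexp_ge0 ?sexp_le1. Qed.

Lemma bump_gt0 n a b x : x \in `]a, b[ -> 0 < bump n a b x.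
Proof.
by rewrite in_itv/= => /andP[ax xb]; rewrite mulr_gt0// sexp_gt0// mulr_gt0// subr_gt0.
Qed.

Lemma bump_cvg a b x : (fun n => bump n a b x) @ \oo --> (\1_(`]a, b[) x : R).
Proof.
rewrite indicE; case: (boolP (x \in `]a, b[)) => [xab|xab].
  rewrite mem_set//; move: xab; rewrite in_itv/= => /andP[ax xb].
  rewrite -[X in _ --> X](mulr1 (1 : R)); apply: cvgM.
    by apply: sexp_cvg1; rewrite subr_gt0.
  by apply: sexp_cvg1; rewrite subr_gt0.
rewrite memNset/=; last by move=> /= h; rewrite h in xab.
rewrite (_ : (fun n => _) = cst 0); first exact: cvg_cst.
by apply/funext => n; rewrite bump_out.
Qed.

Lemma compact_support (f : R -> R) a b : (forall x, x \notin `]a, b[ -> f x = 0) ->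
  compact (closure [set x | f x != 0]).
Proof.
move=> h; apply: (@subclosed_compact _ _ `[a, b]).
- exact: closed_closure.
- exact: segment_compact.
- have cl : closed (`[a, b]%classic : set R) by exact: itv_closed.
  rewrite ((closure_id _).1 cl); apply: closure_subset => x /= fx; apply: subset_itv_oo_cc => /=.
  by apply: contrapT => /negP /h; apply/eqP.
Qed.

Lemma smooth_bump n a b : smooth (bump n a b).
Proof.
apply: smoothM.
  rewrite (_ : (fun x => _) = (fun x => sexp (n.+1%:R * x + (- n.+1%:R * a)))).
    by apply: smooth_affine; exact: smooth_flat.
  by apply/funext => x; rewrite mulrBr mulNr.
rewrite (_ : (fun x => _) = (fun x => sexp (- n.+1%:R * x + n.+1%:R * b))).
  by apply: smooth_affine; exact: smooth_flat.
by apply/funext => x; rewrite mulrBr mulNr addrC.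
Qed.

Lemma test_bump n a b : test_function (bump n a b).
Proof.
by split; [exact: smooth_bump|apply: (@compact_support _ a b) => x; exact: bump_out].
Qed.

End Bump.

(** * Du Bois-Reymond lemma and weak derivatives *)

Lemma Rdominated_cvg {d} {T : measurableType d} {R : realType}
  (mu : {measure set T -> \bar R}) (D : set T) (mD : measurable D)
  (f_ : nat -> T -> R) (f g : T -> R) :
  (forall n, measurable_fun D (f_ n)) -> measurable_fun D f -> rint mu D g ->
  (forall n x, D x -> `|f_ n x| <= g x) ->
  (forall x, D x -> f_ ^~ x @ \oo --> f x) ->
  (fun n => \int[mu]_(x in D) f_ n x) @ \oo --> \int[mu]_(x in D) f x.
Proof.
move=> mf_ mf ig fg fc.
have lim : (fun n => (\int[mu]_(x in D) (f_ n x)%:E)%E) @ \oo --> (\int[mu]_(x in D) (f x)%:E)%E.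
  have m1 n : measurable_fun D (fun x => (f_ n x)%:E) by apply/measurable_EFinP.
  have c1 x : D x -> (fun n => (f_ n x)%:E) @ \oo --> (f x)%:E.
    by move=> Dx; apply: cvg_EFin; [exact: nearW|exact: fc].
  have b1 n x : D x -> (`|(f_ n x)%:E| <= (EFin \o g) x)%E.
    by move=> Dx; rewrite /= lee_fin fg.
  have fg' x : D x -> (EFin \o g) x \is a fin_num by [].
  exact: (dominated_cvg mD m1 c1 fg' ig b1).
rewrite (EFin_Rint mD) in lim; first exact: (fine_cvg lim).
apply: (@le_rint _ _ _ mu D mD f g) => // x Dx.
have h : (fun n => `|f_ n x|) @ \oo --> `|f x|.
  by apply: cvg_norm; exact: fc.
by apply: (cvgr_to_le h); apply: nearW => n; exact: fg.
Qed.

Section DuBoisReymond.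
Context {R : realType}.
Notation mu := (@lebesgue_measure R).
Implicit Types (f g F G J : R -> R) (a b : R).
Local Hint Resolve mitv : core.

Lemma Rint_itv_support f a b : (forall x, x \notin `[a, b] -> f x = 0) ->
  \int[mu]_x f x = \int[mu]_(x in `[a, b]) f x.
Proof.
move=> h; rewrite [RHS]Rintegral_mkcond; congr fine; apply: eq_integral => x _.
rewrite patchE; case: ifPn => // hx; rewrite h//.
by apply: contraNN hx => hx; rewrite inE.
Qed.

Lemma smooth_continuous f : smooth f -> continuous f.
Proof. by case/smoothP. Qed.

(** The bumps converge boundedly to the indicator function of an interval, so
    all integrals of J over segments vanish and the constant 0 is a primitive of
    J. *)
Lemma testing_zero J : linc J ->
  (forall eta, test_function eta -> \int[mu]_x (J x * eta x) = 0) ->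
  {ae mu, forall x, J x = 0}.
Proof.
move=> lJ hJ.
suff h : prim (cst 0) J by exact: prim_unique h (prim_cst 0).
split => // a b ab; rewrite subrr; apply/esym.
have lim := @Rdominated_cvg _ _ R mu `[a, b] (mitv a b)
  (fun n x => J x * bump n a b x) (fun x => J x * \1_(`]a, b[) x) (fun x => `|J x|).
have mJ := linc_measurable lJ.
have /lim {}lim n : measurable_fun `[a, b] (fun x => J x * bump n a b x).
  apply: measurable_funTS; apply: measurable_funM => //.
  exact: (continuous_measurable_fun (smooth_continuous (smooth_bump n a b))).
have /lim {}lim : measurable_fun `[a, b] (fun x => J x * \1_(`]a, b[) x).
  by apply: measurable_funTS; apply: measurable_funM => //; exact: measurable_indic.
have {}lim : (fun n => \int[mu]_(x in `[a, b]) (J x * bump n a b x)) @ \oo -->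
   \int[mu]_(x in `[a, b]) (J x * \1_(`]a, b[) x).
  apply: lim.
  - exact: (linc_norm lJ).
  - by move=> n x _; rewrite normrM ler_piMr// ger0_norm ?bump_ge0// bump_le1.
  - by move=> x _; apply: cvgMl_tmp; exact: bump_cvg.
rewrite (_ : (fun n => _) = cst 0) in lim; last first.
  apply/funext => n; rewrite -[RHS](hJ _ (test_bump n a b)).
  apply/esym/Rint_itv_support => x xab; rewrite bump_out ?mulr0//.
  by apply: contraNN xab; exact: subset_itv_oo_cc.
have -> : \int[mu]_(x in `[a, b]) J x = \int[mu]_(x in `[a, b]) (J x * \1_(`]a, b[) x).
  have io : mu.-integrable `]a, b] (EFin \o J).
    by apply: integrableS (lJ a b) => //; exact: subset_itv_oc_cc.
  rewrite -Rintegral_itv_obnd_cbnd// -Rintegral_itv_bndo_bndc; last first.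
    by apply: integrableS (lJ a b) => //; exact: subset_itv_oo_cc.
  rewrite Rintegral_mkcond [RHS]Rintegral_mkcond; apply: eq_Rint => x _.
  rewrite !patchE indicE; case: ifPn => hx; first rewrite mulr1.
    by rewrite ifT// inE; move: hx; rewrite inE; exact: subset_itv_oo_cc.
  by rewrite mulr0; case: ifP.
have <- := cvg_lim (@Rhausdorff R) lim.
exact: (cvg_lim (@Rhausdorff R) (cvg_cst _)).
Qed.

Lemma smooth_prim F f : (forall x : R, is_derive x 1 F (f x)) -> smooth f -> smooth F.
Proof.
move=> hF sf.
apply: (@smooth_class1 _ (fun g => smooth g \/ exists c, g = fun x => c * F x)).
- move=> c g [sg|[d ->]]; first by left; exact: smoothZ.
  by right; exists (c * d); apply/funext => x; rewrite mulrA.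
- move=> g [sg|[c ->]].
    by have [g' sg' hg] := smooth_is_derive sg; exists g' => //; left.
  by exists (fun x => c * f x); [left; exact: smoothZ|move=> x; exact: is_der_scale].
- by right; exists 1; apply/funext => x; rewrite mul1r.
Qed.

Lemma prim_is_derive F f : continuous f -> prim F f -> forall x : R, is_derive x 1 F (f x).
Proof.
move=> cf [lf hF] x.
have xu : x < x + 1 by rewrite ltrDl.
have ax : x - 1 < x by rewrite ltrBlDr ltrDl.
have [dF1 vF1] := @continuous_FTC1_closed R f (x - 1) x (x + 1) xu (lf _ _) ax (cf x).
pose F1 (y : R) := \int[mu]_(t in `[x - 1, y]) f t + F (x - 1).
have d1 : is_derive x 1 F1 (f x).
  have d0 : is_derive x 1 (fun y => \int[mu]_(t in `[x - 1, y]) f t) (f x).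
    by apply: DeriveDef; [exact: dF1|rewrite -derive1E vF1].
  by have := is_der_add d0 (is_derive_cst (F (x - 1)) x 1); rewrite addr0.
apply: near_eq_is_derive d1; near=> y; rewrite /F1 -hF ?subrK//; apply: ltW; near: y.
by apply: lt_nbhsr; rewrite ltrBlDr ltrDl.
Unshelve. all: end_near. Qed.

Lemma test_function_linc f : test_function f -> linc f.
Proof. by move=> [/smooth_continuous cf _]; exact: continuous_linc. Qed.

Lemma linc_testM f eta : linc f -> test_function eta -> linc (fun x => f x * eta x).
Proof.
move=> lf [/smooth_continuous ce _].
rewrite (_ : (fun x => _) = (fun x => eta x * f x)); first exact: linc_contM.
by apply/funext => x; rewrite mulrC.
Qed.

Lemma test_int f eta : linc f -> test_function eta -> rint mu setT (fun x => f x * eta x).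
Proof.
move=> lf te; have [K hK] := test_function_bound te.
apply: (Rint_support (linc_testM lf te) _).1 => x /hK[-> _].
by rewrite mulr0.
Qed.

Lemma test_rint eta : test_function eta -> rint mu setT eta.
Proof.
move=> te; have := test_int (continuous_linc (@cst_continuous _ _ (1 : R))) te.
by congr (rint _ _); apply/funext => x; rewrite mul1r.
Qed.

(** The primitive that vanishes on the left of the support vanishes on its right
    too, as the integral is 0. *)
Lemma test_antiderivative eta : test_function eta -> \int[mu]_x eta x = 0 ->
  exists2 zeta, test_function zeta & derive1 zeta = eta.
Proof.
move=> te e0; have le := test_function_linc te; have [se _] := te.
have [K0 hK0] := test_function_bound te.
pose K := `|K0| + 1.
have KK : K0 < K by rewrite (le_lt_trans (ler_norm _))// ltrDl.
have K1 : 0 <= K by rewrite addr_ge0.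
have hK x : K <= `|x| -> eta x = 0.
  by move=> Kx; apply: (hK0 x _).1; exact: lt_le_trans Kx.
have [Z [hZ _]] := prim_exists le.
pose zeta x := Z x - Z (- K).
have dz (x : R) : is_derive x 1 zeta (eta x).
  have := is_der_add (prim_is_derive (smooth_continuous se) hZ x) (is_derive_cst (- Z (- K)) x 1).
  by rewrite addr0.
have z0 a b : a <= b -> (forall x, x \in `[a, b] -> eta x = 0) -> Z a = Z b.
  move=> ab h; apply/esym/eqP; rewrite -subr_eq0 hZ.2//.
  rewrite (@eq_Rint _ _ _ mu _ _ (cst 0)); first by rewrite Rintegral_cst// mul0r.
  by move=> x /= /h.
have ZK : Z K = Z (- K).
  apply/eqP; rewrite -subr_eq0 hZ.2 ?ge0_cp// -e0; apply/eqP/esym.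
  apply: Rint_itv_support => x; rewrite in_itv/= -ler_norml -ltNge => /ltW.
  exact: hK.
exists zeta; last by apply/funext => x; rewrite derive1E; case: (dz x).
split; first exact: smooth_prim dz se.
apply: (@compact_support _ _ (- K) K) => x; rewrite in_itv/= negb_and -!leNgt.
move=> /orP[xK|Kx]; rewrite /zeta.
  rewrite (z0 x (- K))// ?subrr// => y; rewrite in_itv/= => /andP[_ yK].
  by apply: hK; rewrite lerNr in yK; rewrite (le_trans yK)// -normrN ler_norm.
rewrite -(z0 K x)// ?ZK ?subrr// => y; rewrite in_itv/= => /andP[Ky _].
by apply: hK; rewrite (le_trans Ky)// ler_norm.
Qed.

End DuBoisReymond.

Section WeakDerivative.
Context {R : realType}.
Notation mu := (@lebesgue_measure R).
Implicit Types (f g F G J : R -> R) (a b : R).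
Local Hint Resolve mitv : core.

(** A test function eta minus the right multiple of a fixed bump rho is a
    derivative, so J - c is orthogonal to eta, with c the rho-average of J. *)
Lemma du_bois_reymond J : linc J ->
  (forall zeta, test_function zeta -> \int[mu]_x (J x * derive1 zeta x) = 0) ->
  exists c, {ae mu, forall x, J x = c}.
Proof.
move=> lJ hJ; pose rho := bump 0 0 (1 : R).
have tr : test_function rho by exact: test_bump.
have ir := test_rint tr.
pose I := \int[mu]_x rho x.
have I0 : 0 < I.
  rewrite lt0r; apply/andP; split; last by apply: Rintegral_ge0 => x _; exact: bump_ge0.
  apply/eqP => I0.
  have := (@ae_eq_integral_abs _ _ _ mu setT measurableT (EFin \o rho) (measurable_int _ ir)).1.
  have -> : (\int[mu]_x `|(EFin \o rho) x| = 0)%E.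
    transitivity (\int[mu]_x (rho x)%:E)%E.
      by apply: eq_integral => x _ /=; rewrite ger0_norm ?bump_ge0.
    by rewrite EFin_Rint// -/I I0.
  move=> /(_ erefl) ae0.
  have : {ae mu, forall x : R, ~ `]0, 1[%classic x}.
    apply: aeS ae0 => x /(_ Logic.I) /= [] r0 x01.
    by have := @bump_gt0 R 0 0 1 x x01; rewrite -/rho r0 ltxx.
  move=> [N [mN N0 hN]].
  have : (mu `]0%R, 1%R[ <= mu N)%E.
    by apply: le_measure; rewrite ?inE//; move=> x x01; apply: hN => /(_ x01).
  by rewrite N0 lebesgue_measure_itv/= lte_fin ltr01 sube0 lee_fin ler10.
pose c := (\int[mu]_x (J x * rho x)) / I; exists c.
suff : {ae mu, forall x, J x - c = 0}.
  by apply: aeS => x /eqP; rewrite subr_eq0 => /eqP.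
have lc : linc (cst c) by apply: continuous_linc => x; exact: cvg_cst.
apply: testing_zero; first exact: (lincB lJ lc).
move=> eta te; pose e := (\int[mu]_x eta x) / I.
have tk : test_function (fun x => eta x + - e * rho x).
  by apply: test_functionD => //; exact: test_functionZ.
have ie := test_rint te.
have k0 : \int[mu]_x (eta x + - e * rho x) = 0.
  rewrite RintD//; last exact: rintZ.
  by rewrite RintZ// mulNr mulfVK ?subrr// gt_eqF.
have [zeta tz dz] := test_antiderivative tk k0.
have := hJ _ tz; rewrite dz.
have -> : \int[mu]_x (J x * (eta x + - e * rho x)) =
   \int[mu]_x (J x * eta x) - e * \int[mu]_x (J x * rho x).
  rewrite -RintZ//; last exact: test_int.
  rewrite -RintB//; [|exact: test_int|by apply: rintZ => //; exact: test_int].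
  by apply: eq_Rint => x _; ring.
move=> h.
have -> : \int[mu]_x ((J x - c) * eta x) = \int[mu]_x (J x * eta x) - c * \int[mu]_x eta x.
  rewrite -RintZ// -RintB//; [|exact: test_int|exact: rintZ].
  by apply: eq_Rint => x _; ring.
rewrite -[RHS]h; congr (_ - _); rewrite /c /e.
by rewrite -!mulrA; rewrite mulrC mulrA mulrAC -mulrA mulrC; ring.
Qed.

Lemma prim_by_parts F f zeta : prim F f -> test_function zeta ->
  \int[mu]_x (F x * derive1 zeta x) = - \int[mu]_x (f x * zeta x).
Proof.
move=> hF tz; have [K hK] := test_function_bound tz.
have [sz _] := tz; have [_ dz sz'] := smoothP sz.
have E : derive1 zeta = (fun x => 'D_1 zeta x) by apply/funext => x; rewrite derive1E.
have cz' : continuous (derive1 zeta) by rewrite E; exact: smooth_continuous (sz' 1).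
have hz : prim zeta (derive1 zeta).
  by apply: prim_C1 => // x; rewrite derive1E; exact: derivableP.
have hM := primM hF hz.
have h0 := @prim_support_int0 R _ _ K hM.
have i1 : rint mu setT (fun x => f x * zeta x) by exact: test_int hF.1 tz.
have i2 : rint mu setT (fun x => F x * derive1 zeta x).
  apply: (@Rint_support _ _ K _ _).1.
    by apply: linc_contM; [exact: prim_continuous hF|exact: continuous_linc].
  by move=> x /hK[_ d0]; rewrite E d0 mulr0.
move: h0; rewrite RintD// => h0; apply/eqP; rewrite -addr_eq0 addrC; apply/eqP; apply: h0.
by move=> x /hK[z0 d0]; rewrite z0 E d0 !mulr0 addr0.
Qed.

Lemma prim_is_weak_derivative F f g0 : prim F f -> measurable_fun setT g0 ->
  {ae mu, forall x, g0 x = F x} -> is_weak_derivative g0 f.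
Proof.
move=> hF mg h; have cF := prim_continuous hF; have lF := continuous_linc cF.
have h' : {ae mu, forall x, F x = g0 x} by apply: aeS h => x ->.
have lg : linc g0.
  by move=> a b; apply: rint_ae_eq (lF a b) => //; exact: continuous_measurable_fun.
split; [exact/linc_locally_integrable|exact/linc_locally_integrable/hF.1|].
move=> zeta tz; rewrite -(prim_by_parts hF tz).
have [_ _ sz'] := smoothP tz.1.
have mz : measurable_fun setT (derive1 zeta).
  rewrite (_ : derive1 zeta = (fun x => 'D_1 zeta x)); last first.
    by apply/funext => x; rewrite derive1E.
  exact: (continuous_measurable_fun (smooth_continuous (sz' 1))).
apply: Rint_ae_eq => //; first exact: measurable_funM.
  by apply: measurable_funM => //; exact: continuous_measurable_fun.
by apply: aeS h => x ->.
Qed.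

(** g0 minus a primitive of f is orthogonal to all derivatives of test
    functions, hence constant. *)
Lemma weak_derivative_prim g0 f : is_weak_derivative g0 f ->
  exists F, prim F f /\ {ae mu, forall x, g0 x = F x}.
Proof.
move=> [/linc_locally_integrable lg /linc_locally_integrable lf hw].
have [F [hF _]] := prim_exists lf.
have lF := continuous_linc (prim_continuous hF).
have [c hc] : exists c, {ae mu, forall x, g0 x - F x = c}.
  apply: du_bois_reymond; first exact: lincB.
  move=> zeta tz; have [_ _ sz'] := smoothP tz.1.
  have E : derive1 zeta = (fun x => 'D_1 zeta x) by apply/funext => x; rewrite derive1E.
  have tz' : test_function (derive1 zeta).
    split; first by rewrite E.
    apply: (@subclosed_compact _ _ (closure [set x | zeta x != 0])).
    - exact: closed_closure.
    - by case: tz.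
    - rewrite [X in _ `<=` X](closure_id _).1; last exact: closed_closure.
      apply: closure_subset => x /= zx; apply: contrapT => hx; move/eqP: zx; apply.
      by rewrite E; exact: derive_out_support.
  have -> : \int[mu]_x ((g0 x - F x) * derive1 zeta x) =
     \int[mu]_x (g0 x * derive1 zeta x) - \int[mu]_x (F x * derive1 zeta x).
    rewrite -RintB//; [|exact: test_int|exact: test_int].
    by apply: eq_Rint => x _; ring.
  by rewrite hw// (prim_by_parts hF tz) subrr.
exists (fun x => F x + c); split.
  by have := primD hF (prim_cst c); congr (prim _ _); apply/funext => x; rewrite addr0.
by apply: aeS hc => x <-; rewrite addrC subrK.
Qed.

Lemma weak_derivative_unique g0 f g : is_weak_derivative g0 f ->
  is_weak_derivative g0 g -> {ae mu, forall x, f x = g x}.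
Proof.
move=> [_ /linc_locally_integrable lf hf] [_ /linc_locally_integrable lg hg].
suff : {ae mu, forall x, f x - g x = 0}.
  by apply: aeS => x /eqP; rewrite subr_eq0 => /eqP.
apply: testing_zero; first exact: lincB.
move=> eta te; have -> : \int[mu]_x ((f x - g x) * eta x) =
   \int[mu]_x (f x * eta x) - \int[mu]_x (g x * eta x).
  rewrite -RintB//; [|exact: test_int|exact: test_int].
  by apply: eq_Rint => x _; ring.
by have := hf _ te; rewrite hg// => /oppr_inj ->; rewrite subrr.
Qed.

Lemma weak_derivativeP g0 f : is_weak_derivative g0 f ->
  measurable_fun setT (weak_derivative g0) /\
  {ae mu, forall x, weak_derivative g0 x = f x}.
Proof.
move=> hf; have hg : is_weak_derivative g0 (weak_derivative g0).
  exact: (@getPex _ [set g | is_weak_derivative g0 g] (ex_intro _ f hf)).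
split; last exact: weak_derivative_unique hg hf.
by case: hg => _ /linc_locally_integrable /linc_measurable.
Qed.

End WeakDerivative.

(** * Change of variables on the line *)

Section ChangeOfVariables.
Context {R : realType}.
Notation mu := (@lebesgue_measure R).
Variables (Psi Phi psi : R -> R).
Hypothesis dPsi : forall x : R, is_derive x 1 Psi (psi x).
Hypothesis cpsi : continuous psi.
Hypothesis psi0 : forall x, 0 <= psi x.
Hypothesis PhiK : cancel Phi Psi.
Hypothesis mono : {mono Psi : x y / x <= y}.
Local Hint Resolve mitv : core.

Let cPsi : continuous Psi := is_derive_continuous dPsi.
Let mPsi : measurable_fun [set: measurableTypeR R] (Psi : measurableTypeR R -> measurableTypeR R).
Proof. exact: continuous_measurable_fun. Qed.
Let mpsi : measurable_fun setT psi.
Proof. exact: continuous_measurable_fun. Qed.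

Let mpre (A : set (measurableTypeR R)) : measurable A -> measurable (Psi @^-1` A).
Proof. by move=> mA; rewrite -[X in measurable X]setTI; exact: mPsi. Qed.

(** The measure with density psi, pushed forward by Psi. *)
Definition image_density (A : set (measurableTypeR R)) : \bar R :=
  (\int[mu]_(x in Psi @^-1` A) (psi x)%:E)%E.

Let id0 : image_density set0 = 0%E.
Proof. by rewrite /image_density preimage_set0 integral_set0. Qed.

Let id_ge0 A : (0 <= image_density A)%E.
Proof. by apply: integral_ge0 => x _; rewrite lee_fin. Qed.

Let id_sigma : semi_sigma_additive image_density.
Proof.
move=> F mF tF mUF; rewrite /image_density preimage_bigcup.
rewrite ge0_integral_bigcup//.
- by apply: is_cvg_nneseries => n _ _; exact: id_ge0.
- by move=> n; exact: mpre.
- apply/measurable_EFinP; exact: measurable_funTS.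
- by move=> x _; rewrite lee_fin.
- apply/trivIsetP => /= i j _ _ ij; rewrite -preimage_setI.
  by move/trivIsetP : tF => /(_ _ _ _ _ ij) ->//; rewrite preimage_set0.
Qed.

HB.instance Definition _ := isMeasure.Build _ _ _ image_density id0 id_ge0 id_sigma.

(** Both measures agree on intervals, by the fundamental theorem of calculus. *)
Lemma image_densityE A : measurable A -> mu A = image_density A.
Proof.
apply: (lebesgue_measure_unique (mu := [the measure _ _ of image_density])).
move=> _ [[a b] /= _ <-].
rewrite /image_density lebesgue_measure_itv/= lte_fin.
have -> : Psi @^-1` `]a, b] = `]Phi a, Phi b]%classic.
  have aE x : (a < Psi x) = (Phi a < x) by rewrite -[in LHS](PhiK a) (leW_mono mono).
  have bE x : (Psi x <= b) = (x <= Phi b) by rewrite -[in LHS](PhiK b) mono.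
  by apply/seteqP; split => x /=; rewrite !in_itv/= aE bE.
have hab : (Phi a < Phi b) = (a < b) by rewrite -(leW_mono mono) !PhiK.
case: ifPn => [ab|]; last first.
  by rewrite -hab -leNgt => ba; rewrite set_itv_ge ?integral_set0// bnd_simp -leNgt.
rewrite integral_itv_obnd_cbnd; last first.
  by apply/measurable_EFinP; exact: measurable_funTS.
have hp := prim_C1 dPsi cpsi.
rewrite (EFin_Rint (mitv _ _)); last exact: hp.1.
by rewrite -hp.2 ?PhiK ?EFinB// ltW// hab.
Qed.

Import HBNNSimple.

Lemma ge0_change_of_variables (h : R -> R) : measurable_fun setT h ->
  (forall x, 0 <= h x) ->
  (\int[mu]_x (h (Psi x) * psi x)%:E = \int[mu]_x (h x)%:E)%E.
Proof.
move=> mh h0; have mh' : measurable_fun [set: measurableTypeR R] (EFin \o h).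
  exact/measurable_EFinP.
pose s := nnsfun_approx measurableT mh'.
have sh x : (fun n => (s n x)%:E) @ \oo --> (h x)%:E.
  by apply: (@cvg_nnsfun_approx _ _ _ _ measurableT _ mh') => // y _; rewrite /= lee_fin.
have snd x (a b : nat) : (a <= b)%N -> s a x <= s b x.
  by move=> ab; exact/lefP/nd_nnsfun_approx.
have -> : (\int[mu]_x (h x)%:E = limn (fun n => \int[mu]_x (s n x)%:E))%E.
  rewrite -monotone_convergence//.
  - by apply: eq_integral => x _; exact/esym/cvg_lim.
  - by move=> n; apply/measurable_EFinP; exact/measurable_funP.
  - by move=> n x _; rewrite lee_fin.
  - by move=> x _ a b ab; rewrite lee_fin snd.
have -> : (\int[mu]_x (h (Psi x) * psi x)%:E =
    limn (fun n => \int[mu]_x (s n (Psi x) * psi x)%:E))%E.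
  rewrite -monotone_convergence//.
  - apply: eq_integral => x _; apply/esym/cvg_lim => //.
    under eq_fun do rewrite EFinM.
    by rewrite EFinM; apply: cvgeZr; [|exact: sh].
  - move=> n; apply/measurable_EFinP; apply: measurable_funM => //.
    exact: (measurableT_comp (@measurable_funP _ _ _ _ _ (s n)) mPsi).
  - by move=> n x _; rewrite lee_fin mulr_ge0.
  - by move=> x _ a b ab; rewrite lee_fin ler_wpM2r// snd.
congr (limn _); apply/funext => n.
pose A y := s n @^-1` [set y].
have mA y : measurable (A y) by exact: measurable_sfunP.
transitivity (\int[mu]_x (\sum_(y \in range (s n)) (y * \1_(A y) (Psi x) * psi x)%:E))%E.
  apply: eq_integral => x _; rewrite fsumEFin// fimfunE; congr EFin.
  by rewrite [LHS]mulr_fsuml.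
rewrite ge0_integral_fsum//; last 2 first.
  - move=> y; apply/measurable_EFinP; apply: measurable_funM => //.
    apply: measurable_funM => //.
    have mI : measurable_fun [set: measurableTypeR R] (\1_(A y) : measurableTypeR R -> R).
      by apply: measurable_indic; exact: mA.
    exact: (measurableT_comp mI mPsi).
  - move=> y x _; rewrite lee_fin mulr_ge0//.
    have := nnfun_muleindic_ge0 (s n) y (Psi x); by rewrite -EFinM lee_fin.
transitivity (\int[mu]_x (\sum_(y \in range (s n)) (y * \1_(A y) x)%:E))%E; last first.
  by apply: eq_integral => x _; rewrite fsumEFin// fimfunE.
rewrite ge0_integral_fsum//; last 2 first.
  - by move=> y; apply/measurable_EFinP; apply: measurable_funM.
  - by move=> y x _; have := nnfun_muleindic_ge0 (s n) y x; rewrite -EFinM.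
apply: eq_fsbigr => y /set_mem [x0 _ yE].
have y0 : 0 <= y by rewrite -yE.
transitivity (y%:E * image_density (A y))%E.
  rewrite /image_density [X in (_ * X)%E]integral_mkcond -ge0_integralZl//.
  - apply: eq_integral => x _; rewrite patchE/= indicE /=.
    rewrite (_ : (x \in Psi @^-1` A y) = (Psi x \in A y)); last by apply/idP/idP; rewrite !inE.
    case: (_ \in _) => /=; first by rewrite mulr1 EFinM.
    by rewrite mulr0n mulr0 mul0r mule0.
  - have mE : measurable_fun (Psi @^-1` A y) (EFin \o psi).
      by apply/measurable_EFinP; exact: measurable_funTS.
    exact: ((measurable_restrictT _ (mpre (mA y))).1 mE).
  - by move=> x _; rewrite patchE; case: ifP => _; rewrite ?lee_fin.
rewrite -image_densityE// -[X in mu X]setIT -integral_indic// -ge0_integralZl//.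
by apply/measurable_EFinP.
Qed.

End ChangeOfVariables.

(** * Integration on the half plane *)

(** The half plane as a subset of the product of two Borel measurable lines, the
    type on which the product measure lives. *)
Definition hplane {R : realType} : set (measurableTypeR R * measurableTypeR R) :=
  half_plane.

Section Plane.
Context {R : realType}.
Notation mu := (@lebesgue_measure R).
Notation plane := (measurableTypeR R * measurableTypeR R)%type.
Notation mu2 := (@lebesgue_measure R \x @lebesgue_measure R)%E.
Notation D := (@hplane R).
Notation posR := (`]0, +oo[%classic : set R).

(** An open set is the union of the boxes with rational centre and rational
    radius that it contains. *)
Lemma open_measurable_plane (U : set plane) : open (U : set (R * R)) -> measurable U.
Proof.
move=> oU.
pose B (p q e : rat) : set plane := ball (ratr p : R) (ratr e) `*` ball (ratr q : R) (ratr e).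
have -> : U = \bigcup_p \bigcup_q \bigcup_e
    (if `[< B p q e `<=` U >] then B p q e else set0).
  apply/seteqP; split => [[x y] Uxy|z [p _] [q _] [e _]]; last by case: asboolP => // h /h.
  have nU : nbhs ((x, y) : R * R) U by exact: open_nbhs_nbhs.
  have [d hd] := nbhs_ex nU.
  have [e /andP[e0 ed]] : exists e : rat, (0 : R) < ratr e < d%:num / 2.
    have d2 : (0 : R) < d%:num / 2 by rewrite divr_gt0.
    by have [e] := rat_in_itvoo d2; rewrite in_itv/=; exists e.
  have app (t : R) : exists p : rat, ball (ratr p : R) (ratr e) t.
    have : (t - ratr e : R) < t + ratr e by rewrite ltrBlDr -addrA ltrDl addr_gt0.
    move=> /rat_in_itvoo[p]; rewrite in_itv/= => hp; exists p.
    by rewrite /ball/= distrC ltr_distlC.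
  have [p hp] := app x; have [q hq] := app y.
  exists p => //; exists q => //; exists e => //; case: asboolP => [_|]; first by split.
  move=> nh; exfalso; apply: nh => -[s t] [/= hs ht]; apply: hd.
  split => /=.
    apply: (@le_ball _ _ _ (ratr e + ratr e)); first by lra.
    by apply: ball_triangle hs; exact: ball_sym.
  apply: (@le_ball _ _ _ (ratr e + ratr e)); first by lra.
  by apply: ball_triangle ht; exact: ball_sym.
do 3 (apply: bigcupT_measurable_rat => ?).
by case: ifP => // _; apply: measurableX; exact: measurable_ball.
Qed.

Lemma continuous_measurable_plane (f : plane -> R) :
  continuous (f : R * R -> R) -> measurable_fun setT f.
Proof.
move=> cf; apply: (measurability _ (RGenOInfty.measurableE R)).
move=> /= _ [_ [a ->]] <-; apply: measurableI => //.
apply: open_measurable_plane; move/continuousP: cf; apply.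
exact: interval_open.
Qed.

Lemma measurable_half_plane : measurable (D : set plane).
Proof.
rewrite (_ : D = setT `*` posR); first by apply: measurableX => //; exact: measurable_itv.
by apply/seteqP; split => z; rewrite /hplane /half_plane /= in_itv/= andbT //; case.
Qed.

Lemma measurable_posR : measurable (posR : set (measurableTypeR R)).
Proof. exact: measurable_itv. Qed.

(** The sections of the half plane are half lines. *)
Lemma restrict_half_plane (F : plane -> R) x y :
  ((fun z : plane => (F z)%:E) \_ D) (x, y) = ((fun y => (F (x, y))%:E) \_ posR) y.
Proof.
rewrite !patchE; congr (if _ then _ else _).
by apply/idP/idP; rewrite !inE /hplane /half_plane /= in_itv/= andbT.
Qed.

Section Tonelli.
Variable F : plane -> R.
Hypothesis mF : measurable_fun D F.
Hypothesis F0 : forall z, D z -> 0 <= F z.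

Let mFD : measurable_fun [set: plane] ((fun z : plane => (F z)%:E) \_ D).
Proof.
have h : measurable_fun D (EFin \o F) by exact/measurable_EFinP.
exact: ((measurable_restrictT _ measurable_half_plane).1 h).
Qed.

Let FD0 z : (0 <= ((fun z : plane => (F z)%:E) \_ D) z)%E.
Proof. by rewrite patchE; case: ifPn => // /set_mem/F0; rewrite lee_fin. Qed.

Lemma tonelli1 : (\int[mu2]_(z in D) (F z)%:E =
  \int[mu]_x \int[mu]_(y in posR) (F (x, y))%:E)%E.
Proof.
rewrite integral_mkcond; apply: (eq_trans (fubini_tonelli1 _ mFD FD0)).
apply: eq_integral => x _.
rewrite /fubini_F [RHS]integral_mkcond; apply: eq_integral => y _.
exact: restrict_half_plane.
Qed.

Lemma tonelli2 : (\int[mu2]_(z in D) (F z)%:E =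
  \int[mu]_(y in posR) \int[mu]_x (F (x, y))%:E)%E.
Proof.
rewrite integral_mkcond; apply: (eq_trans (@fubini_tonelli2 _ _ _ _ _ mu mu _ mFD FD0)).
rewrite [RHS]integral_mkcond.
apply: eq_integral => y _; rewrite /fubini_G patchE; case: ifPn => hy.
  by apply: eq_integral => x _; rewrite restrict_half_plane patchE hy.
by apply: integral0_eq => x _; rewrite restrict_half_plane patchE (negbTE hy).
Qed.

End Tonelli.

(** Inner integrals of an integrable function are finite almost everywhere, so
    taking their finite parts changes nothing. *)
Lemma rint_fine {d} {T : measurableType d} (m : {measure set T -> \bar R})
    (A : set T) (g : T -> \bar R) : measurable A -> m.-integrable A g ->
  rint m A (fine \o g) /\ \int[m]_(x in A) fine (g x) = fine (\int[m]_(x in A) g x).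
Proof.
move=> mA ig; have mg := measurable_int _ ig.
have mfg : measurable_fun A (EFin \o (fine \o g)).
  by apply/measurable_EFinP; exact: measurableT_comp.
have ae : ae_eq m A (EFin \o (fine \o g)) g.
  by apply: filterS (integrable_ae mA ig) => x h Ax /=; rewrite fineK// h.
split; last by congr fine; exact: ae_eq_integral.
apply/integrableP; split => //.
have /integrableP[_] := ig; congr (_ < _)%E; apply: ae_eq_integral => //.
- exact: measurableT_comp.
- exact: measurableT_comp.
- by apply: filterS ae => x h Ax /=; rewrite -h.
Qed.

Section Fubini.
Variable F : plane -> R.
Hypothesis iF : rint mu2 D F.

Let iFD : mu2.-integrable setT ((fun z : plane => (F z)%:E) \_ D).
Proof. exact: (integrable_mkcond _ measurable_half_plane).1. Qed.

Lemma fubini1 : rint mu setT (fun x => \int[mu]_(y in posR) F (x, y)) /\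
  \int[mu2]_(z in D) F z = \int[mu]_x \int[mu]_(y in posR) F (x, y).
Proof.
have E x : fubini_F mu ((fun z : plane => (F z)%:E) \_ D) x = (\int[mu]_(y in posR) (F (x, y))%:E)%E.
  rewrite /fubini_F [RHS]integral_mkcond; apply: eq_integral => y _.
  exact: restrict_half_plane.
have := rint_fine measurableT (integrable_fubini_F iFD).
rewrite (funext E) => -[h1 h2]; split; first exact: h1.
rewrite {1}/Rintegral integral_mkcond.
have e := integral12_prod_meas1 iFD; rewrite (funext E) in e.
by rewrite -[X in fine X]e; exact: esym h2.
Qed.

Lemma fubini2 : rint mu posR (fun y => \int[mu]_x F (x, y)) /\
  \int[mu2]_(z in D) F z = \int[mu]_(y in posR) \int[mu]_x F (x, y).
Proof.
pose g y := (\int[mu]_x (F (x, y))%:E)%E.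
have E y : fubini_G mu ((fun z : plane => (F z)%:E) \_ D) y = (g \_ posR) y.
  rewrite /fubini_G patchE; case: ifPn => hy.
    by apply: eq_integral => x _; rewrite restrict_half_plane patchE hy.
  by apply: integral0_eq => x _; rewrite restrict_half_plane patchE (negbTE hy).
have mFG := measurable_fubini_G iFD.
have ig : mu.-integrable posR g.
  apply: (integrable_mkcond _ measurable_posR).2; rewrite -(funext E).
  apply/integrableP; split; first exact: mFG.
  have := (integrable21ltyP mu mu (measurable_int _ iFD)).1 iFD.
  have mFD := measurable_int _ iFD.
  have mG : measurable_fun setT (fubini_G mu (fun z => `|((fun z : plane => (F z)%:E) \_ D) z|%E)).
    by apply: measurable_fun_fubini_tonelli_G => //; exact: measurableT_comp.
  apply: le_lt_trans; apply: ge0_le_integral => //.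
  + exact: measurableT_comp mFG.
  + by move=> y yT; exact: le_abse_integral (measurableT_comp mFD (pair2_measurable y)).
have [h1 h2] := rint_fine measurable_posR ig; split; first exact: h1.
rewrite {1}/Rintegral integral_mkcond.
have e := integral21_prod_meas1 iFD; rewrite (funext E) -integral_mkcond in e.
by rewrite -[X in fine X]e; exact: esym h2.
Qed.

End Fubini.

End Plane.

(** * Chain rule in the plane *)

Section PlaneCalculus.
Context {R : realType}.
Notation e1 := ((1, 0) : R * R).
Notation e2 := ((0, 1) : R * R).
Implicit Types (f g zeta : R * R -> R).

(** Directional derivatives are derivatives along a line, which makes the
    calculus on the line available. *)
Lemma is_derive_line (V : normedModType R) (f : V -> R) (x v : V) (d : R) :
  is_derive (0 : R) 1 (fun t : R => f (t *: v + x)) d -> is_derive x v f d.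
Proof.
move=> [df vf].
have E : (fun h : R => h^-1 *: ((f \o shift x) (h *: v) - f x)) =
   (fun h : R => h^-1 *: (((fun t : R => f (t *: v + x)) \o shift 0) (h *: (1 : R)) - f (0 *: v + x))).
  by apply/funext => h /=; rewrite scale0r add0r addr0 [h *: 1]mulr1.
apply: DeriveDef; first by rewrite /derivable E.
by rewrite /derive E.
Qed.

Lemma line_is_derive (V : normedModType R) (f : V -> R) (x v : V) :
  derivable f x v -> is_derive (0 : R) 1 (fun t : R => f (t *: v + x)) ('D_v f x).
Proof.
move=> df.
have E : (fun h : R => h^-1 *: ((f \o shift x) (h *: v) - f x)) =
   (fun h : R => h^-1 *: (((fun t : R => f (t *: v + x)) \o shift 0) (h *: (1 : R)) - f (0 *: v + x))).
  by apply/funext => h /=; rewrite scale0r add0r addr0 [h *: 1]mulr1.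
apply: DeriveDef; first by move: df; rewrite /derivable E.
by rewrite /derive E.
Qed.

Lemma partial1 f (x y : R) : derivable f (x, y) e1 ->
  is_derive x 1 (fun t => f (t, y)) ('D_e1 f (x, y)).
Proof.
move=> /line_is_derive h; apply: is_derive_line; move: h.
congr (is_derive _ _ _ _); apply/funext => t; congr f.
by rewrite -[LHS]/(t * 1 + x, t * 0 + y) mulr0 add0r.
Qed.

Lemma partial2 f (x y : R) : derivable f (x, y) e2 ->
  is_derive y 1 (fun t => f (x, t)) ('D_e2 f (x, y)).
Proof.
move=> /line_is_derive h; apply: is_derive_line; move: h.
congr (is_derive _ _ _ _); apply/funext => t; congr f.
by rewrite -[LHS]/(t * 0 + x, t * 1 + y) mulr0 add0r.
Qed.

(** The chain rule along a plane curve needs only one continuous partial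
    derivative: the increment in the first variable is treated by the mean value
    theorem, that in the second by the definition. *)
Lemma is_derive_curve f (a b : R -> R) (t0 a' b' : R) :
  (forall z, derivable f z e1) -> (forall z, derivable f z e2) ->
  continuous (fun z => 'D_e1 f z) ->
  is_derive t0 1 a a' -> is_derive t0 1 b b' ->
  is_derive t0 1 (fun t => f (a t, b t))
    ('D_e1 f (a t0, b t0) * a' + 'D_e2 f (a t0, b t0) * b').
Proof.
move=> d1 d2 c1 ha hb.
have h2 : is_derive t0 1 (fun t => f (a t0, b t)) ('D_e2 f (a t0, b t0) * b').
  exact: (is_der_comp (partial2 (d2 _)) hb).
pose g t := f (a t, b t) - f (a t0, b t).
suff h1 : is_derive t0 1 g ('D_e1 f (a t0, b t0) * a').
  have := is_der_add h1 h2; congr (is_derive _ _ _ _).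
  by apply/funext => t; rewrite /g subrK.
have mvt t : exists c, `|c - a t0| <= `|a t - a t0| /\ g t = 'D_e1 f (c, b t) * (a t - a t0).
  have cf y : continuous (fun x => f (x, y)).
    by apply: is_derive_continuous => x; exact: partial1.
  have [xy|/ltW yx] := leP (a t0) (a t).
    have [c] := @MVT_segment _ (fun x => f (x, b t)) _ _ _ xy
      (fun x _ => partial1 (d1 (x, b t))) (continuous_subspaceT (cf _)).
    rewrite in_itv/= => /andP[xc cy] h; exists c; split; last exact: h.
    by rewrite !ger0_norm ?subr_ge0// lerB.
  have [c] := @MVT_segment _ (fun x => f (x, b t)) _ _ _ yx
    (fun x _ => partial1 (d1 (x, b t))) (continuous_subspaceT (cf _)).
  rewrite in_itv/= => /andP[yc cx] h; exists c; split.
    by rewrite !ler0_norm ?subr_le0// !opprB lerB.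
  by rewrite /g -[LHS]opprB h -mulrN opprB.
pose c t := projT1 (cid (mvt t)).
have hc t : `|c t - a t0| <= `|a t - a t0| := (projT2 (cid (mvt t))).1.
have gc t : g t = 'D_e1 f (c t, b t) * (a t - a t0) := (projT2 (cid (mvt t))).2.
have ca : {for t0, continuous a}.
  by apply: differentiable_continuous; apply/derivable1_diffP; case: ha.
have cb : {for t0, continuous b}.
  by apply: differentiable_continuous; apply/derivable1_diffP; case: hb.
have cc : c t @[t --> t0] --> a t0.
  apply/cvgrPdist_le => e e0; move/cvgrPdist_le : ca => /(_ _ e0).
  by apply: filterS => t ht; rewrite distrC (le_trans (hc t))// distrC.
have lim1 : 'D_e1 f (c t, b t) @[t --> t0] --> 'D_e1 f (a t0, b t0).
  have hp : (c t, b t) @[t --> t0] --> (a t0, b t0) by exact: cvg_pair cc cb.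
  exact: (cvg_comp _ _ hp (c1 (a t0, b t0))).
have lim0 : h^-1 *: ((g \o shift t0) (h *: (1 : R)) - g t0) @[h --> 0^'] -->
    'D_e1 f (a t0, b t0) * a'.
  have [da va] := ha.
  have hq : h^-1 *: ((a \o shift t0) (h *: (1 : R)) - a t0) @[h --> 0^'] --> a'.
    by rewrite -va.
  have E : (fun h : R => h^-1 *: ((g \o shift t0) (h *: (1 : R)) - g t0)) =
     (fun h => 'D_e1 f (c (h + t0), b (h + t0)) * (h^-1 *: ((a \o shift t0) (h *: (1 : R)) - a t0))).
    apply/funext => h /=; rewrite {2}/g subrr subr0 gc [h *: 1]mulr1.
    by rewrite /GRing.scale/=; ring.
  rewrite E; apply: cvgM => //.
  have sh : h + t0 @[h --> 0^'] --> t0.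
    have h0 : (fun h : R => h + t0) @ (0 : R) --> 0 + t0.
      exact: (cvgD (@cvg_id _ _) (cvg_cst t0)).
    by rewrite add0r in h0; exact: cvg_within_filter h0.
  exact: (cvg_comp _ _ sh lim1).
by apply: DeriveDef; [apply/cvg_ex; eexists; exact: lim0|exact/cvg_lim].
Qed.

Lemma smooth_partials f : smooth f ->
  [/\ continuous f, forall z, derivable f z e1, forall z, derivable f z e2,
     continuous (fun z => 'D_e1 f z) & continuous (fun z => 'D_e2 f z)].
Proof.
case/smoothP => cf df sf; split => //; first by case: (smoothP (sf e1)).
by case: (smoothP (sf e2)).
Qed.

Section Substitution.
Variables (Psi psi : R -> R) (lam : R).
Hypothesis dPsi : forall x : R, is_derive x 1 Psi (psi x).
Hypothesis spsi : smooth psi.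

Definition subst_map (z : R * R) : R * R := (Psi z.1, lam * z.2).

Lemma subst_is_derive f (x y : R) (v : R * R) : smooth f ->
  is_derive (x, y) v (fun z => f (subst_map z))
    ('D_e1 f (Psi x, lam * y) * (psi x * v.1) + 'D_e2 f (Psi x, lam * y) * (lam * v.2)).
Proof.
move=> sf; have [_ d1 d2 c1 _] := smooth_partials sf.
have h1 (p q : R) : is_derive (0 : R) 1 (fun t : R => t * p + q) p.
  have := is_der_affine p q 0; congr (is_derive _ _ _ _).
  by apply/funext => t; rewrite mulrC.
have := @is_derive_curve f (fun t => Psi (t * v.1 + x)) (fun t => lam * (t * v.2 + y)) 0
   (psi x * v.1) (lam * v.2) d1 d2 c1.
rewrite !mul0r !add0r => h; apply: is_derive_line; apply: h.
  apply: (@is_der_comp _ Psi (fun t => t * v.1 + x)) => //.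
  by rewrite mul0r add0r.
Qed.

Lemma fst_is_derive (a : R -> R) (a' x y : R) (v : R * R) : is_derive x 1 a a' ->
  is_derive ((x, y) : R * R) v (fun z => a z.1) (a' * v.1).
Proof.
move=> ha; apply: is_derive_line.
apply: (@is_der_comp _ a (fun t => t * v.1 + x)).
  by rewrite mul0r add0r.
have := is_der_affine v.1 x 0; congr (is_derive _ _ _ _).
by apply/funext => t; rewrite mulrC.
Qed.

(** A class stable under directional derivatives that contains all compositions
    with the substitution. *)
Inductive subst_sum : (R * R -> R) -> Prop :=
| SSM a g : smooth a -> smooth g -> subst_sum (fun z => a z.1 * g (subst_map z))
| SSD f g : subst_sum f -> subst_sum g -> subst_sum (fun z => f z + g z).

Let csubst : continuous subst_map.
Proof.
have cPsi := is_derive_continuous dPsi.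
move=> z; have h1 : Psi w.1 @[w --> z] --> Psi z.1.
  by apply: continuous_comp; [exact: cvg_fst|exact: cPsi].
have h2 : lam * w.2 @[w --> z] --> lam * z.2 by apply: cvgMl_tmp; exact: cvg_snd.
exact: cvg_pair h1 h2.
Qed.

Lemma smooth_subst f : smooth f -> smooth (fun z => f (subst_map z)).
Proof.
move=> sf; apply: (@smooth_class _ _ subst_sum); last first.
  have := SSM (smooth_cst 1) sf; congr subst_sum; apply/funext => z.
  by rewrite mul1r.
move=> h; elim=> {h} [a g sa sg|f1 f2 _ [c1 d1 p1] _ [c2 d2 p2]]; last first.
  split.
  - by move=> z; apply: cvgD; [exact: c1|exact: c2].
  - by move=> z v; apply: derivableD.
  - move=> v; rewrite (_ : (fun z => _) = (fun z => 'D_v f1 z + 'D_v f2 z)); first exact: SSD.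
    by apply/funext => z; rewrite (deriveD (d1 _ _) (d2 _ _)).
have [a' sa' ha] := smooth_is_derive sa.
have [cg dg sg'] := smoothP sg.
have hM (x y : R) (v : R * R) : is_derive (x, y) v (fun z => a z.1 * g (subst_map z))
   (a x * ('D_e1 g (Psi x, lam * y) * (psi x * v.1) + 'D_e2 g (Psi x, lam * y) * (lam * v.2)) +
    g (Psi x, lam * y) * (a' x * v.1)).
  exact: (is_deriveM (fst_is_derive y v (ha x)) (subst_is_derive x y v sg)).
split.
- move=> z; apply: cvgM.
    apply: continuous_comp; first exact: cvg_fst.
    exact: (smooth_continuous sa).
  by apply: continuous_comp; [exact: csubst|exact: cg].
- by move=> [x y] v; case: (hM x y v).
- move=> v.
  have := SSD (SSD (SSM (smoothZ v.1 (smoothM sa spsi)) (sg' e1))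
                   (SSM (smoothZ (lam * v.2) sa) (sg' e2)))
              (SSM (smoothZ v.1 sa') sg).
  congr subst_sum; apply/funext => -[x y]; case: (hM x y v) => _ ->.
  by rewrite /subst_map/=; ring.
Qed.

End Substitution.

End PlaneCalculus.

(** * Test functions of the plane *)

Section PlaneTest.
Context {R : realType}.
Notation mu := (@lebesgue_measure R).
Notation plane := (measurableTypeR R * measurableTypeR R)%type.
Notation mu2 := (@lebesgue_measure R \x @lebesgue_measure R)%E.
Notation D := (@hplane R).
Notation e1 := ((1, 0) : R * R).
Notation e2 := ((0, 1) : R * R).
Implicit Types (f g zeta : R * R -> R).

Lemma prod_norm_le (x y K : R) : (`|(x, y)| <= K) = (`|x| <= K) && (`|y| <= K).
Proof. by rewrite prod_normE/= ge_max. Qed.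

Lemma box_compact (a b c d : R) : compact ([set z : R * R | z.1 \in `[a, b] /\ z.2 \in `[c, d]]).
Proof.
have := compact_setX (@segment_compact R a b) (@segment_compact R c d).
by congr compact; apply/seteqP; split => z.
Qed.

Lemma plane_support_rint f K : continuous f -> (forall z, K < `|z| -> f z = 0) ->
  rint mu2 D (f : plane -> R).
Proof.
move=> cf f0; pose B : set plane := [set z : R * R | z.1 \in `[- K, K] /\ z.2 \in `[- K, K]].
have BE : B = `[- K, K]%classic `*` `[- K, K]%classic by apply/seteqP; split => z.
have mB : measurable B by rewrite BE; apply: measurableX; exact: mitv.
have [C hC] : exists C, forall z, B z -> `|f z| <= C.
  have : compact (f @` B).
    apply: continuous_compact; last exact: box_compact.
    exact: continuous_subspaceT.
  by move=> /compact_norm_le[C hC]; exists C => z Bz; apply: hC; exists z.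
have fB z : `|f z| <= `|C| * \1_B z.
  rewrite indicE; case: (boolP (z \in B)) => [|nB].
    by move=> /set_mem/hC h; rewrite mulr1 (le_trans h)// ler_norm.
  rewrite mulr0 f0 ?normr0// ltNge; apply: contra nB => zK.
  by rewrite inE; case: z zK => x y; rewrite prod_norm_le !ler_norml => /andP[].
have iB : mu2.-integrable setT (fun z : plane => (\1_B z)%:E).
  apply/integrableP; split; first exact/measurable_EFinP.
  rewrite (eq_integral (fun z : plane => (\1_B z)%:E)); last first.
    by move=> t _; rewrite gee0_abs// lee_fin.
  have e : mu2 (`[- K, K]%classic `*` `[- K, K]%classic) = (mu `[(- K)%R, K] * mu `[(- K)%R, K])%E.
    by apply: product_measure1E; exact: mitv.
  rewrite integral_indic// setIT BE [X in (X < _)%E]e.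
  have fin : (mu `[(- K)%R, K] < +oo)%E by apply: compact_finite_measure; exact: segment_compact.
  by rewrite lte_mul_pinfty// ge0_fin_numE.
have mf : measurable_fun setT (f : plane -> R) by exact: continuous_measurable_plane.
have h : rint mu2 setT (f : plane -> R).
  apply: (@le_rint _ _ _ mu2 _ measurableT f (fun z => `|C| * \1_B z)) => //.
  by apply: rintZ.
by apply: integrableS h => //; exact: measurable_half_plane.
Qed.

Lemma plane_support_sqint f K : continuous f -> (forall z, K < `|z| -> f z = 0) ->
  sqint mu2 D (f : plane -> R).
Proof.
move=> cf f0; split; first by apply: measurable_funTS; exact: continuous_measurable_plane.
apply: (@plane_support_rint _ K) => [z|z /f0 ->]; last by rewrite expr0n.
exact: (continuousM (cf z) (cf z)).
Qed.

Lemma gradient_sq2 zeta : test_function zeta -> sq2 mu2 D (gradient zeta : plane -> R * R).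
Proof.
move=> tz; have [K hK] := test_function_bound tz.
have [_ _ _ c1 c2] := smooth_partials tz.1.
split.
  by apply: (plane_support_sqint c1) => z /hK[_ h]; exact: h.
by apply: (plane_support_sqint c2) => z /hK[_ h]; exact: h.
Qed.

Lemma gradient_lin c f g : smooth f -> smooth g ->
  gradient (fun z => c * f z + g z) = (fun z => c *: gradient f z + gradient g z).
Proof.
move=> sf sg; have [_ d1 d2 _ _] := smooth_partials sf.
have [_ d1' d2' _ _] := smooth_partials sg.
apply/funext => z; rewrite -[RHS]/(c * 'D_e1 f z + 'D_e1 g z, c * 'D_e2 f z + 'D_e2 g z).
have hl v : derivable f z v -> derivable g z v -> 'D_v (fun z => c * f z + g z) z = c * 'D_v f z + 'D_v g z.
  move=> df dg; have h := is_deriveD (is_deriveZ c (derivableP df)) (derivableP dg).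
  by case: h.
by rewrite /gradient !hl.
Qed.

Lemma gradient0 : gradient (cst 0 : R * R -> R) = (fun=> 0).
Proof. by apply/funext => z; rewrite /gradient !derive_cst. Qed.

Definition test_gradients : set (plane -> R * R) :=
  [set A | exists zeta : R * R -> R, test_function zeta /\ A = gradient zeta].

(** The existence of the stray field: projection_exists for the linear space of
    the gradients of test functions. *)
Lemma stray_projection (K : plane -> R * R) : sq2 mu2 D K ->
  exists G, [/\ sq2 mu2 D G,
    exists A, (forall n, test_gradients (A n)) /\ L2lim mu2 D A G &
    forall zeta : R * R -> R, test_function zeta ->
      ip mu2 D K (gradient zeta) = ip mu2 D G (gradient zeta)].
Proof.
move=> sK.
have [||A [z [tz ->]]|G [sG hA hG]] := @projection_exists _ _ _ mu2 D measurable_half_plane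
   test_gradients _ _ _ K sK.
- by exists (cst 0); split; [exact: test_function0|rewrite gradient0].
- move=> c A B [f [tf ->]] [g [tg ->]]; exists (fun z => c * f z + g z); split.
    by apply: test_functionD => //; exact: test_functionZ.
  by rewrite gradient_lin//; [case: tf|case: tg].
- exact: gradient_sq2.
by exists G; split => // zeta tz; apply: hG; exists zeta.
Qed.

Lemma trace_is_derive zeta (y x : R) : test_function zeta ->
  is_derive x 1 (fun x => zeta (x, y)) ('D_e1 zeta (x, y)).
Proof.
by move=> [/smooth_partials[_ d1 _ _ _] _]; apply: partial1; exact: d1.
Qed.

Lemma section_continuous1 f y : continuous f -> continuous (fun x : R => f (x, y)).
Proof.
move=> cf x; have h : (t, y) @[t --> x] --> (x, y).
  exact: (cvg_pair (@cvg_id _ _) (cvg_cst y)).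
exact: (cvg_comp _ _ h (cf (x, y))).
Qed.

Lemma section_continuous2 f x : continuous f -> continuous (fun y : R => f (x, y)).
Proof.
move=> cf y; have h : (x, t) @[t --> y] --> (x, y).
  exact: (cvg_pair (cvg_cst x) (@cvg_id _ _)).
exact: (cvg_comp _ _ h (cf (x, y))).
Qed.

(** Integration by parts on a horizontal line. *)
Lemma section_by_parts (g g' : R -> R) zeta (y : R) : prim g g' -> test_function zeta ->
  [/\ rint mu setT (fun x => g' x * zeta (x, y)),
   rint mu setT (fun x => g x * 'D_e1 zeta (x, y)) &
  \int[mu]_x (g x * 'D_e1 zeta (x, y)) = - \int[mu]_x (g' x * zeta (x, y))].
Proof.
move=> hg tz; have [K hK] := test_function_bound tz.
have [cz _ _ c1 _] := smooth_partials tz.1.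
have hz : prim (fun x => zeta (x, y)) (fun x => 'D_e1 zeta (x, y)).
  apply: prim_C1 => [x|]; first exact: trace_is_derive.
  exact: (@section_continuous1 _ y c1).
have hM := primM hg hz.
have z0 (x : R) : K < `|x| -> zeta (x, y) = 0 /\ 'D_e1 zeta (x, y) = 0.
  move=> Kx; have /hK[h1 h2] : K < `|(x, y)| by rewrite prod_normE/= lt_max Kx.
  by split => //; exact: h2.
have i1 : rint mu setT (fun x => g' x * zeta (x, y)).
  apply: (@Rint_support _ _ K _ _).1; last by move=> x /z0[-> _]; rewrite mulr0.
  rewrite (_ : (fun x => _) = (fun x => zeta (x, y) * g' x)).
    by apply: linc_contM; [exact: (@section_continuous1 _ y cz)|exact: hg.1].
  by apply/funext => x; rewrite mulrC.
have i2 : rint mu setT (fun x => g x * 'D_e1 zeta (x, y)).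
  apply: (@Rint_support _ _ K _ _).1; last by move=> x /z0[_ ->]; rewrite mulr0.
  by apply: linc_contM; [exact: prim_continuous hg|exact: hz.1].
split => //.
have := @prim_support_int0 R _ _ K hM; rewrite RintD// => h0.
apply/eqP; rewrite -addr_eq0 addrC; apply/eqP; apply: h0 => x /z0[-> ->].
by rewrite !mulr0 addr0.
Qed.

End PlaneTest.

(** * Stray field of a profile *)

Section Stray.
Context {R : realType}.
Notation mu := (@lebesgue_measure R).
Notation plane := (measurableTypeR R * measurableTypeR R)%type.
Notation mu2 := (@lebesgue_measure R \x @lebesgue_measure R)%E.
Notation D := (@hplane R).
Notation posR := (`]0, +oo[%classic : set R).
Notation ip := (ip mu2 D).
Notation sq2 := (sq2 mu2 D).
Implicit Types (zeta : R * R -> R) (f g F : R -> R) (G H K : plane -> R * R).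

(** The gradients of the elements of the homogeneous Sobolev space of the half
    plane. *)
Definition grad_closure G := sq2 G /\
  exists A, (forall n, test_gradients (A n)) /\ L2lim mu2 D A G.

(** The weak form of div K = 0 in the half plane with vertical component - F on
    its boundary. For K = grad u this is the boundary value problem of the stray
    field potential with F = m_1 prime. *)
Definition neumann F K := forall zeta, test_function zeta ->
  ip K (gradient zeta) = \int[mu]_x (F x * zeta (x, 0)).

Lemma test_gradients_sq2 (A : plane -> R * R) : test_gradients A -> sq2 A.
Proof. by move=> [z [tz ->]]; exact: gradient_sq2. Qed.

(** Identities between the actions on test gradients extend to the closure by
    continuity. *)
Lemma closure_ip K1 K2 H : grad_closure H -> sq2 K1 -> sq2 K2 ->
  (forall zeta, test_function zeta -> ip K1 (gradient zeta) = ip K2 (gradient zeta)) ->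
  ip K1 H = ip K2 H.
Proof.
move=> [sH [A [tA lA]]] s1 s2 h.
have sA n := test_gradients_sq2 (tA n).
have l1 := L2lim_ip measurable_half_plane sA sH s1 lA.
have l2 := L2lim_ip measurable_half_plane sA sH s2 lA.
have E : (fun n => ip (A n) K1) = (fun n => ip (A n) K2).
  by apply/funext => n; have [z [tz ->]] := tA n; rewrite ipC h// ipC.
rewrite E in l1; rewrite ipC [RHS]ipC.
by rewrite -(cvg_lim (@Rhausdorff R) l1) -(cvg_lim (@Rhausdorff R) l2).
Qed.

(** The Dirichlet principle in dual form: among the fields with the flux F the
    gradient has the least energy, because the others differ from it by a field
    orthogonal to all gradients. *)
Lemma thomson F G K : grad_closure G -> neumann F G -> sq2 K -> neumann F K ->
  ip G G <= ip K K.
Proof.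
move=> cG nG sK nK.
have e : ip K G = ip G G.
  by apply: closure_ip => // [|z tz]; [case: cG|rewrite nK// nG].
have := ip_convex measurable_half_plane cG.1 sK.
rewrite (ipBr measurable_half_plane sK cG.1 cG.1).
by rewrite (ipC mu2 D G K) e subrr mulr0 addr0.
Qed.

(** The stray energy of a changed flux lies above its tangent, and the tangent
    can be evaluated with any field K carrying the change of the flux. This
    avoids solving a boundary value problem for the change. *)
Lemma stray_convex F F1 G G1 K : grad_closure G -> neumann F G ->
  grad_closure G1 -> neumann F1 G1 -> sq2 K ->
  (forall zeta, test_function zeta ->
     ip K (gradient zeta) = \int[mu]_x (F1 x * zeta (x, 0)) - \int[mu]_x (F x * zeta (x, 0))) ->
  ip G G + 2 * ip G K <= ip G1 G1.
Proof.
move=> cG nG cG1 nG1 sK nK.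
have sG := cG.1; have sG1 := cG1.1.
have sB := sq2B measurable_half_plane sG1 sG.
have e : ip (fun z => G1 z - G z) G = ip K G.
  apply: closure_ip => // z tz.
  by rewrite (ipBl measurable_half_plane sG1 sG (gradient_sq2 tz)) nK// nG1// nG.
have := ip_convex measurable_half_plane sG sG1.
by rewrite (ipC mu2 D G (fun z => G1 z - G z)) e (ipC mu2 D K G).
Qed.

Lemma exp_is_derive (m y : R) : is_derive y 1 (fun y => expR (- (m * y))) (- m * expR (- (m * y))).
Proof.
have h : is_derive y 1 (fun y => - (m * y)) (- m).
  have := is_der_affine (- m) 0 y; congr (is_derive _ _ _ _).
  by apply/funext => t; rewrite addr0 mulNr.
by have := is_der_comp (is_derive_expR _) h; rewrite mulrC.
Qed.

Lemma exp_continuous (m : R) : continuous (fun y : R => expR (- (m * y))).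
Proof. exact: is_derive_continuous (exp_is_derive m). Qed.

Lemma exp_integral (m : R) : 0 < m ->
  (\int[mu]_(y in posR) (expR (- (m * y)))%:E = (m^-1)%:E)%E.
Proof.
move=> m0; rewrite integral_itv_obnd_cbnd; last first.
  apply/measurable_EFinP; apply: measurable_funTS.
  by apply: continuous_measurable_fun; exact: exp_continuous.
pose P y := - m^-1 * expR (- (m * y)).
have dP (y : R) : is_derive y 1 P (expR (- (m * y))).
  have := is_der_scale (- m^-1) (exp_is_derive m y).
  by rewrite mulrA mulrNN mulVf ?gt_eqF// mul1r.
have lim : P x @[x --> +oo] --> 0.
  have h : expR (- (m * x)) @[x --> +oo] --> (0 : R).
    apply: (@cvg_comp _ _ _ (fun x => m * x) (fun x => expR (- x)) _ (pinfty_nbhs R)).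
      by apply: gt0_cvgMry => //; exact: cvg_id.
    exact: cvgr_expR.
  rewrite -(mulr0 (- m^-1)); exact: cvgMl_tmp.
rewrite (@ge0_continuous_FTC2y R _ P 0 0) //.
- by rewrite /P mulr0 oppr0 expR0 mulr1 -EFinB sub0r opprK.
- by apply: continuous_subspaceT; exact: exp_continuous.
- by apply: cvg_at_right_filter; exact: (is_derive_continuous dP).
- by move=> y _; rewrite derive1E; case: (dP y).
Qed.

Lemma measurable_fst_comp f : measurable_fun setT f ->
  measurable_fun [set: plane] (fun z : plane => f z.1).
Proof. by move=> mf; exact: (measurableT_comp mf measurable_fst). Qed.

Lemma measurable_snd_comp f : measurable_fun setT f ->
  measurable_fun [set: plane] (fun z : plane => f z.2).
Proof. by move=> mf; exact: (measurableT_comp mf measurable_snd). Qed.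

Lemma measurable_exp_factor f (m : R) : measurable_fun setT f ->
  measurable_fun [set: plane] (fun z : plane => f z.1 * expR (- (m * z.2))).
Proof.
move=> mf; apply: measurable_funM; first exact: measurable_fst_comp.
have h : measurable_fun setT (fun y : R => expR (- (m * y))).
  by apply: continuous_measurable_fun; exact: exp_continuous.
exact: (measurable_snd_comp h).
Qed.

(** Tonelli, the integral over a vertical half line being explicit. *)
Lemma sqint_exp f (m : R) : 0 < m -> sqint mu setT f ->
  sqint mu2 D (fun z => f z.1 * expR (- (m * z.2))) /\
  \int[mu2]_(z in D) ((f z.1 * expR (- (m * z.2))) ^+ 2) =
    (2 * m)^-1 * \int[mu]_x (f x ^+ 2).
Proof.
move=> m0 [mf f2].
have m2 : 0 < 2 * m by rewrite mulr_gt0.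
have mF := measurable_exp_factor m mf.
have e : (\int[mu2]_(z in D) ((f z.1 * expR (- (m * z.2))) ^+ 2)%:E =
    ((2 * m)^-1 * \int[mu]_x (f x ^+ 2))%:E)%E.
  rewrite (tonelli1 (F := fun z => (f z.1 * expR (- (m * z.2))) ^+ 2)); last 2 first.
  - by apply: measurable_funTS; exact: measurable_funX.
  - by move=> z _; exact: sqr_ge0.
  transitivity (\int[mu]_x (((2 * m)^-1 * f x ^+ 2)%:E))%E; last first.
    by rewrite (EFin_Rint measurableT) ?(RintZ measurableT)//; exact: rintZ.
  apply: eq_integral => x _ /=.
  transitivity (\int[mu]_(y in posR) ((f x ^+ 2)%:E * (expR (- (2 * m * y)))%:E))%E.
    apply: eq_integral => y _; rewrite -EFinM exprMn -expRM_natr; congr (_ * expR _)%:E.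
    by ring.
  have me : measurable_fun posR (fun y : R => (expR (- (2 * m * y)))%:E).
    apply/measurable_EFinP; apply: measurable_funTS.
    by apply: continuous_measurable_fun; exact: exp_continuous.
  rewrite ge0_integralZl//.
  + by rewrite exp_integral// -EFinM mulrC.
  + by rewrite lee_fin sqr_ge0.
split; last by rewrite /Rintegral e.
split; first exact: measurable_funTS.
apply/integrableP; split.
  by apply/measurable_EFinP; apply: measurable_funTS; exact: measurable_funX.
rewrite (_ : (\int[mu2]_(z in D) _ = \int[mu2]_(z in D) ((f z.1 * expR (- (m * z.2))) ^+ 2)%:E)%E).
  by rewrite e ltry.
by apply: eq_integral => z _ /=; rewrite ger0_norm// sqr_ge0.
Qed.

(** The gradient of g x * exp (- m y), rotated by a quarter turn: a field
    without divergence whose boundary flux is the derivative of g. The decay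
    rate m weighs g against its derivative in the norm (exp_field_norm). *)
Definition exp_field (m : R) (g g' : R -> R) : plane -> R * R := fun z =>
  (- (m * (g z.1 * expR (- (m * z.2)))), - (g' z.1 * expR (- (m * z.2)))).

Lemma exp_field_sq2 m g g' : 0 < m -> sqint mu setT g -> sqint mu setT g' ->
  sq2 (exp_field m g g').
Proof.
move=> m0 sg sg'; have mD := @measurable_half_plane R.
split; apply: sqintN => //; last exact: (sqint_exp m0 sg').1.
by apply: sqintZ => //; exact: (sqint_exp m0 sg).1.
Qed.

Lemma exp_field_norm m g g' : 0 < m -> sqint mu setT g -> sqint mu setT g' ->
  ip (exp_field m g g') (exp_field m g g') =
  (m * \int[mu]_x (g x ^+ 2) + m^-1 * \int[mu]_x (g' x ^+ 2)) / 2.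
Proof.
move=> m0 sg sg'; have mD := @measurable_half_plane R.
rewrite ip_sqint//; last exact: exp_field_sq2.
have [s1 i1] := sqint_exp m0 sg; have [s2 i2] := sqint_exp m0 sg'.
rewrite (_ : \int[mu2]_(z in D) ((exp_field m g g' z).1 ^+ 2) =
   m ^+ 2 * \int[mu2]_(z in D) ((g z.1 * expR (- (m * z.2))) ^+ 2)); last first.
  by rewrite -RintZ//; [apply: eq_Rint => z _; rewrite /exp_field/=; ring|case: s1].
rewrite (_ : \int[mu2]_(z in D) ((exp_field m g g' z).2 ^+ 2) =
   \int[mu2]_(z in D) ((g' z.1 * expR (- (m * z.2))) ^+ 2)); last first.
  by apply: eq_Rint => z _; rewrite /exp_field/= sqrrN.
by rewrite i1 i2; field; rewrite gt_eqF.
Qed.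

End Stray.

Section ExponentialField.
Context {R : realType}.
Notation mu := (@lebesgue_measure R).
Notation plane := (measurableTypeR R * measurableTypeR R)%type.
Notation mu2 := (@lebesgue_measure R \x @lebesgue_measure R)%E.
Notation D := (@hplane R).
Notation e1 := ((1, 0) : R * R).
Notation e2 := ((0, 1) : R * R).
Notation posR := (`]0, +oo[%classic : set R).
Notation ip := (ip mu2 D).
Notation sq2 := (sq2 mu2 D).
Implicit Types (zeta : R * R -> R) (f g F : R -> R) (G H K : plane -> R * R).
Local Hint Resolve mitv : core.

(** The fundamental theorem of calculus on the half line, for an integrand that
    vanishes far away. *)
Lemma Rint_pos_prim F f (K : R) : prim F f -> 0 <= K ->
  (forall y, K < y -> f y = 0) ->
  rint mu posR f /\ \int[mu]_(y in posR) f y = F K - F 0.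
Proof.
move=> hF K0 f0.
have io : mu.-integrable `]0, K] (EFin \o f).
  by apply: integrableS (hF.1 0 K) => //; exact: subset_itv_oc_cc.
have E : f \_ posR = f \_ `]0, K].
  apply/funext => y; rewrite !patchE; case: ifPn => hy; last first.
    rewrite ifF//; apply: contraNF hy; rewrite !inE/= !in_itv/= => /andP[-> _]//.
  case: ifPn => // hy'; apply: f0; rewrite ltNge; apply: contra hy' => yK.
  by move: hy; rewrite !inE/= !in_itv/= andbT yK => ->.
split.
  have E' : (EFin \o f) \_ posR = (EFin \o f) \_ `]0, K] by rewrite !restrict_EFin E.
  apply: (integrable_mkcond _ (@measurable_posR R)).2; rewrite E'.
  by apply: (integrable_mkcond _ _).1 io.
by rewrite hF.2// Rintegral_mkcond -Rintegral_itv_obnd_cbnd// [RHS]Rintegral_mkcond E.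
Qed.

(** Horizontal integration by parts moves the derivative from zeta to g; the
    result is a vertical derivative of exp (- m y) zeta, which integrates to the
    boundary value. *)
Lemma exp_field_neumann m g g' : 0 < m -> prim g g' ->
  sqint mu setT g -> sqint mu setT g' -> neumann g' (exp_field m g g').
Proof.
move=> m0 hg sg sg' zeta tz.
have mD := @measurable_half_plane R.
have [K hK] := test_function_bound tz.
have [cz d1 d2 c1 c2] := smooth_partials tz.1.
have sz := gradient_sq2 tz.
have [s1 _] := sqint_exp m0 sg; have [s2 _] := sqint_exp m0 sg'.
have sZ : sqint mu2 D (zeta : plane -> R).
  by apply: (plane_support_sqint cz) => z /hK[].
pose A (z : plane) : R := m * ((g z.1 * expR (- (m * z.2))) * 'D_e1 zeta z).
pose A' (z : plane) : R := m * ((g' z.1 * expR (- (m * z.2))) * zeta z).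
pose B (z : plane) : R := (g' z.1 * expR (- (m * z.2))) * 'D_e2 zeta z.
have iA : rint mu2 D A by apply: rintZ => //; exact: rint_sqM s1 sz.1.
have iA' : rint mu2 D A' by apply: rintZ => //; exact: rint_sqM s2 sZ.
have iB : rint mu2 D B by exact: rint_sqM s2 sz.2.
have AA' : \int[mu2]_(z in D) A z = - \int[mu2]_(z in D) A' z.
  rewrite (fubini2 iA).2 (fubini2 iA').2 -RintN; last 2 first.
  - exact: measurable_posR.
  - exact: (fubini2 iA').1.
  apply: eq_Rint => y _; rewrite /A /A'/=.
  have [i1 i2 hp] := section_by_parts y hg tz.
  rewrite (_ : \int[mu]_x (m * (g x * expR (- (m * y)) * 'D_e1 zeta (x, y))) =
     (m * expR (- (m * y))) * \int[mu]_x (g x * 'D_e1 zeta (x, y))); last first.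
    by rewrite -RintZ//; apply: eq_Rint => x _; ring.
  rewrite (_ : \int[mu]_x (m * (g' x * expR (- (m * y)) * zeta (x, y))) =
     (m * expR (- (m * y))) * \int[mu]_x (g' x * zeta (x, y))); last first.
    by rewrite -RintZ//; apply: eq_Rint => x _; ring.
  by rewrite hp mulrN.
have -> : ip (exp_field m g g') (gradient zeta) = \int[mu2]_(z in D) (A' z - B z).
  rewrite RintB// -[X in X - _]opprK -AA'.
  rewrite (_ : ip _ _ = \int[mu2]_(z in D) (- A z - B z)); last first.
    by apply: eq_Rint => z _; rewrite /dotp /exp_field /A /B /gradient/=; ring.
  by rewrite RintB ?RintN//; exact: rintN.
have iAB : rint mu2 D (fun z => A' z - B z) by exact: rintB.
rewrite (fubini1 iAB).2; apply: eq_Rint => x _; rewrite /A' /B/=.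
pose L := `|K| + 1; have KL : K < L by rewrite (le_lt_trans (ler_norm _))// ltrDl.
have L0 : 0 <= L by rewrite addr_ge0.
pose F y := - (expR (- (m * y)) * zeta (x, y)).
have dF (y : R) : is_derive y 1 F (m * expR (- (m * y)) * zeta (x, y) - expR (- (m * y)) * 'D_e2 zeta (x, y)).
  have h := is_der_scale (-1) (is_der_mul (exp_is_derive m y) (partial2 (d2 (x, y)))).
  have := h; rewrite (_ : (fun y => _) = F); last by apply/funext => t; rewrite mulN1r.
  by congr (is_derive _ _ _ _); ring.
have hF : prim F (fun y => m * expR (- (m * y)) * zeta (x, y) - expR (- (m * y)) * 'D_e2 zeta (x, y)).
  apply: prim_C1 => // y.
  have hE := @exp_continuous _ m y.
  have h1 : m * expR (- (m * t)) @[t --> y] --> m * expR (- (m * y)) by exact: cvgMl_tmp.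
  exact: (cvgB (cvgM h1 (@section_continuous2 _ _ x cz y)) (cvgM hE (@section_continuous2 _ _ x c2 y))).
have z0 (y : R) : K < y -> zeta (x, y) = 0 /\ 'D_e2 zeta (x, y) = 0.
  move=> Ky; have /hK[h1 h2] : K < `|(x, y)|.
    by rewrite prod_normE/= lt_max (lt_le_trans Ky (ler_norm y)) orbT.
  by split => //; exact: h2.
have h0 y : L < y -> m * expR (- (m * y)) * zeta (x, y) - expR (- (m * y)) * 'D_e2 zeta (x, y) = 0.
  by move=> Ly; have [-> ->] := z0 y (lt_trans KL Ly); rewrite !mulr0 subrr.
have [iF hI] := Rint_pos_prim hF L0 h0.
transitivity (g' x * \int[mu]_(y in posR)
   (m * expR (- (m * y)) * zeta (x, y) - expR (- (m * y)) * 'D_e2 zeta (x, y))).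
  rewrite -(RintZ (@measurable_posR R) _ iF).
  by apply: eq_Rint => y _; ring.
rewrite hI /F; have [-> _] := z0 L KL.
by rewrite !mulr0 oppr0 sub0r opprK expR0 mul1r.
Qed.

End ExponentialField.

Section StrayEnergy.
Context {R : realType}.
Notation mu := (@lebesgue_measure R).
Notation plane := (measurableTypeR R * measurableTypeR R)%type.
Notation mu2 := (@lebesgue_measure R \x @lebesgue_measure R)%E.
Notation D := (@hplane R).
Notation ip := (ip mu2 D).
Notation sq2 := (sq2 mu2 D).
Implicit Types (zeta : R * R -> R) (f g F : R -> R) (G H K : plane -> R * R).

(** Any field with the flux g prime can be projected; exp_field provides one. *)
Lemma stray_exists g g' : prim g g' -> sqint mu setT g -> sqint mu setT g' ->
  exists G, grad_closure G /\ neumann g' G.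
Proof.
move=> hg sg sg'.
have sK := exp_field_sq2 ltr01 sg sg'.
have nK := exp_field_neumann ltr01 hg sg sg'.
have [G [sG hA hG]] := stray_projection sK.
by exists G; split => // zeta tz; rewrite -hG// nK.
Qed.

(** The elements of the completion and grad_closure differ only in the way in
    which convergence in norm is expressed. *)
Lemma dotH1_closure G : dotH1_gradient (G : R * R -> R * R) <-> grad_closure G.
Proof.
have mD := @measurable_half_plane R; split.
  move=> [m1 m2 [phi [tphi lim]]].
  have sphi n := gradient_sq2 (tphi n).
  have mB1 n : measurable_fun D (fun z : plane => (gradient (phi n) z - G z).1).
    by apply: measurable_funB; [case: (sphi n) => -[]|exact: m1].
  have mB2 n : measurable_fun D (fun z : plane => (gradient (phi n) z - G z).2).
    by apply: measurable_funB; [case: (sphi n) => _ []|exact: m2].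
  have mS n : measurable_fun D (fun z : plane => sqnorm (gradient (phi n) z - G z)).
    by apply: measurable_funD; apply: measurable_funM.
  have S0 z : 0 <= @sqnorm R z by rewrite /sqnorm /dotp -!expr2 addr_ge0// sqr_ge0.
  have hN e : 0 < e -> exists N : nat, forall n, (N <= n)%N ->
      (\int[mu2]_(z in D) (sqnorm (gradient (phi n) z - G z)%R)%:E <= e%:E)%E.
    move=> e0; move/fine_cvgP : lim => [[N1 _ hN1] /cvgrPdist_le/(_ _ e0)[N2 _ hN2]].
    exists (maxn N1 N2) => n; rewrite geq_max => /andP[n1 n2].
    have := hN1 n n1; have := hN2 n n2; rewrite /= sub0r normrN => h hfin.
    rewrite -(fineK hfin) lee_fin; apply: le_trans h; exact: ler_norm.
  have sB e n : (\int[mu2]_(z in D) (sqnorm (gradient (phi n) z - G z)%R)%:E <= e%:E)%E ->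
      sq2 (fun z => gradient (phi n) z - G z).
    move=> h; have iS : rint mu2 D (fun z : plane => sqnorm (gradient (phi n) z - G z)).
      apply/integrableP; split; first exact/measurable_EFinP.
      apply: le_lt_trans (ltry e); apply: le_trans h.
      rewrite le_eqVlt; apply/orP; left; apply/eqP; apply: eq_integral => z _ /=.
      by rewrite ger0_norm.
    split; split => //; apply: (le_rint mD _ _ iS) => //.
    - exact: measurable_funX.
    - by move=> z _; rewrite ger0_norm ?sqr_ge0// /sqnorm /dotp -!expr2 lerDl sqr_ge0.
    - exact: measurable_funX.
    - by move=> z _; rewrite ger0_norm ?sqr_ge0// /sqnorm /dotp -!expr2 lerDr sqr_ge0.
  have sG : sq2 G.
    have [N /(_ N (leqnn _)) /sB sN] := hN 1 ltr01.
    have := sq2B mD (sphi N) sN; congr (sq2 _); apply/funext => z.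
    by rewrite opprB addrC subrK.
  split => //; exists (fun n => gradient (phi n)); split; first by move=> n; exists (phi n).
  move=> e /hN[N {}hN]; exists N => n Nn.
  rewrite -lee_fin -(EFin_Rint mD); first exact: hN.
  by apply: rint_dot => //; exact: sq2B.
move=> [sG [A [tA lA]]]; split; [by case: sG => -[]|by case: sG => _ []|].
pose phi n := projT1 (cid (tA n)).
have hphi n : test_function (phi n) /\ A n = gradient (phi n) := projT2 (cid (tA n)).
exists phi; split; first by move=> n; case: (hphi n).
have E n : (\int[mu2]_(z in D) (sqnorm (gradient (phi n) z - G z)%R)%:E)%E =
   (ip (fun z => A n z - G z) (fun z => A n z - G z))%:E.
  have [tp ->] := hphi n; rewrite (EFin_Rint mD)//.
  by apply: rint_dot => //; apply: sq2B => //; exact: gradient_sq2.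
apply/fine_cvgP; split; first by apply: nearW => n; rewrite [X in X \is a _](E n).
apply/cvgrPdist_le => e /lA[N hN]; exists N => // n /= Nn.
by rewrite [X in fine X](E n) /= sub0r normrN ger0_norm ?hN// ip_ge0.
Qed.

(** The unspecified choice in stray_gradient is harmless: by thomson, applied in
    both directions, two solutions have the same energy. *)
Lemma stray_energyE F m G : measurable_fun setT F ->
  measurable_fun setT (fun x => (mderiv m x).1) ->
  {ae mu, forall x, (mderiv m x).1 = F x} ->
  grad_closure G -> neumann F G ->
  (\int[mu2]_(z in half_plane) (sqnorm (stray_gradient m z))%:E = (ip G G)%:E)%E.
Proof.
move=> mF mm ae cG nG.
have tr zeta : test_function zeta -> \int[mu]_x ((mderiv m x).1 * zeta (x, 0)) =
    \int[mu]_x (F x * zeta (x, 0)).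
  move=> tz; have mz : measurable_fun setT (fun x : R => zeta (x, 0)).
    apply: continuous_measurable_fun; apply: section_continuous1.
    by case: (smooth_partials tz.1).
  by apply: Rint_ae_eq => //; [exact: measurable_funM..|apply: aeS ae => x ->].
have hG : is_stray_gradient m G.
  by split; [exact/dotH1_closure|move=> zeta tz; rewrite tr//; exact: nG].
have : is_stray_gradient m (stray_gradient m).
  exact: (@getPex _ [set G | is_stray_gradient m G] (ex_intro _ (G : R * R -> R * R) hG)).
move=> [/dotH1_closure cH nH0].
have nH : neumann F (stray_gradient m) by move=> zeta tz; rewrite -tr//; exact: nH0.
have e : ip (stray_gradient m) (stray_gradient m) = ip G G.
  by apply/eqP; rewrite eq_le (thomson cH nH cG.1 nG) (thomson cG nG cH.1 nH).
rewrite -e -(EFin_Rint (@measurable_half_plane R))//.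
by apply: rint_dot; [exact: measurable_half_plane|exact: cH.1..].
Qed.

End StrayEnergy.

(** * Transport of the stray field by a diffeomorphism *)

Section Transport.
Context {R : realType}.
Notation mu := (@lebesgue_measure R).
Notation plane := (measurableTypeR R * measurableTypeR R)%type.
Notation mu2 := (@lebesgue_measure R \x @lebesgue_measure R)%E.
Notation D := (@hplane R).
Notation e1 := ((1, 0) : R * R).
Notation e2 := ((0, 1) : R * R).
Notation posR := (`]0, +oo[%classic : set R).
Notation ip := (ip mu2 D).
Notation sq2 := (sq2 mu2 D).
Implicit Types (zeta : R * R -> R) (f g F : R -> R) (G H K : plane -> R * R).
Local Hint Resolve mitv : core.

Section SignedChangeOfVariables.
Variables (Psi Phi psi : R -> R).
Hypothesis dPsi : forall x : R, is_derive x 1 Psi (psi x).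
Hypothesis cpsi : continuous psi.
Hypothesis psi_ge0 : forall x, 0 <= psi x.
Hypothesis PhiK : cancel Phi Psi.
Hypothesis mono : {mono Psi : x y / x <= y}.

Let cPsi : continuous Psi := is_derive_continuous dPsi.

(** A signed function is the difference of |h| + h and |h|. *)
Lemma change_of_variables h : rint mu setT h ->
  rint mu setT (fun x => h (Psi x) * psi x) /\
  \int[mu]_x (h (Psi x) * psi x) = \int[mu]_x h x.
Proof.
move=> ih; have mh := rint_measurable ih.
have mc (k : R -> R) : measurable_fun setT k -> measurable_fun setT (fun x => k (Psi x) * psi x).
  move=> mk; apply: measurable_funM; last exact: continuous_measurable_fun.
  exact: (measurableT_comp mk (continuous_measurable_fun cPsi)).
have pos (k : R -> R) : rint mu setT k -> (forall x, 0 <= k x) ->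
    rint mu setT (fun x => k (Psi x) * psi x) /\
    \int[mu]_x (k (Psi x) * psi x) = \int[mu]_x k x.
  move=> ik k0; have mk := rint_measurable ik; have e := ge0_change_of_variables dPsi cpsi psi_ge0 PhiK mono mk k0.
  split; last by rewrite /Rintegral e.
  apply/integrableP; split; first by apply/measurable_EFinP; exact: mc.
  rewrite (_ : (\int[mu]_x _ = \int[mu]_x (k (Psi x) * psi x)%:E)%E).
    by rewrite e; exact: integrable_lty.
  by apply: eq_integral => x _ /=; rewrite ger0_norm// mulr_ge0.
have ia := rint_norm ih.
have iu : rint mu setT (fun x => `|h x| + h x) by exact: rintD.
have [i1 e1'] := pos _ ia (fun x => normr_ge0 _).
have u0 x : 0 <= `|h x| + h x by have := ler_norm (- h x); rewrite normrN; lra.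
have [i2 e2'] := pos _ iu u0.
have E x : h (Psi x) * psi x = (`|h (Psi x)| + h (Psi x)) * psi x - `|h (Psi x)| * psi x by ring.
rewrite (funext E); split; first exact: rintB.
rewrite RintB// e1' e2' -RintB//; apply: eq_Rint => x _; ring.
Qed.

End SignedChangeOfVariables.

Variables (Psi Phi psi : R -> R).
Hypothesis dPsi : forall x : R, is_derive x 1 Psi (psi x).
Hypothesis spsi : smooth psi.
Hypothesis psi_gt0 : forall x, 0 < psi x.
Hypothesis PsiK : cancel Psi Phi.
Hypothesis PhiK : cancel Phi Psi.

Let cpsi : continuous psi := smooth_continuous spsi.
Let psi_ge0 x : 0 <= psi x := ltW (psi_gt0 x).
Let psi_neq0 x : psi x != 0. Proof. by rewrite gt_eqF. Qed.
Let cPsi : continuous Psi := is_derive_continuous dPsi.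

Let mono : {mono Psi : x y / x <= y}.
Proof.
apply: le_mono => x y xy; have hp := prim_C1 dPsi cpsi.
rewrite lt_neqAle (inj_eq (can_inj PsiK)) lt_eqF//=.
rewrite -subr_ge0 (hp.2 _ _ (ltW xy)); apply: Rintegral_ge0 => t _; exact: psi_ge0.
Qed.

Let CV := ge0_change_of_variables dPsi cpsi psi_ge0 PhiK mono.

Lemma inverse_is_derive (y : R) : is_derive y 1 Phi (psi (Phi y))^-1.
Proof.
rewrite -[X in is_derive X](PhiK y); apply: is_derive_inverse => //.
- have h : \forall x \near Phi y, Phi (Psi x) = x by exists 1 => [|x _]; [exact: ltr01|exact: PsiK].
  exact: h.
- have h : \forall x \near Phi y, {for x, continuous Psi} by exists 1 => [|x _]; [exact: ltr01|exact: cPsi].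
  exact: h.
Qed.

Let cPhi : continuous Phi := is_derive_continuous inverse_is_derive.

Lemma inverse_change_of_variables h : rint mu setT h ->
  rint mu setT (fun y => h (Phi y) / psi (Phi y)) /\
  \int[mu]_y (h (Phi y) / psi (Phi y)) = \int[mu]_x h x.
Proof.
apply: (@change_of_variables Phi Psi (fun y => (psi (Phi y))^-1)) => //.
- exact: inverse_is_derive.
- move=> y; apply: (@cvgV _ _ _ _ (fun y => psi (Phi y))) => //.
  by apply: continuous_comp; [exact: cPhi|exact: cpsi].
- by move=> y; rewrite invr_ge0.
- by move=> x y; rewrite -[in RHS](PhiK x) -[in RHS](PhiK y) mono.
Qed.

(** The chain rule for the composition with a diffeomorphism. The function f is
    defined up to null sets only, so the change of variables replaces a
    pointwise computation. *)
Lemma prim_diffeo F f : prim F f ->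
  prim (fun y => F (Phi y)) (fun y => f (Phi y) / psi (Phi y)).
Proof.
move=> [lf hF].
have key a b : let h x := f x * \1_(`[Phi a, Phi b]) x in
    rint mu setT h /\ (fun y => h (Phi y) / psi (Phi y)) =
    (fun y => f (Phi y) / psi (Phi y)) \_ `[a, b].
  split.
    rewrite (_ : (fun x => _) = f \_ `[Phi a, Phi b]); last first.
      by apply/funext => x; rewrite patchE indicE; case: (_ \in _); rewrite ?mulr1 ?mulr0.
    have := (integrable_mkcond _ (mitv _ _)).1 (lf (Phi a) (Phi b)).
    by rewrite /rint -restrict_EFin.
  apply/funext => y; rewrite patchE indicE.
  have -> : (Phi y \in `[Phi a, Phi b]%classic) = (y \in `[a, b]%classic).
    have e1' : (Phi a <= Phi y) = (a <= y) by rewrite -[LHS]mono !PhiK.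
    have e2' : (Phi y <= Phi b) = (y <= b) by rewrite -[LHS]mono !PhiK.
    by apply/idP/idP; rewrite !inE/= !in_itv/= e1' e2'.
  by case: (_ \in _); rewrite ?mulr1 ?mulr0 ?mul0r.
split.
  move=> a b; have [ih E] := key a b.
  have [i _] := inverse_change_of_variables ih; rewrite E in i.
  apply: (integrable_mkcond _ (mitv _ _)).2; move: i.
  by rewrite /rint -restrict_EFin.
move=> a b ab; have [ih E] := key a b.
have [_ e] := inverse_change_of_variables ih; rewrite E in e.
have ab' : Phi a <= Phi b by rewrite -mono !PhiK.
rewrite hF// Rintegral_mkcond [RHS]Rintegral_mkcond e.
by apply: eq_Rint => x _; rewrite patchE indicE; case: (_ \in _); rewrite ?mulr1 ?mulr0.
Qed.

Variable lam : R.
Hypothesis lam0 : 0 < lam.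

Notation T := (subst_map Psi lam).

Let cT : continuous T.
Proof.
move=> z; have h1 : Psi w.1 @[w --> z] --> Psi z.1.
  by apply: continuous_comp; [exact: cvg_fst|exact: cPsi].
have h2 : lam * w.2 @[w --> z] --> lam * z.2 by apply: cvgMl_tmp; exact: cvg_snd.
exact: cvg_pair h1 h2.
Qed.

Lemma test_function_subst zeta : test_function zeta -> test_function (fun z => zeta (T z)).
Proof.
move=> tz; split; first exact: (smooth_subst _ dPsi spsi tz.1).
have [K hK] := test_function_bound tz.
apply: (@subclosed_compact _ _ [set z : R * R | z.1 \in `[Phi (- K), Phi K] /\
    z.2 \in `[- (K / lam), K / lam]]).
- exact: closed_closure.
- exact: box_compact.
- have cl : closed [set z : R * R | z.1 \in `[Phi (- K), Phi K] /\
    z.2 \in `[- (K / lam), K / lam]].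
    by apply: compact_closed; [exact: norm_hausdorff|exact: box_compact].
  rewrite ((closure_id _).1 cl); apply: closure_subset => -[x y] /= z0.
  have : `|T (x, y)| <= K.
    by rewrite leNgt; apply: contra z0 => /hK[->].
  rewrite prod_norm_le !ler_norml => /andP[hx hy]; split.
    by rewrite in_itv/= -[X in X && _]mono -[X in _ && X]mono !PhiK.
  by rewrite in_itv/= -mulNr ler_pdivrMr// ler_pdivlMr// (mulrC y).
Qed.

(** By Tonelli, horizontal and vertical change of variables separately. *)
Lemma plane_change_of_variables (h : R * R -> R) : continuous h -> (forall z, 0 <= h z) ->
  (\int[mu2]_(z in D) (h (T z) * (psi z.1 * lam))%:E = \int[mu2]_(z in D) (h z)%:E)%E.
Proof.
move=> ch h0.
pose h' z : R := h (z.1, lam * z.2) * lam.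
have ch' : continuous h'.
  move=> z; have h1 : (w.1, lam * w.2) @[w --> z] --> (z.1, lam * z.2).
    have h2 : lam * w.2 @[w --> z] --> lam * z.2 by apply: cvgMl_tmp; exact: cvg_snd.
    exact: (cvg_pair (@cvg_fst _ _ _ _ _) h2).
  by apply: cvgMr_tmp; exact: (cvg_comp _ _ h1 (ch _)).
have h'0 z : 0 <= h' z by rewrite mulr_ge0// ltW.
have mP (k : plane -> R) : continuous (k : R * R -> R) -> measurable_fun D k.
  by move=> ck; apply: measurable_funTS; exact: continuous_measurable_plane.
transitivity (\int[mu2]_(z in D) (h' (Psi z.1, z.2) * psi z.1)%:E)%E.
  by apply: eq_integral => z _; rewrite /h' /subst_map/= (mulrC (psi _)) mulrA.
have ck : continuous (fun z : R * R => h' (Psi z.1, z.2) * psi z.1).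
  move=> z; have h1 : Psi w.1 @[w --> z] --> Psi z.1.
    by apply: continuous_comp; [exact: cvg_fst|exact: cPsi].
  have h2 : (Psi w.1, w.2) @[w --> z] --> (Psi z.1, z.2) by exact: (cvg_pair h1 (@cvg_snd _ _ _ _ _)).
  apply: cvgM; first exact: (cvg_comp _ _ h2 (ch' _)).
  by apply: continuous_comp; [exact: cvg_fst|exact: cpsi].
transitivity (\int[mu2]_(z in D) (h' z)%:E)%E.
  rewrite (tonelli2 (F := fun z => h' (Psi z.1, z.2) * psi z.1)); last 2 first.
  - exact: mP.
  - by move=> z _; rewrite mulr_ge0.
  rewrite (tonelli2 (F := h')); [|exact: mP|by move=> z _].
  apply: eq_integral => y _ /=; apply: (CV (h := fun x => h' (x, y))) => //.
  by apply: continuous_measurable_fun; exact: section_continuous1.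
rewrite (tonelli1 (F := h')); [|exact: mP|by move=> z _].
rewrite (tonelli1 (F := h)); [|exact: mP|by move=> z _].
apply: eq_integral => x _ /=.
rewrite integral_mkcond [RHS]integral_mkcond.
pose k y : R := h (x, y) * \1_posR y.
have mk : measurable_fun setT k.
  apply: measurable_funM; last by apply: measurable_indic; exact: measurable_posR.
  by apply: continuous_measurable_fun; exact: section_continuous2.
have k0 y : 0 <= k y by rewrite mulr_ge0.
have lamK : cancel (fun y : R => lam * y) (fun y => lam^-1 * y).
  by move=> y; rewrite mulKf// gt_eqF.
have lamKV : cancel (fun y : R => lam^-1 * y) (fun y => lam * y).
  by move=> y; rewrite mulVKf// gt_eqF.
have dl (y : R) : is_derive y 1 (fun y => lam * y) (cst lam y).
  by have := is_der_affine lam 0 y; congr (is_derive _ _ _ _); apply/funext => t; rewrite addr0.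
have ml : {mono (fun y : R => lam * y) : x y / x <= y} by move=> a b; rewrite ler_pM2l.
have := ge0_change_of_variables dl (@cst_continuous _ _ lam) (fun=> ltW lam0) lamKV ml mk k0.
rewrite (_ : (\int[mu]_y (k (lam * y) * cst lam y)%:E = \int[mu]_y ((fun y => (h' (x, y))%:E) \_ posR) y)%E).
  move=> ->; apply: eq_integral => y _; rewrite patchE /k indicE.
  by case: (_ \in _); rewrite ?mulr1 ?mulr0.
apply: eq_integral => y _; rewrite patchE /k indicE.
rewrite (_ : (lam * y \in posR) = (y \in posR)).
  by case: (_ \in _); rewrite ?mulr1 ?mulr0 ?mul0r.
by apply/idP/idP; rewrite !inE /= !in_itv/= !andbT pmulr_rgt0.
Qed.

Hypothesis psi_le2 : forall x, psi x <= 2.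
Hypothesis psi_geV2 : forall x, 2^-1 <= psi x.

Let Q (G : plane -> R * R) (z : plane) : R :=
  psi z.1 / lam * (G z).1 ^+ 2 + lam / psi z.1 * (G z).2 ^+ 2.

Let psiV_le2 x : (psi x)^-1 <= 2.
Proof. by rewrite invf_ple ?posrE. Qed.

Let cpsiV : continuous (fun x => (psi x)^-1).
Proof. by move=> x; apply: (@cvgV _ _ _ _ psi) => //; exact: cpsi. Qed.

Lemma transport_rint G : sq2 G -> rint mu2 D (Q G).
Proof.
move=> [[_ i1] [_ i2]]; have mD := @measurable_half_plane R; apply: rintD => //.
  apply: (rintMb mD (C := 2 / lam)) => //.
    apply: measurable_funTS; apply: (@measurable_fst_comp _ (fun x => psi x / lam)).
    by apply: measurable_funM => //; exact: continuous_measurable_fun.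
  move=> z _; rewrite ger0_norm; last by rewrite mulr_ge0 ?invr_ge0 ?ltW.
  by rewrite ler_wpM2r// invr_ge0 ltW.
apply: (rintMb mD (C := lam * 2)) => //.
  apply: measurable_funTS; apply: (@measurable_fst_comp _ (fun x => lam / psi x)).
  by apply: measurable_funM => //; exact: continuous_measurable_fun.
move=> z _; rewrite ger0_norm; last by rewrite mulr_ge0 ?invr_ge0 ?ltW.
by rewrite ler_wpM2l// ltW.
Qed.

Lemma transport_neumann F f zeta : prim F f -> test_function zeta ->
  \int[mu]_y (f (Phi y) / psi (Phi y) * zeta (y, 0)) =
  \int[mu]_x (f x * zeta (T (x, 0))).
Proof.
move=> hf tz; have txi := test_function_subst tz.
have [i _ _] := section_by_parts 0 hf txi.
rewrite -(inverse_change_of_variables i).2; apply: eq_Rint => y _.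
by rewrite /subst_map/= PhiK mulr0 mulrAC.
Qed.

(** A test function for the transported profile is composed with the plane map,
    which gives a test function for the original one; Young with the weights psi
    / lam and lam / psi, the ratios of the two stretching factors, leaves the
    Dirichlet integral of zeta exactly. *)
Lemma transport_test F f G zeta : prim F f -> sq2 G -> neumann f G -> test_function zeta ->
  2 * \int[mu]_y (f (Phi y) / psi (Phi y) * zeta (y, 0)) -
    ip (gradient zeta) (gradient zeta) <= \int[mu2]_(z in D) Q G z.
Proof.
move=> hf sG nG tz; have txi := test_function_subst tz.
have mD := @measurable_half_plane R.
rewrite (transport_neumann hf tz) -(nG _ txi).
have [cz d1 d2 c1 c2] := smooth_partials tz.1.
pose h (z : R * R) : R := 'D_e1 zeta z ^+ 2 + 'D_e2 zeta z ^+ 2.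
have h0 z : 0 <= h z by rewrite addr_ge0// sqr_ge0.
have ch : continuous h.
  move=> z; rewrite /h.
  exact: (cvgD (cvgM (c1 z) (c1 z)) (cvgM (c2 z) (c2 z))).
have ih : rint mu2 D (h : plane -> R).
  have := rint_dot mD (gradient_sq2 tz) (gradient_sq2 tz).
  by congr rint; apply/funext => z; rewrite /h /dotp /gradient/= !expr2.
have e := plane_change_of_variables ch h0.
pose k (z : plane) : R := h (T z) * (psi z.1 * lam).
have mk : measurable_fun D k.
  apply: measurable_funTS; apply: measurable_funM.
    have chT : continuous (fun w : R * R => h (T w)).
      by move=> w; apply: continuous_comp; [exact: cT|exact: ch].
    exact: continuous_measurable_plane chT.
  apply: (@measurable_fst_comp _ (fun x => psi x * lam)).
  by apply: measurable_funM => //; exact: continuous_measurable_fun.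
have ik : rint mu2 D k.
  apply/integrableP; split; first exact/measurable_EFinP.
  rewrite (_ : (\int[mu2]_(z in D) _ = \int[mu2]_(z in D) (h (T z) * (psi z.1 * lam))%:E)%E).
    by rewrite e (EFin_Rint mD ih) ltry.
  by apply: eq_integral => z _ /=; rewrite ger0_norm// /k mulr_ge0// mulr_ge0// ltW.
have -> : ip (gradient zeta) (gradient zeta) = \int[mu2]_(z in D) k z.
  rewrite /Rintegral -[in RHS]/(\int[mu2]_(z in D) (h (T z) * (psi z.1 * lam))%:E)%E e.
  by congr fine; apply: eq_integral => z _; rewrite /h /dotp /gradient/= !expr2.
have sxi := gradient_sq2 txi.
rewrite /ip -(RintZ mD _ (rint_dot mD sG sxi)) -(RintB mD); last 2 first.
- exact: (rintZ mD 2 (rint_dot mD sG sxi)).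
- exact: ik.
apply: (le_Rint mD).
- apply: (rintB mD) => //; exact: (rintZ mD 2 (rint_dot mD sG sxi)).
- exact: transport_rint.
move=> [x y] _; rewrite /k /h /Q /dotp /gradient/=.
have [_ ->] := subst_is_derive lam dPsi x y e1 tz.1.
have [_ ->] := subst_is_derive lam dPsi x y e2 tz.1.
rewrite /subst_map/= !mulr1 !mulr0 addr0 add0r.
set a := 'D_e1 zeta _; set b := 'D_e2 zeta _.
set u := (G (x, y)).1; set v := (G (x, y)).2.
rewrite -subr_ge0 (_ : _ - _ = psi x / lam * (u - lam * a) ^+ 2 +
  lam / psi x * (v - psi x * b) ^+ 2).
  by rewrite addr_ge0// mulr_ge0 ?sqr_ge0// mulr_ge0 ?invr_ge0 ?ltW.
by field; rewrite gt_eqF//= gt_eqF.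
Qed.

(** The stray energy is the largest value of 2 \int F zeta - |grad zeta|^2, and
    each of these values is bounded by transport_test. The weights express that
    a conformal map (psi = lam) preserves the energy. *)
Lemma transport_bound F f G G1 : prim F f -> grad_closure G -> neumann f G ->
  grad_closure G1 -> neumann (fun y => f (Phi y) / psi (Phi y)) G1 ->
  ip G1 G1 <= \int[mu2]_(z in D) Q G z.
Proof.
move=> hf cG nG [sG1 [A [tA lA]]] nG1; have mD := @measurable_half_plane R.
have sA n := test_gradients_sq2 (tA n).
have l1 := L2lim_ip mD sA sG1 sG1 lA.
have l2 := L2lim_sq mD sA sG1 lA.
have l : (fun n => 2 * ip (A n) G1 - ip (A n) (A n)) @ \oo --> 2 * ip G1 G1 - ip G1 G1.
  by apply: cvgB => //; exact: cvgMl_tmp.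
have -> : ip G1 G1 = 2 * ip G1 G1 - ip G1 G1 by ring.
rewrite -(cvg_lim (@Rhausdorff R) l); apply: limr_le; first by apply/cvg_ex; eexists; exact: l.
apply: nearW => n; have [z [tz ->]] := tA n.
by rewrite ipC nG1//; exact: (transport_test hf cG.1 nG tz).
Qed.

End Transport.

(** * Lifting of a map of finite energy *)

Section Lifting.
Context {R : realType}.
Notation mu := (@lebesgue_measure R).
Implicit Types (F f g phi psi p r : R -> R) (m : R -> R * R).
Local Hint Resolve mitv : core.

(** The difference is continuous, and it is a derivative of the constant 0. *)
Lemma ae_eq_continuous f g : continuous f -> continuous g ->
  {ae mu, forall x, f x = g x} -> f =1 g.
Proof.
move=> cf cg fg x; pose J x := f x - g x.
have cJ : continuous J by move=> y; apply: cvgB; [exact: cf|exact: cg].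
have hJ : prim (cst 0 : R -> R) J.
  apply: (prim_ae_eq _ _ (prim_cst 0)); first exact: continuous_measurable_fun.
  by apply: aeS fg => y; rewrite /J => ->; rewrite subrr.
have [_ /esym] := prim_is_derive cJ hJ x.
by rewrite derive_cst => /eqP; rewrite subr_eq0 => /eqP.
Qed.

(** By the intermediate value theorem, as the cosine is less than 1 on ]0, 1]. *)
Lemma cos_eq1_continuous (d : R -> R) : continuous d -> d 0 = 0 ->
  (forall x, cos (d x) = 1) -> forall x, d x = 0.
Proof.
move=> cd d0 hd x; have [//|dx] := eqVneq (d x) 0; exfalso.
have dx0 : 0 < `|d x| by rewrite normr_gt0.
have cn : continuous (fun y => `|d y|).
  by move=> y; apply: continuous_comp; [exact: cd|exact: norm_continuous].
(* a value that d takes in absolute value, in ]0, 1] where the cosine is not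
   1 *)
pose v := Num.min `|d x| 1.
have v0 : 0 < v by rewrite lt_min dx0 ltr01.
have v1 : v <= 1 by rewrite ge_min lexx orbT.
have vx : v <= `|d x| by rewrite ge_min lexx.
have [c hc] : exists c, `|d c| = v.
  have [x0|/ltW x0] := leP 0 x.
    have [||c _ hc] := @IVT R (fun y => `|d y|) 0 x v x0; last by exists c.
      exact: continuous_subspaceT.
    by rewrite d0 normr0 ge_min le_max (ltW v0) vx orbT.
  have [||c _ hc] := @IVT R (fun y => `|d y|) x 0 v x0; last by exists c.
    exact: continuous_subspaceT.
  by rewrite d0 normr0 ge_min le_max (ltW v0) vx orbT.
have cv : cos v = 1.
  rewrite -hc; have [_|_] := ger0P (d c); first exact: hd.
  by rewrite cosN.
have : cos (v / 2 + v / 2) = 1 by rewrite -splitr.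
rewrite cosD -!expr2 cos2sin2 => h.
have s0 : 0 < sin (v / 2).
  apply: sin_gt0_pi; rewrite ?divr_gt0//=.
  by have := @pi_ge2 R; lra.
by have := exprn_gt0 2 s0; lra.
Qed.

Lemma L2_sqint f : L2 f -> sqint mu setT f.
Proof.
move=> h; split; last exact: Lfun2_integrable_sqr.
by move: h; rewrite /L2 inE => /andP[]; rewrite inE.
Qed.

Lemma sqint_ae f g : measurable_fun setT g -> {ae mu, forall x, f x = g x} ->
  sqint mu setT f -> sqint mu setT g.
Proof.
move=> mg fg [mf i]; split => //; apply: rint_ae_eq i => //.
- exact: measurable_funX.
- exact: measurable_funX.
- by apply: aeS fg => x ->.
Qed.

Lemma continuous_cos_comp phi : continuous phi -> continuous (fun x => cos (phi x)).
Proof. by move=> c x; apply: continuous_comp; [exact: c|exact: continuous_cos]. Qed.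

Lemma continuous_sin_comp phi : continuous phi -> continuous (fun x => sin (phi x)).
Proof. by move=> c x; apply: continuous_comp; [exact: c|exact: continuous_sin]. Qed.

Lemma cos_norm_le1 (x : R) : `|cos x| <= 1.
Proof. by rewrite ler_norml cos_geN1 cos_le1. Qed.

Lemma sin_norm_le1 (x : R) : `|sin x| <= 1.
Proof. by rewrite ler_norml sin_geN1 sin_le1. Qed.

(** The primitive th of the expected derivative with the same value at 0
    satisfies cos (th - phi) = 1, because this cosine has the derivative 0; so
    th = phi by continuity. *)
Lemma lifting_prim phi c' s' : continuous phi ->
  prim (fun x => cos (phi x)) c' -> prim (fun x => sin (phi x)) s' ->
  let p x := cos (phi x) * s' x - sin (phi x) * c' x in
  prim phi p.
Proof.
move=> cphi hc hs p.
have lp : linc p.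
  apply: lincB; apply: linc_contM.
  - exact: continuous_cos_comp.
  - exact: hs.1.
  - exact: continuous_sin_comp.
  - exact: hc.1.
have [th0 [hth0 th00]] := prim_exists lp.
pose th x := th0 x + phi 0.
have hth : prim th p.
  have := primD hth0 (prim_cst (phi 0)).
  by congr prim; apply/funext => x; rewrite addr0.
have cth := prim_continuous hth.
(* cos^2 + sin^2 = 1, differentiated *)
have orth : {ae mu, forall x, cos (phi x) * c' x + sin (phi x) * s' x = 0}.
  have h1 := primD (primM hc hc) (primM hs hs).
  have h2 : prim (fun x => cos (phi x) * cos (phi x) + sin (phi x) * sin (phi x)) (cst 0).
    have := prim_cst (1 : R); congr prim; apply/funext => x.
    by rewrite -!expr2 cos2Dsin2.
  by apply: aeS (prim_unique h1 h2) => x /= h; lra.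
have hu := primD (primM (prim_cos hth) hc) (primM (prim_sin hth) hs).
have hu0 : prim (fun x => cos (th x) * cos (phi x) + sin (th x) * sin (phi x)) (cst 0).
  apply: (prim_ae_eq _ _ hu) => //; apply: aeS orth => x /= o.
  have e := cos2Dsin2 (phi x).
  have -> : c' x = - sin (phi x) * p x.
    have : c' x * (cos (phi x) ^+ 2 + sin (phi x) ^+ 2) = - sin (phi x) * p x + cos (phi x) *
       (cos (phi x) * c' x + sin (phi x) * s' x) by rewrite /p; ring.
    by rewrite o e; lra.
  have -> : s' x = cos (phi x) * p x.
    have : s' x * (cos (phi x) ^+ 2 + sin (phi x) ^+ 2) = cos (phi x) * p x + sin (phi x) *
       (cos (phi x) * c' x + sin (phi x) * s' x) by rewrite /p; ring.
    by rewrite o e; lra.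
  ring.
have u1 x : cos (th x - phi x) = 1.
  rewrite cosB; have th0E : th 0 = phi 0 by rewrite /th th00 add0r.
  have u0 : cos (th 0) * cos (phi 0) + sin (th 0) * sin (phi 0) = 1.
    by rewrite th0E -!expr2 cos2Dsin2.
  have I0 a b : \int[mu]_(x in `[a, b]) (cst 0 : R -> R) x = 0.
    by rewrite Rintegral_cst// mul0r.
  rewrite -u0; apply/eqP; rewrite -subr_eq0; apply/eqP.
  have [x0|/ltW x0] := leP 0 x; first by rewrite hu0.2// I0.
  by apply: oppr_inj; rewrite opprB hu0.2// I0 oppr0.
have E x : th x = phi x.
  apply/eqP; rewrite -subr_eq0; apply/eqP.
  apply: (@cos_eq1_continuous (fun x => th x - phi x)) => //.
    by move=> y; apply: cvgB; [exact: cth|exact: cphi].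
  by rewrite /th th00 add0r subrr.
exact: eq_prim hth E.
Qed.

(** The choice in weak_derivative agrees almost everywhere with the derivatives
    of cos psi and sin psi. *)
Lemma angle_mderiv m psi r : prim psi r ->
  measurable_fun setT (component1 m) -> measurable_fun setT (component2 m) ->
  {ae mu, forall x, m x = angle_map psi x} ->
  [/\ measurable_fun setT (fun x => (mderiv m x).1),
      measurable_fun setT (fun x => (mderiv m x).2),
      {ae mu, forall x, (mderiv m x).1 = - sin (psi x) * r x} &
      {ae mu, forall x, (mderiv m x).2 = cos (psi x) * r x}].
Proof.
move=> hr m1 m2 ae.
have a1 : {ae mu, forall x, component1 m x = cos (psi x)}.
  by apply: aeS ae => x; rewrite /component1 => ->.
have a2 : {ae mu, forall x, component2 m x = sin (psi x)}.
  by apply: aeS ae => x; rewrite /component2 => ->.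
have [? ?] := weak_derivativeP (prim_is_weak_derivative (prim_cos hr) m1 a1).
have [? ?] := weak_derivativeP (prim_is_weak_derivative (prim_sin hr) m2 a2).
by split.
Qed.

Lemma kparE (h : R) : (h <= 1 /\ kpar h = h) \/ (1 < h /\ kpar h = 1).
Proof.
rewrite /kpar; have [h1|h1] := leP h 1; [left|right]; split => //.
Qed.

(** W is the square of cos - h below the saturation field, and 1 - cos times a
    bounded function above it. In the latter case the integrability of 1 - cos
    is part of the finiteness of the energy. *)
Lemma W_rint (h : R) psi : continuous psi -> sqint mu setT (fun x => cos (psi x) - kpar h) ->
  (1 < h -> rint mu setT (fun x => cos (psi x) - 1)) ->
  rint mu setT (fun x => W h (angle_map psi x)).
Proof.
move=> cpsi sf i1; have [[_ kE]|[h1 kE]] := kparE h.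
  have := rintZ measurableT 2^-1 sf.2; congr rint; apply/funext => x.
  by rewrite /W /= kE; ring.
have mf : measurable_fun setT (fun x => cos (psi x) - (2 * h - 1)).
  apply: measurable_funB => //; apply: continuous_measurable_fun.
  exact: continuous_cos_comp.
have bf x : [set: R] x -> `|cos (psi x) - (2 * h - 1)| <= 1 + `|2 * h - 1|.
  by move=> _; rewrite (le_trans (ler_normB _ _))// lerD// cos_norm_le1.
have : rint mu setT (fun x => (cos (psi x) - (2 * h - 1)) * (cos (psi x) - 1)).
  by apply: (@rintMb _ _ _ mu setT measurableT (1 + `|2 * h - 1|)); [exact: mf|exact: bf|exact: i1].
move=> /(rintZ measurableT 2^-1); congr rint; apply/funext => x.
by rewrite /W /= kE; field.
Qed.

Section FiniteEnergy.
Variables (h : R) (m : R -> R * R) (phi : R -> R).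
Hypothesis cphi : continuous phi.
Hypothesis mphi : {ae mu, forall x, m x = angle_map phi x}.
Hypothesis fin : finite_energy h m.

(** The weak derivatives of the components yield absolutely continuous
    representatives, which coincide with cos phi and sin phi by continuity. *)
Lemma finite_energy_lifting : exists p, [/\ prim phi p, sqint mu setT p,
  sqint mu setT (fun x => cos (phi x) - kpar h),
  1 < h -> rint mu setT (fun x => cos (phi x) - 1) &
  measurable_fun setT (component1 m) /\ measurable_fun setT (component2 m)].
Proof.
case: fin => -[lk [c' [wc lc]]] [s' [ws ls]] l1.
have cc := continuous_cos_comp cphi; have cs := continuous_sin_comp cphi.
have ck : continuous (fun x => cos (phi x) - kpar h).
  by move=> x; apply: cvgB; [exact: cc|exact: cvg_cst].
have a1 : {ae mu, forall x, (m x).1 = cos (phi x)} by apply: aeS mphi => x ->.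
have a2 : {ae mu, forall x, (m x).2 = sin (phi x)} by apply: aeS mphi => x ->.
have hc : prim (fun x => cos (phi x)) c'.
  have [F [hF aF]] := weak_derivative_prim wc.
  have E : F =1 (fun x => cos (phi x) - kpar h).
    apply: ae_eq_continuous ck _; first exact: prim_continuous hF.
    by apply: aeS2 a1 aF => x -> <-.
  have := primD (eq_prim hF E) (prim_cst (kpar h)).
  by congr prim; apply/funext => x /=; rewrite ?subrK ?addr0.
have hs : prim (fun x => sin (phi x)) s'.
  have [F [hF aF]] := weak_derivative_prim ws.
  have E : F =1 (fun x => sin (phi x)).
    apply: ae_eq_continuous cs _; first exact: prim_continuous hF.
    by apply: aeS2 a2 aF => x e; rewrite /component2 e => <-.
  exact: (eq_prim hF E).
have sk := L2_sqint lk; have sc := L2_sqint lc; have ss := L2_sqint ls.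
have m1 : measurable_fun setT (component1 m).
  have := measurable_funD sk.1 (measurable_cst (kpar h)).
  by congr measurable_fun; apply/funext => x /=; rewrite subrK.
have m2 : measurable_fun setT (component2 m).
  by case: ws => /linc_locally_integrable/linc_measurable.
exists (fun x => cos (phi x) * s' x - sin (phi x) * c' x); split => //.
- exact: lifting_prim.
- apply: sqintB => //; apply: (sqintMb measurableT (C := 1)) => //.
  + exact: continuous_measurable_fun.
  + by move=> x _; exact: cos_norm_le1.
  + exact: continuous_measurable_fun.
  + by move=> x _; exact: sin_norm_le1.
- apply: sqint_ae sk; first exact: continuous_measurable_fun.
  by apply: aeS a1 => x ->.
- move=> h1; have /Lfun1_integrable i1 := l1 h1.
  apply: (rint_ae_eq _ _ _ _ i1) => //.
  + by apply: measurable_funB.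
  + by apply: measurable_funB => //; exact: continuous_measurable_fun.
  + by apply: aeS a1 => x ->.
Qed.

End FiniteEnergy.
End Lifting.

(** * Energy as a function of the angle *)

Section EnergyFormula.
Context {R : realType}.
Notation mu := (@lebesgue_measure R).
Notation plane := (measurableTypeR R * measurableTypeR R)%type.
Notation mu2 := (@lebesgue_measure R \x @lebesgue_measure R)%E.
Notation D := (@hplane R).
Notation ip := (ip mu2 D).
Implicit Types (f g phi psi p r zeta z : R -> R) (G : plane -> R * R).
Local Hint Resolve mitv : core.
Variable h : R.

(** The angles of finite energy, together with their derivative. *)
Definition admissible psi r := [/\ prim psi r, sqint mu setT r,
  sqint mu setT (fun x => cos (psi x) - kpar h) &
  rint mu setT (fun x => W h (angle_map psi x))].

(** The gradient of the stray field potential of the map with angle psi; r is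
    the derivative of psi. *)
Definition stray psi r G := grad_closure G /\ neumann (fun x => - sin (psi x) * r x) G.

Definition energy_value psi r G : R :=
  2^-1 * \int[mu]_x (r x ^+ 2) + \int[mu]_x W h (angle_map psi x) + 2^-1 * ip G G.

(** Absolutely continuous perturbations of compact support, with their
    derivative z. *)
Definition cprim zeta z := [/\ prim zeta z, sqint mu setT z &
  exists K, forall x, K < `|x| -> zeta x = 0 /\ z x = 0].

Lemma prim_measurable f g : prim f g -> measurable_fun setT f.
Proof. by move=> hf; apply: continuous_measurable_fun; exact: prim_continuous hf. Qed.

Lemma cos_prim_measurable psi r : prim psi r -> measurable_fun setT (fun x => cos (psi x)).
Proof. by move=> /prim_cos/prim_measurable. Qed.

Lemma sin_prim_measurable psi r : prim psi r -> measurable_fun setT (fun x => sin (psi x)).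
Proof. by move=> /prim_sin/prim_measurable. Qed.

Lemma integral_ae_eq f g : measurable_fun setT f -> measurable_fun setT g ->
  {ae mu, forall x, f x = g x} -> (\int[mu]_x (f x)%:E = \int[mu]_x (g x)%:E)%E.
Proof.
move=> mf mg fg; apply: ae_eq_integral => //.
- exact/measurable_EFinP.
- exact/measurable_EFinP.
- by apply: aeS fg => x -> _.
Qed.

Lemma stray_sq psi r : admissible psi r ->
  prim (fun x => cos (psi x) - kpar h) (fun x => - sin (psi x) * r x) /\
  sqint mu setT (fun x => - sin (psi x) * r x).
Proof.
move=> [hr sr sk _]; split.
  have := primB (prim_cos hr) (prim_cst (kpar h)).
  by congr prim; apply/funext => x /=; rewrite subr0.
apply: (sqintMb measurableT (C := 1)) => //.
  by apply: measurableT_comp => //; exact: sin_prim_measurable hr.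
by move=> x _; rewrite normrN sin_norm_le1.
Qed.

Lemma admissible_stray psi r : admissible psi r -> exists G, stray psi r G.
Proof.
move=> a; have [hp sp] := stray_sq a; have [_ _ sk _] := a.
exact: (stray_exists hp sk sp).
Qed.

Lemma sqnorm_mderiv m psi r : prim psi r -> sqint mu setT r ->
  measurable_fun setT (component1 m) -> measurable_fun setT (component2 m) ->
  {ae mu, forall x, m x = angle_map psi x} ->
  measurable_fun setT (fun x => sqnorm (mderiv m x)) /\
  {ae mu, forall x, sqnorm (mderiv m x) = r x ^+ 2}.
Proof.
move=> hr sr m1 m2 ae; have [d1 d2 a1 a2] := angle_mderiv hr m1 m2 ae.
split; first by apply: measurable_funD; exact: measurable_funM.
apply: aeS2 a1 a2 => x; rewrite /sqnorm /dotp => -> ->.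
by rewrite -[RHS]mul1r -(cos2Dsin2 (psi x)); ring.
Qed.

(** The energy as a real number, with chosen representatives of the derivatives
    and of the stray field. *)
Lemma energyE psi r G : admissible psi r -> stray psi r G ->
  energy h (angle_map psi) = (energy_value psi r G)%:E.
Proof.
move=> a [cG nG]; have [hr sr sk iW] := a; have [_ sp] := stray_sq a.
have mc := cos_prim_measurable hr; have ms := sin_prim_measurable hr.
have ae : {ae mu, forall x, angle_map psi x = angle_map psi x}.
  by apply: aeW => x.
have [d1 d2 a1 a2] := angle_mderiv (m := angle_map psi) hr mc ms ae.
have [mS aS] := sqnorm_mderiv (m := angle_map psi) hr sr mc ms ae.
have mW := rint_measurable iW.
rewrite /energy (stray_energyE sp.1 d1 a1 cG nG).
rewrite (@integral_ae_eq _ (fun x => r x ^+ 2 + 2 * W h (angle_map psi x))); last 3 first.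
- by apply: measurable_funD => //; exact: measurable_funM.
- by apply: measurable_funD; [exact: measurable_funX sr.1|exact: measurable_funM].
- by apply: aeS aS => x ->.
have i2 : rint mu setT (fun x => 2 * W h (angle_map psi x)) by exact: rintZ.
rewrite (EFin_Rint measurableT); last exact: rintD sr.2 i2.
rewrite (RintD measurableT sr.2 i2) (RintZ measurableT _ iW) -!EFinM -EFinD.
by congr EFin; rewrite /energy_value; field.
Qed.

Lemma sin_taylor (x y : R) : `|sin y - sin x - cos x * (y - x)| <= (y - x) ^+ 2.
Proof.
have := @taylor2 R (@sin R) (@cos R) 1 ler01 (@is_derive_sin R) _ x y.
by rewrite mul1r; apply => a b; rewrite mul1r cos_lip.
Qed.

Section CompactPerturbation.
Variables (zeta z : R -> R).
Hypothesis cz : cprim zeta z.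

Lemma cprim_rint (g : R -> R) : linc g -> (forall x, zeta x = 0 -> z x = 0 -> g x = 0) ->
  rint mu setT g.
Proof.
move=> lg g0; have [_ _ [K hK]] := cz.
by apply: (Rint_support lg _).1 => x /hK[a b]; exact: g0.
Qed.

Lemma cprim_sqint (g : R -> R) : continuous g -> (forall x, zeta x = 0 -> g x = 0) ->
  sqint mu setT g.
Proof.
move=> cg g0; split; first exact: continuous_measurable_fun.
apply: cprim_rint => [|x /g0 -> _]; last by rewrite expr0n.
by apply: continuous_linc => x; exact: (continuousM (cg x) (cg x)).
Qed.

Lemma cprim_sq : sqint mu setT zeta.
Proof. by apply: cprim_sqint => //; case: cz => /prim_continuous. Qed.

Lemma cprim_bounded : exists B, forall x, `|zeta x| <= B.
Proof.
have [/prim_continuous c _ [K hK]] := cz.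
have [M hM] := continuous_bounded_itv (- K) K c; exists `|M| => x.
have [xK|/hK[-> _]] := leP `|x| K; last by rewrite normr0.
by rewrite (le_trans (hM _ _) (ler_norm _))// in_itv/= -ler_norml.
Qed.

End CompactPerturbation.

Lemma continuous_W psi : continuous psi -> continuous (fun x => W h (angle_map psi x)).
Proof.
move=> c; have cc := continuous_cos_comp c => x.
rewrite /W /=; apply: cvgMl_tmp; apply: cvgB; last exact: cvg_cst.
apply: cvgD; last exact: cvg_cst.
apply: cvgB; last by apply: cvgMl_tmp; exact: cc.
exact: (continuousM (cc x) (cc x)).
Qed.

(** A perturbation of compact support changes the integrands on a bounded set
    only. *)
Lemma admissibleD psi r zeta z : admissible psi r -> cprim zeta z ->
  admissible (fun x => psi x + zeta x) (fun x => r x + z x).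
Proof.
move=> [hr sr sk iW] cz; have [hz sz _] := cz.
have hD := primD hr hz.
have c0 := prim_continuous hr; have c1 := prim_continuous hD.
split => //; first exact: sqintD.
  have s1 : sqint mu setT (fun x => cos (psi x + zeta x) - cos (psi x)).
    apply: (cprim_sqint cz) => [x|x ->]; last by rewrite addr0 subrr.
    by apply: cvgB; [exact: (continuous_cos_comp c1)|exact: (continuous_cos_comp c0)].
  have := sqintD measurableT sk s1; congr sqint; apply/funext => x; ring.
have i1 : rint mu setT (fun x => W h (angle_map (fun x => psi x + zeta x) x) - W h (angle_map psi x)).
  apply: (cprim_rint cz) => [|x e _]; last by rewrite /angle_map e addr0 subrr.
  by apply: lincB; apply: continuous_linc; exact: continuous_W.
have := rintD measurableT iW i1; congr rint; apply/funext => x; ring.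
Qed.

End EnergyFormula.

(** * Lower bound for the energy of a perturbation *)

(** The arithmetic of energy_lower. *)
Lemma energy_balance (R : realFieldType) (l1 l2 n p1 w1 p0 w0 g k1 k2 g1 e : R) :
  l1 + l2 - n <= (2^-1 * p1 + w1) - (2^-1 * p0 + w0) -> g + 2 * (k1 + k2) <= g1 ->
  - e <= k2 -> n <= e ->
  2^-1 * p0 + w0 + 2^-1 * g + (l1 + l2 + k1) - (e + e) <= 2^-1 * p1 + w1 + 2^-1 * g1.
Proof. by move=> *; lra. Qed.

Section LowerBound.
Context {R : realType}.
Notation mu := (@lebesgue_measure R).
Notation plane := (measurableTypeR R * measurableTypeR R)%type.
Notation mu2 := (@lebesgue_measure R \x @lebesgue_measure R)%E.
Notation D := (@hplane R).
Notation ip := (ip mu2 D).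
Notation sq2 := (sq2 mu2 D).
Local Hint Resolve mitv : core.
Variables (h : R) (phi p : R -> R) (G : plane -> R * R).
Hypothesis adm : admissible h phi p.
Hypothesis sG : stray phi p G.
Implicit Types zeta z : R -> R.

(** The linear part in zeta of the energy of phi + zeta; z is the derivative of
    zeta. The stray energy contributes the inner product with a field whose flux
    is the derivative of - sin phi * zeta. *)
Definition first_variation zeta z : R :=
  \int[mu]_x (p x * z x) + \int[mu]_x ((h - cos (phi x)) * sin (phi x) * zeta x) +
  ip G (exp_field 1 (fun x => - (sin (phi x) * zeta x))
                    (fun x => - (cos (phi x) * p x * zeta x + sin (phi x) * z x))).

Let hp : prim phi p := let: And4 a _ _ _ := adm in a.
Let sp : sqint mu setT p := let: And4 _ a _ _ := adm in a.
Let iW : rint mu setT (fun x => W h (angle_map phi x)) := let: And4 _ _ _ a := adm in a.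
Let cphi : continuous phi := prim_continuous hp.
Let mc : measurable_fun setT (fun x => cos (phi x)) := cos_prim_measurable hp.
Let ms : measurable_fun setT (fun x => sin (phi x)) := sin_prim_measurable hp.
Let P0 : R := \int[mu]_x (p x ^+ 2).

Section OnePerturbation.
Variables (zeta z : R -> R).
Hypothesis cz : cprim zeta z.
Let hz : prim zeta z := let: And3 a _ _ := cz in a.
Let sz : sqint mu setT z := let: And3 _ a _ := cz in a.
Let szeta := cprim_sq cz.
Let phi1 x := phi x + zeta x.
Let hp1 : prim phi1 (fun x => p x + z x) := primD hp hz.

Let g x := - (sin (phi x) * zeta x).
Let g' x := - (cos (phi x) * p x * zeta x + sin (phi x) * z x).

Lemma linear_part_prim : prim g g' /\ sqint mu setT g /\ sqint mu setT g'.
Proof.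
split.
  have := primZ (-1) (primM (prim_sin hp) hz).
  by congr prim; apply/funext => x; rewrite mulN1r.
have [B hB] := cprim_bounded cz.
split; apply: sqintN => //.
  by apply: (sqintMb measurableT (C := 1)) => // x _; exact: sin_norm_le1.
apply: sqintD => //; last first.
  by apply: (sqintMb measurableT (C := 1)) => // x _; exact: sin_norm_le1.
have := @sqintMb _ _ _ mu setT measurableT B (fun x => cos (phi x) * zeta x) p.
move=> hs; have {hs} : sqint mu setT (fun x => cos (phi x) * zeta x * p x).
  apply: hs => //; first by apply: measurable_funM => //; exact: prim_measurable hz.
  move=> x _; rewrite normrM (le_trans _ (hB x))// ler_piMl//; exact: cos_norm_le1.
by congr sqint; apply/funext => x; ring.
Qed.

Let r x := cos (phi1 x) - cos (phi x) - g x.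
Let r' x := - sin (phi1 x) * (p x + z x) - - sin (phi x) * p x - g' x.

(** The part r of the change of cos phi that is not linear in zeta, with its
    derivative. *)
Lemma remainder_prim : prim r r'.
Proof. exact: primB (primB (prim_cos hp1) (prim_cos hp)) linear_part_prim.1. Qed.

Variables (t e : R).
Hypothesis t0 : 0 < t.
Hypothesis e1 : e <= 1.
Hypothesis zeta_le : forall x, zeta x ^+ 2 <= e.

Let r_le x : `|r x| <= zeta x ^+ 2.
Proof.
have := cos_taylor (phi x) (phi1 x); congr (`| _ | <= _ ^+ 2); rewrite /r /g /phi1; ring.
Qed.

Let r'_le x : `|r' x| <= zeta x ^+ 2 * `|p x| + `|zeta x| * `|z x|.
Proof.
have -> : r' x = - (sin (phi1 x) - sin (phi x) - cos (phi x) * (phi1 x - phi x)) * p x +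
    - (sin (phi1 x) - sin (phi x)) * z x by rewrite /r' /g' /phi1; ring.
have dE : phi1 x - phi x = zeta x by rewrite /phi1; ring.
rewrite (le_trans (ler_normD _ _))// !normrM !normrN lerD// ler_wpM2r//.
  by have := sin_taylor (phi x) (phi1 x); rewrite dE.
by have := sin_lip (phi x) (phi1 x); rewrite dE.
Qed.

Lemma remainder_sq : sqint mu setT r /\ \int[mu]_x (r x ^+ 2) <= e * \int[mu]_x (zeta x ^+ 2).
Proof.
have mr := prim_measurable remainder_prim.
have i : rint mu setT (fun x => e * zeta x ^+ 2) by exact: rintZ _ _ szeta.2.
have le x : r x ^+ 2 <= e * zeta x ^+ 2.
  rewrite -(real_normK (num_real (r x))).
  have := r_le x; have := zeta_le x; have := sqr_ge0 (zeta x); have := normr_ge0 (r x); nra.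
have s : sqint mu setT r.
  split => //; apply: (le_rint measurableT _ _ i); first exact: measurable_funX.
  by move=> x _; rewrite ger0_norm ?sqr_ge0.
split => //; rewrite -(RintZ measurableT _ szeta.2).
by apply: (le_Rint measurableT s.2 i) => x _; exact: le.
Qed.

Lemma remainder_deriv_sq : sqint mu setT r' /\
  \int[mu]_x (r' x ^+ 2) <= 2 * e * (P0 + \int[mu]_x (z x ^+ 2)).
Proof.
have mr := linc_measurable remainder_prim.1.
have i0 := rintD measurableT sp.2 sz.2.
have i : rint mu setT (fun x => 2 * e * (p x ^+ 2 + z x ^+ 2)) by exact: rintZ _ _ i0.
have le x : r' x ^+ 2 <= 2 * e * (p x ^+ 2 + z x ^+ 2).
  have h1 := r'_le x; have h2 := zeta_le x; have h3 := sqr_ge0 (zeta x).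
  rewrite -(real_normK (num_real (r' x))) -(real_normK (num_real (p x))).
  rewrite -(real_normK (num_real (z x))).
  have hn : zeta x ^+ 2 = `|zeta x| ^+ 2 by rewrite real_normK ?num_real.
  have := normr_ge0 (r' x); have := normr_ge0 (p x); have := normr_ge0 (z x).
  have := normr_ge0 (zeta x).
  move: h1 h2 h3; rewrite hn.
  set a := `|r' x|; set b := `|p x|; set c := `|z x|; set y := `|zeta x|.
  move=> h1 h2 h3 y0 c0 b0 a0.
  have q1 : a ^+ 2 <= (y ^+ 2 * b + y * c) ^+ 2 by rewrite lerXn2r ?nnegrE// addr_ge0// mulr_ge0.
  apply: (le_trans q1).
  apply: (@le_trans _ _ (2 * ((y ^+ 2 * b) ^+ 2 + (y * c) ^+ 2))).
    by have := sqr_ge0 (y ^+ 2 * b - y * c); lra.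
  rewrite !exprMn.
  have p1 : (y ^+ 2) ^+ 2 * b ^+ 2 <= e * b ^+ 2 by rewrite ler_wpM2r ?sqr_ge0// expr2 (le_trans _ h2)// ler_piMl// (le_trans h2).
  have p2 : y ^+ 2 * c ^+ 2 <= e * c ^+ 2 by rewrite ler_wpM2r ?sqr_ge0.
  lra.
have s : sqint mu setT r'.
  split => //; apply: (le_rint measurableT _ _ i); first exact: measurable_funX.
  by move=> x _; rewrite ger0_norm ?sqr_ge0.
split => //; rewrite -(RintD measurableT sp.2 sz.2) -(RintZ measurableT _ i0).
by apply: (le_Rint measurableT s.2 i) => x _; exact: le.
Qed.

Let K1 := exp_field 1 g g'.
Let K2 := exp_field t^-1 r r'.

Let sK1 : sq2 K1.
Proof. by have [_ [? ?]] := linear_part_prim; exact: exp_field_sq2. Qed.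

Let sK2 : sq2 K2.
Proof.
apply: exp_field_sq2; first by rewrite invr_gt0.
- exact: remainder_sq.1.
- exact: remainder_deriv_sq.1.
Qed.

(** Cauchy-Schwarz and the explicit norm of the exponential field. With the
    decay rate 1 / t the two terms are balanced when zeta is of order t in mean
    square and its derivative is bounded in mean square. *)
Lemma remainder_field : (ip G K2) ^+ 2 <= ip G G * ((e / t * \int[mu]_x (zeta x ^+ 2) +
   t * (2 * e * (P0 + \int[mu]_x (z x ^+ 2)))) / 2).
Proof.
have mD := @measurable_half_plane R.
apply: (le_trans (ip_cauchy_schwarz mD sG.1.1 sK2)).
apply: ler_wpM2l; first exact: ip_ge0.
have [s1 l1] := remainder_sq; have [s2 l2] := remainder_deriv_sq.
rewrite exp_field_norm ?invr_gt0// invrK ler_wpM2r ?invr_ge0// lerD//.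
  by rewrite (mulrC e) -mulrA ler_wpM2l// invr_ge0 ltW.
by rewrite ler_wpM2l// ltW.
Qed.

(** Convexity, with the flux of the change carried by two exponential fields:
    one for the linear part, one for the remainder. *)
Lemma stray_lower G1 : stray phi1 (fun x => p x + z x) G1 ->
  ip G G + 2 * (ip G K1 + ip G K2) <= ip G1 G1.
Proof.
move=> [cG1 nG1]; have mD := @measurable_half_plane R.
rewrite -(ipDr mD sK1 sK2 sG.1.1).
apply: (stray_convex sG.1 sG.2 cG1 nG1); first exact: sq2D.
move=> xi txi; have sx := gradient_sq2 txi.
have [hg [s1 s2]] := linear_part_prim.
rewrite (ipDl mD sK1 sK2 sx) (exp_field_neumann ltr01 hg s1 s2 txi).
rewrite (exp_field_neumann _ remainder_prim remainder_sq.1 remainder_deriv_sq.1 txi) ?invr_gt0//.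
have [i1 _ _] := section_by_parts 0 hg txi.
have [i2 _ _] := section_by_parts 0 remainder_prim txi.
have [i3 _ _] := section_by_parts 0 (prim_cos hp1) txi.
have [i4 _ _] := section_by_parts 0 (prim_cos hp) txi.
rewrite -(RintD measurableT i1 i2) -(RintB measurableT i3 i4).
by apply: eq_Rint => x _; rewrite /r'; ring.
Qed.

(** The exchange energy is convex; the anisotropy is expanded to the second
    order in zeta. *)
Lemma local_lower :
  \int[mu]_x (p x * z x) + \int[mu]_x ((h - cos (phi x)) * sin (phi x) * zeta x) -
    (1 + `|h|) * \int[mu]_x (zeta x ^+ 2) <=
  (2^-1 * \int[mu]_x ((p x + z x) ^+ 2) + \int[mu]_x W h (angle_map phi1 x)) -
  (2^-1 * P0 + \int[mu]_x W h (angle_map phi x)).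
Proof.
have [_ _ _ iW1] := admissibleD adm cz.
have ipz := rint_sqM measurableT sp sz.
have iw : rint mu setT (fun x => (h - cos (phi x)) * sin (phi x) * zeta x).
  apply: (cprim_rint cz) => [|x -> _]; last by rewrite mulr0.
  apply: linc_contM; last by apply: continuous_linc; exact: prim_continuous hz.
  move=> x; apply: cvgM; last exact: (continuous_sin_comp cphi).
  by apply: cvgB; [exact: cvg_cst|exact: (continuous_cos_comp cphi)].
have iz : rint mu setT (fun x => (1 + `|h|) * zeta x ^+ 2) by exact: rintZ _ _ szeta.2.
rewrite (Rint_sqD measurableT sp sz) -(RintZ measurableT _ szeta.2).
have hw : \int[mu]_x ((h - cos (phi x)) * sin (phi x) * zeta x) -
    \int[mu]_x ((1 + `|h|) * zeta x ^+ 2) <=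
    \int[mu]_x W h (angle_map phi1 x) - \int[mu]_x W h (angle_map phi x).
  rewrite -(RintB measurableT iw iz) -(RintB measurableT iW1 iW).
  apply: (le_Rint measurableT); [exact: rintB|exact: rintB|move=> x _].
  rewrite /W /=.
  have E : cos (phi1 x) = cos (phi x) - sin (phi x) * zeta x + r x by rewrite /r /g; ring.
  have hc := cos_norm_le1 (phi x); have hr := r_le x.
  have hb : - ((1 + `|h|) * zeta x ^+ 2) <= (cos (phi x) - h) * r x.
    rewrite lerNl (le_trans (ler_norm _))// normrN normrM.
    rewrite (le_trans (ler_wpM2l _ hr))// ler_wpM2r ?sqr_ge0//.
    by rewrite (le_trans (ler_normB _ _))// lerD.
  have hsq := sqr_ge0 (- (sin (phi x) * zeta x) + r x).
  rewrite -/(phi1 x) E; lra.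
by have := Rint_sq_ge0 mu setT z; rewrite -/P0; lra.
Qed.

End OnePerturbation.

(** The error is smaller than del * t as soon as zeta^2 is uniformly small
    compared with t. The derivative z is only required to be bounded: along a
    flow phi \o Psi^-1 - phi is small to the first order, but its derivative is
    not, since p is merely square integrable. For zeta = s * eta with a test
    function eta the assumption holds as well. *)
Lemma energy_lower (C del : R) : 0 < del -> exists2 eps, 0 < eps &
  forall t zeta z G1, 0 < t <= eps -> cprim zeta z ->
    (forall x, zeta x ^+ 2 <= eps * t) -> \int[mu]_x (z x ^+ 2) <= C ->
    \int[mu]_x (zeta x ^+ 2) <= C * t ^+ 2 ->
    stray (fun x => phi x + zeta x) (fun x => p x + z x) G1 ->
    energy_value h phi p G + first_variation zeta z - del * t <=
    energy_value h (fun x => phi x + zeta x) (fun x => p x + z x) G1.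
Proof.
move=> del0.
have P00 : 0 <= P0 by exact: Rint_sq_ge0.
have G0 := ip_ge0 mu2 D G.
pose C' : R := `|C| + 1.
have C'0 : 0 < C' by rewrite ltr_wpDl.
have CC' : C <= C' by rewrite (le_trans (ler_norm _))// lerDl.
pose A : R := (1 + `|h|) * C' + 1.
have A0 : 0 < A by rewrite ltr_wpDl// mulr_ge0// ?addr_ge0// ltW.
pose B : R := ip G G * (3 * C' + 2 * P0) + 1.
have B0 : 0 < B by rewrite ltr_wpDl// mulr_ge0// addr_ge0// mulr_ge0// ltW.
pose eps : R := Num.min 1 (Num.min (del / (2 * A)) (del ^+ 2 / (2 * B))).
have eps0 : 0 < eps.
  by rewrite !lt_min ltr01 !divr_gt0// ?mulr_gt0// exprn_gt0.
have eps1 : eps <= 1 by rewrite ge_min lexx.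
have epsA : eps * A <= del / 2.
  have : eps <= del / (2 * A) by rewrite !ge_min lexx orbT.
  by rewrite ler_pdivlMr ?mulr_gt0//; lra.
have epsB : eps * B <= del ^+ 2 / 2.
  have : eps <= del ^+ 2 / (2 * B) by rewrite !ge_min lexx !orbT.
  by rewrite ler_pdivlMr ?mulr_gt0//; lra.
exists eps => // t zeta z G1 /andP[t0 te] cz zle zC zetaC s1.
have e1 : eps * t <= 1 by rewrite mulr_ile1 ?(le_trans te)// ltW.
have h1 := local_lower cz.
have h2 := remainder_field cz t0 e1 zle.
have h3 := stray_lower cz t0 e1 zle s1.
move: h2 h3; set K1 := exp_field 1 _ _; set K2 := exp_field t^-1 _ _ => h2 h3.
rewrite /energy_value /first_variation -/K1 -/P0.
have Z0 := Rint_sq_ge0 mu setT z; have I0 := Rint_sq_ge0 mu setT zeta.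
have b2 : - (del / 2 * t) <= ip G K2.
  have : `|ip G K2| <= del / 2 * t.
    apply: norm_le_sqr; first by rewrite mulr_ge0// ?divr_ge0// ltW.
    apply: (le_trans h2).
    rewrite [eps * t / t]mulfK ?gt_eqF//.
    apply: (@le_trans _ _ (ip G G * ((eps * (C' * t ^+ 2) + t * (2 * (eps * t) * (P0 + C'))) / 2))).
      apply: ler_wpM2l => //; rewrite ler_wpM2r// lerD//.
        apply: ler_wpM2l; first exact: ltW.
        by rewrite (le_trans zetaC)// ler_wpM2r// sqr_ge0.
      apply: ler_wpM2l; first exact: ltW.
      by apply: ler_wpM2l; [rewrite ?mulr_ge0 ?ltW|rewrite lerD2l (le_trans zC)].
    have -> : ip G G * ((eps * (C' * t ^+ 2) + t * (2 * (eps * t) * (P0 + C'))) / 2) =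
        (eps * (B - 1)) * t ^+ 2 / 2 by rewrite /B; field.
    have -> : (del / 2 * t) ^+ 2 = (del ^+ 2 / 2) * t ^+ 2 / 2 by field.
    have q : eps * (B - 1) <= eps * B by apply: ler_wpM2l; [exact: ltW|rewrite gerDl oppr_le0].
    by rewrite ler_wpM2r// ler_wpM2r ?sqr_ge0// (le_trans q).
  by rewrite ler_norml => /andP[].
have b3 : (1 + `|h|) * \int[mu]_x (zeta x ^+ 2) <= del / 2 * t.
  have q1 : (1 + `|h|) * \int[mu]_x (zeta x ^+ 2) <= (1 + `|h|) * (C' * t ^+ 2).
    by rewrite ler_wpM2l// (le_trans zetaC)// ler_wpM2r// sqr_ge0.
  have q2 : (1 + `|h|) * (C' * t ^+ 2) <= A * t * t.
    by rewrite mulrA expr2 mulrA !ler_pM2r// lerDl.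
  have q3 : A * t * t <= eps * A * t by rewrite ler_pM2r// mulrC ler_pM2r.
  by rewrite (le_trans q1)// (le_trans q2)// (le_trans q3)// ler_pM2r.
have -> : del * t = del / 2 * t + del / 2 * t by rewrite -mulrDl -splitr.
exact: energy_balance h1 h3 b2 b3.
Qed.

End LowerBound.

(** * First variation *)

Section ExponentialAverage.
Context {R : realType}.
Notation mu := (@lebesgue_measure R).
Notation plane := (measurableTypeR R * measurableTypeR R)%type.
Notation mu2 := (@lebesgue_measure R \x @lebesgue_measure R)%E.
Notation D := (@hplane R).
Notation posR := (`]0, +oo[%classic : set R).
Notation w := (@gauss_fun R).
Local Hint Resolve mitv : core.
Implicit Types (g : plane -> R) (a : R -> R).

Lemma gauss_sqint : sqint mu setT w.
Proof.
split; first exact: measurable_gauss_fun.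
apply: (@le_rint _ _ _ mu setT measurableT _ w); last exact: integrableT_gauss.
  by apply: measurable_funX; exact: measurable_gauss_fun.
move=> x _; rewrite ger0_norm ?sqr_ge0// expr2 ler_piMl ?gauss_fun_ge0//.
exact: gauss_fun_le1.
Qed.

(** The integral of g over the vertical half line above x, with an exponential
    weight. The Gaussian w, which cancels, is there to make the inner integral
    that of a function integrable over the half plane, so that measurability in
    x comes from Fubini. *)
Definition exp_average g (x : R) : R :=
  (\int[mu]_(y in posR) (g (x, y) * (w x * expR (- (1 * y))))) / w x.

(** Almost every vertical section of an integrable function is integrable, and
    there a x can be taken out of the inner integral. *)
Lemma exp_averageP g : sqint mu2 D g ->
  measurable_fun setT (exp_average g) /\
  forall a, sqint mu setT a -> rint mu setT (fun x => a x * exp_average g x) /\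
    \int[mu2]_(z in D) (g z * (a z.1 * expR (- (1 * z.2)))) =
    \int[mu]_x (a x * exp_average g x).
Proof.
move=> sg; have mD := @measurable_half_plane R.
have w0 (x : R) : w x != 0 by rewrite gt_eqF// expR_gt0.
have rF a : sqint mu setT a -> rint mu2 D (fun z => g z * (a z.1 * expR (- (1 * z.2)))).
  by move=> sa; apply: rint_sqM => //; exact: (sqint_exp ltr01 sa).1.
have iw := rF _ gauss_sqint.
have mq : measurable_fun setT (exp_average g).
  apply: measurable_funM; first exact: (rint_measurable (fubini1 iw).1).
  have cw : continuous (fun x : R => (w x)^-1).
    by move=> x; apply: (@cvgV _ _ _ _ (fun x => w x)) => //; exact: continuous_gauss_fun.
  exact: continuous_measurable_fun.
split => // a sa; have ia := rF a sa; have [i1 ->] := fubini1 ia.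
have ae : {ae mu, forall x, \int[mu]_(y in posR) (g (x, y) * (a x * expR (- (1 * y)))) =
    a x * exp_average g x}.
  have iFD := (integrable_mkcond _ mD).1 iw.
  apply: aeS (ae_integrable1 iFD) => x hx.
  have ix : rint mu posR (fun y => g (x, y) * (w x * expR (- (1 * y)))).
    apply: (integrable_mkcond _ (@measurable_posR R)).2; move: hx.
    congr (_.-integrable _ _); apply/funext => y.
    exact: restrict_half_plane (fun z : plane => g z * (w z.1 * expR (- (1 * z.2)))) x y.
  rewrite /exp_average mulrCA mulrC.
  have -> : a x / w x * \int[mu]_(y in posR) (g (x, y) * (w x * expR (- (1 * y)))) =
     \int[mu]_(y in posR) (a x / w x * (g (x, y) * (w x * expR (- (1 * y))))).
    by rewrite (RintZ (@measurable_posR R) _ ix).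
  by apply: eq_Rint => y _; field.
have m1 := rint_measurable i1.
have m2 : measurable_fun setT (fun x => a x * exp_average g x).
  by apply: measurable_funM => //; case: sa.
split; first exact: rint_ae_eq i1.
exact: Rint_ae_eq.
Qed.

End ExponentialAverage.

Section FirstVariation.
Context {R : realType}.
Notation mu := (@lebesgue_measure R).
Notation plane := (measurableTypeR R * measurableTypeR R)%type.
Notation mu2 := (@lebesgue_measure R \x @lebesgue_measure R)%E.
Notation D := (@hplane R).
Notation ip := (ip mu2 D).
Local Hint Resolve mitv : core.
Variables (h : R) (phi p : R -> R) (G : plane -> R * R).
Hypothesis adm : admissible h phi p.
Hypothesis sG : stray phi p G.
Implicit Types zeta z : R -> R.
Notation FV := (first_variation h phi p G).

Let hp : prim phi p := let: And4 a _ _ _ := adm in a.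
Let sp : sqint mu setT p := let: And4 _ a _ _ := adm in a.
Let cphi : continuous phi := prim_continuous hp.
Let mc : measurable_fun setT (fun x => cos (phi x)) := cos_prim_measurable hp.
Let ms : measurable_fun setT (fun x => sin (phi x)) := sin_prim_measurable hp.

Let Q1 := exp_average (fun q : plane => (G q).1).
Let Q2 := exp_average (fun q : plane => (G q).2).
Let A x := p x + sin (phi x) * Q2 x.
Let B x := (h - cos (phi x)) * sin (phi x) + sin (phi x) * Q1 x + cos (phi x) * p x * Q2 x.

Let sinM (f : R -> R) : sqint mu setT f -> sqint mu setT (fun x => sin (phi x) * f x).
Proof. by move=> sf; apply: (sqintMb measurableT (C := 1)) => // x _; exact: sin_norm_le1. Qed.

Let scp : sqint mu setT (fun x => cos (phi x) * p x).
Proof. by apply: (sqintMb measurableT (C := 1)) => // x _; exact: cos_norm_le1. Qed.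

Let linc_average (g : plane -> R) : sqint mu2 D g -> linc (exp_average g).
Proof.
move=> sg; have [mq hq] := exp_averageP sg => a b.
have sI : sqint mu setT (\1_(`[a, b]) : R -> R).
  split; first exact: measurable_indic.
  have -> : (fun x : R => (\1_(`[a, b]%classic) x : R) ^+ 2) = (\1_(`[a, b]%classic) : R -> R).
    by apply/funext => x; rewrite indicE; case: (_ \in _); rewrite ?expr1n ?expr0n.
  have := (integrable_mkcond _ (mitv a b)).1 (@linc_bounded R (cst 1) 1 (measurable_cst _) _ a b).
  have hb (x : R) : `|cst 1 x : R| <= 1 by rewrite normr1.
  move=> /(_ hb); congr (_.-integrable _ _); apply/funext => x.
  by rewrite patchE /= indicE; case: (_ \in _).
apply: (integrable_mkcond _ (mitv a b)).2; have := (hq _ sI).1.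
congr (_.-integrable _ _); apply/funext => x /=.
by rewrite patchE indicE; case: (_ \in _) => /=; rewrite ?mul1r ?mul0r.
Qed.

(** The inner product in the first variation, integrated first in the vertical
    direction, is an integral over the line. *)
Lemma first_variationE zeta z : cprim zeta z ->
  [/\ rint mu setT (fun x => A x * z x), rint mu setT (fun x => B x * zeta x) &
   FV zeta z = \int[mu]_x (A x * z x) + \int[mu]_x (B x * zeta x)].
Proof.
move=> cz; have [hz sz _] := cz; have szeta := cprim_sq cz.
have mD := @measurable_half_plane R.
have [sG1 sG2] := sG.1.1.
have [_ h1] := exp_averageP sG1; have [_ h2] := exp_averageP sG2.
have s1 := sinM szeta; have s2 := sinM sz.
have s3 : sqint mu setT (fun x => cos (phi x) * p x * zeta x).
  have [_ [_]] := linear_part_prim adm cz.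
  move=> /(sqintN measurableT)/(sqintB measurableT)/(_ s2).
  by congr sqint; apply/funext => x; ring.
have [i1 e1] := h1 _ s1; have [i2 e2] := h2 _ s2; have [i3 e3] := h2 _ s3.
have ipz := rint_sqM measurableT sp sz.
have iw : rint mu setT (fun x => (h - cos (phi x)) * sin (phi x) * zeta x).
  apply: (cprim_rint cz) => [|x -> _]; last by rewrite mulr0.
  apply: linc_contM; last by apply: continuous_linc; exact: prim_continuous hz.
  move=> x; apply: cvgM; last exact: (continuous_sin_comp cphi).
  by apply: cvgB; [exact: cvg_cst|exact: (continuous_cos_comp cphi)].
have EA : (fun x => A x * z x) = (fun x => p x * z x + sin (phi x) * z x * Q2 x).
  by apply/funext => x; rewrite /A; ring.
have EB : (fun x => B x * zeta x) = (fun x => (h - cos (phi x)) * sin (phi x) * zeta x +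
    (sin (phi x) * zeta x * Q1 x + cos (phi x) * p x * zeta x * Q2 x)).
  by apply/funext => x; rewrite /B; ring.
have iA : rint mu setT (fun x => A x * z x) by rewrite EA; exact: rintD.
have i13 := rintD measurableT i1 i3.
have iB : rint mu setT (fun x => B x * zeta x) by rewrite EB; exact: rintD.
split => //; rewrite EA EB (RintD measurableT ipz i2) (RintD measurableT iw i13).
rewrite (RintD measurableT i1 i3) -e1 -e2 -e3 /first_variation.
have j1 : rint mu2 D (fun v => (G v).1 * (sin (phi v.1) * zeta v.1 * expR (- (1 * v.2)))).
  exact: (rint_sqM mD sG1 (sqint_exp ltr01 s1).1).
have j2 : rint mu2 D (fun v => (G v).2 * (sin (phi v.1) * z v.1 * expR (- (1 * v.2)))).
  exact: (rint_sqM mD sG2 (sqint_exp ltr01 s2).1).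
have j3 : rint mu2 D (fun v => (G v).2 * (cos (phi v.1) * p v.1 * zeta v.1 * expR (- (1 * v.2)))).
  exact: (rint_sqM mD sG2 (sqint_exp ltr01 s3).1).
have -> : ip G (exp_field 1 (fun x => - (sin (phi x) * zeta x))
     (fun x => - (cos (phi x) * p x * zeta x + sin (phi x) * z x))) =
   \int[mu2]_(v in D) ((G v).1 * (sin (phi v.1) * zeta v.1 * expR (- (1 * v.2))) +
    ((G v).2 * (cos (phi v.1) * p v.1 * zeta v.1 * expR (- (1 * v.2))) +
     (G v).2 * (sin (phi v.1) * z v.1 * expR (- (1 * v.2))))).
  by apply: eq_Rint => v _; rewrite /dotp /exp_field/=; ring.
rewrite (RintD mD j1 (rintD mD j3 j2)) (RintD mD j3 j2).
ring.
Qed.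

Lemma test_cprim (eta : R -> R) : test_function eta -> cprim eta (derive1 eta).
Proof.
move=> te; have [K hK] := test_function_bound te; have [se _] := te.
have [_ de se'] := smoothP se.
have E : derive1 eta = (fun x => 'D_1 eta x) by apply/funext => x; rewrite derive1E.
have ce : continuous (derive1 eta) by rewrite E; exact: smooth_continuous (se' 1).
have hK' x : K < `|x| -> eta x = 0 /\ derive1 eta x = 0.
  by move=> /hK[-> h1]; rewrite derive1E.
split; last by exists K.
  by apply: prim_C1 => // x; rewrite derive1E; exact: derivableP.
split; first exact: continuous_measurable_fun.
apply: (@Rint_support _ _ K _ _).1; last by move=> x /hK'[_ ->]; rewrite expr0n.
by apply: continuous_linc => x; exact: (continuousM (ce x) (ce x)).
Qed.

(** On test functions FV = 0 says that B is the weak derivative of A. Hence A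
    has an absolutely continuous representative, and the product rule integrates
    A z + B zeta to 0. *)
Lemma first_variation0 :
  (forall eta : R -> R, test_function eta -> FV eta (derive1 eta) = 0) ->
  forall zeta z, cprim zeta z -> FV zeta z = 0.
Proof.
move=> hT zeta z cz.
have [sG1 sG2] := sG.1.1.
have lA : linc A.
  apply: lincD; first exact: hp.1.
  by apply: linc_contM; [exact: continuous_sin_comp|exact: linc_average].
have lB : linc B.
  apply: lincD; last exact: (rint_linc ((exp_averageP sG2).2 _ scp).1).
  apply: lincD; last by apply: linc_contM; [exact: continuous_sin_comp|exact: linc_average].
  apply: continuous_linc => x; apply: cvgM; last exact: (continuous_sin_comp cphi).
  by apply: cvgB; [exact: cvg_cst|exact: (continuous_cos_comp cphi)].
have wAB : is_weak_derivative A B.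
  split; [exact/linc_locally_integrable|exact/linc_locally_integrable|move=> eta te].
  have [_ _ e] := first_variationE (test_cprim te).
  by apply/eqP; rewrite -addr_eq0 -e hT.
have [F [hF aF]] := weak_derivative_prim wAB.
have [iA iB ->] := first_variationE cz; have [hz sz [K hK]] := cz.
have mz := linc_measurable hz.1.
have cF := prim_continuous hF.
have mF : measurable_fun setT F by exact: continuous_measurable_fun.
have mA := linc_measurable lA.
have ae : {ae mu, forall x, A x * z x = F x * z x} by apply: aeS aF => x ->.
have m1 : measurable_fun setT (fun x => A x * z x) by exact: measurable_funM.
have m2 : measurable_fun setT (fun x => F x * z x) by exact: measurable_funM.
rewrite (Rint_ae_eq _ m1 m2 ae)//.
have iF := rint_ae_eq measurableT m1 m2 ae iA.
rewrite addrC -(RintD measurableT iB iF).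
apply: (prim_support_int0 (K := K) (primM hF hz)) => x /hK[-> ->].
by rewrite !mulr0 addr0.
Qed.

Lemma is_derive0_little (f : R -> R) : is_derive (0 : R) (1 : R) f 0 ->
  forall del, 0 < del -> exists2 e, 0 < e & forall s, `|s| <= e -> `|f s - f 0| <= del * `|s|.
Proof.
move=> [df vf] del del0.
have hq : k^-1 *: ((f \o shift 0) (k *: (1 : R)) - f 0) @[k --> 0^'] --> 'D_1 f 0 by exact: df.
rewrite vf in hq.
move/cvgrPdist_le : hq => /(_ _ del0) /nbhs_ballP[e /= e0 he].
exists (e / 2) => [|s se]; first by rewrite divr_gt0.
have [->|s0] := eqVneq s 0; first by rewrite subrr normr0 mulr0.
have bs : ball (0 : R) e s.
  by rewrite -ball_normE /ball_/= sub0r normrN (le_lt_trans se)// ltr_pdivrMr// ltr_pMr// ltr1n.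
have := he s bs s0; rewrite /= sub0r normrN addr0 [s *: 1]mulr1 normrM normfV.
by rewrite mulrC ler_pdivrMr// normr_gt0.
Qed.

Lemma first_variationZ (c : R) zeta z : cprim zeta z ->
  cprim (fun x => c * zeta x) (fun x => c * z x) /\
  FV (fun x => c * zeta x) (fun x => c * z x) = c * FV zeta z.
Proof.
move=> cz; have [hz sz [K hK]] := cz.
have cz' : cprim (fun x => c * zeta x) (fun x => c * z x).
  split; [exact: primZ|exact: sqintZ|exists K => x /hK[-> ->]].
  by rewrite mulr0.
split => //; have [i1 i2 ->] := first_variationE cz; have [j1 j2 ->] := first_variationE cz'.
rewrite mulrDr -(RintZ measurableT _ i1) -(RintZ measurableT _ i2).
by congr (_ + _); apply: eq_Rint => x _; ring.
Qed.

Hypothesis crit : forall eta : R -> R, test_function eta ->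
  is_derive (0 : R) (1 : R)
    (fun t : R => fine (energy h (angle_map (fun x => phi x + t * eta x)))) 0.

(** The energy of phi + s * eta is E + o(s) by criticality and at least E + s *
    FV - o(s) by energy_lower. The two signs of s give FV = 0. *)
Lemma critical_test (eta : R -> R) : test_function eta -> FV eta (derive1 eta) = 0.
Proof.
move=> te; have ce := test_cprim te; set z := derive1 eta in ce *.
pose L := FV eta z; rewrite -/L.
have [B0 hB0] := cprim_bounded ce.
pose C := \int[mu]_x (z x ^+ 2) + \int[mu]_x (eta x ^+ 2).
have Z0 := Rint_sq_ge0 mu setT z; have E0 := Rint_sq_ge0 mu setT eta.
have key del : 0 < del -> forall sgn : R, `|sgn| = 1 -> sgn * L <= 2 * del.
  move=> del0 sgn sgn1.
  have [e e0 he] := is_derive0_little (crit te) del0.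
  have [eps eps0 heps] := energy_lower adm sG C del0.
  pose t := Num.min e (Num.min eps (Num.min 1 (eps / (B0 ^+ 2 + 1)))).
  have B1 : 0 < B0 ^+ 2 + 1 by rewrite ltr_wpDl// sqr_ge0.
  have t0 : 0 < t by rewrite !lt_min e0 eps0 ltr01 divr_gt0.
  have te' : t <= e by rewrite ge_min lexx.
  have teps : t <= eps by rewrite !ge_min lexx !orbT.
  have t1 : t <= 1 by rewrite !ge_min lexx !orbT.
  have tB : t * (B0 ^+ 2 + 1) <= eps.
    by rewrite -ler_pdivlMr// /t !ge_min lexx !orbT.
  have sgn2 : sgn ^+ 2 = 1 by rewrite -(real_normK (num_real sgn)) sgn1 expr1n.
  pose s := sgn * t.
  have s2 : s ^+ 2 = t ^+ 2 by rewrite exprMn sgn2 mul1r.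
  have ns : `|s| = t by rewrite normrM sgn1 mul1r gtr0_norm.
  have [cs hs] := first_variationZ s ce.
  have as1 := admissibleD adm cs; have [G1 hG1] := admissible_stray as1.
  have := heps t _ _ G1 _ cs _ _ _ hG1; rewrite t0 teps hs -/L => hlow.
  have {}hlow : energy_value h phi p G + s * L - del * t <=
      energy_value h (fun x => phi x + s * eta x) (fun x => p x + s * z x) G1.
    apply: hlow => //.
    - move=> x; rewrite exprMn s2.
      have h1 : eta x ^+ 2 <= B0 ^+ 2.
        by rewrite -(real_normK (num_real (eta x))) lerXn2r ?nnegrE// (le_trans _ (hB0 x)).
      rewrite expr2 -mulrA mulrC ler_pM2r// (le_trans _ tB)// ler_pM2l//.
      by rewrite (le_trans h1)// lerDl.
    - rewrite (_ : \int[mu]_x ((s * z x) ^+ 2) = s ^+ 2 * \int[mu]_x (z x ^+ 2)); last first.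
        rewrite -(RintZ measurableT); last by have [_ [_ ?] _] := ce.
        by apply: eq_Rint => x _; rewrite exprMn.
      rewrite s2 (@le_trans _ _ (\int[mu]_x (z x ^+ 2)))//; last by rewrite lerDl.
      by rewrite ler_piMl// expr_le1// ltW.
    - rewrite (_ : \int[mu]_x ((s * eta x) ^+ 2) = s ^+ 2 * \int[mu]_x (eta x ^+ 2)); last first.
        rewrite -(RintZ measurableT); last by have [] := cprim_sq ce.
        by apply: eq_Rint => x _; rewrite exprMn.
      by rewrite s2 mulrC ler_wpM2r ?sqr_ge0// lerDr.
  have hup := he s; rewrite ns in hup; have := hup te'.
  rewrite (energyE as1 hG1) /=.
  have -> : (fun x => phi x + 0 * eta x) = phi by apply/funext => x; rewrite mul0r addr0.
  rewrite (energyE adm sG) /= => /(le_trans (ler_norm _)) hup'.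
  have : s * L <= 2 * del * t by lra.
  by rewrite /s mulrAC ler_pM2r.
apply/eqP; rewrite -normr_le0 leNgt; apply/negP => L0.
have d0 : 0 < `|L| / 4 by rewrite divr_gt0.
have := key _ d0 1 (normr1 _); have := key _ d0 (-1) (normrN1 _).
rewrite mulN1r mul1r => k1 k2.
have : `|L| <= 2 * (`|L| / 4) by rewrite ler_norml k2 andbT lerNl.
lra.
Qed.

(** The class of perturbations that contains the truncated dilations. *)
Lemma critical_first_variation zeta z : cprim zeta z -> FV zeta z = 0.
Proof. exact: first_variation0 critical_test zeta z. Qed.

End FirstVariation.

(** * Increments of square integrable primitives and flows *)

Section Increments.
Context {R : realType}.
Notation mu := (@lebesgue_measure R).
Local Hint Resolve mitv : core.
Variables (F f N : R -> R).
Hypothesis hF : prim F f.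
Hypothesis sf : sqint mu setT f.
Hypothesis hN : prim N (fun x => f x ^+ 2).

Let N_le a b : a <= b -> N a <= N b.
Proof. by apply: prim_le hN _ => x; exact: sqr_ge0. Qed.

(** Cauchy-Schwarz on the interval. *)
Lemma sq_increment_le a b : a <= b -> (F b - F a) ^+ 2 <= (b - a) * (N b - N a).
Proof.
move=> ab; rewrite hF.2// hN.2//.
have sq1 : sqint mu `[a, b] (cst 1 : R -> R).
  split => //; have := @linc_bounded R (cst 1) 1 (measurable_cst _) _ a b.
  have hb (x : R) : `|cst 1 x : R| <= 1 by rewrite normr1.
  by move=> /(_ hb); congr rint; apply/funext => x /=; rewrite expr1n.
have sq2 : sqint mu `[a, b] f.
  by split; [exact: measurable_funTS sf.1|exact: hN.1].
have := cauchy_schwarz (mitv a b) sq1 sq2.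
rewrite (_ : \int[mu]_(x in `[a, b]) (cst 1 x * f x) = \int[mu]_(x in `[a, b]) f x); last first.
  by apply: eq_Rint => x _ /=; rewrite mul1r.
rewrite (_ : \int[mu]_(x in `[a, b]) (cst 1 x ^+ 2) = b - a)//.
have h1 : prim (fun x : R => x) (cst 1).
  by apply: prim_C1 => x; exact: cvg_cst.
by rewrite h1.2//; apply: eq_Rint => x _ /=; rewrite expr1n.
Qed.

Lemma sq_increment_near (d x y : R) : `|y - x| <= d ->
  (F y - F x) ^+ 2 <= d * (N (x + d) - N (x - d)).
Proof.
move=> yx; have d0 : 0 <= d by apply: le_trans yx.
move: yx; rewrite ler_distl => /andP[y1 y2].
have [xy|/ltW xy] := leP x y.
  apply: (le_trans (sq_increment_le xy)); apply: ler_pM => //.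
  - by rewrite subr_ge0.
  - by rewrite subr_ge0 N_le.
  - by rewrite lerBlDl.
  - by rewrite lerB// N_le// gerBl.
rewrite -sqrrN opprB; apply: (le_trans (sq_increment_le xy)); apply: ler_pM => //.
- by rewrite subr_ge0.
- by rewrite subr_ge0 N_le.
- by rewrite lerBlDl -lerBlDr.
- by rewrite lerB// N_le// lerDl.
Qed.

Let i2 : rint mu setT (fun x => f x ^+ 2) := sf.2.

Lemma increment_le_total a b : a <= b -> N b - N a <= \int[mu]_x (f x ^+ 2).
Proof.
move=> ab; rewrite hN.2// Rintegral_mkcond; apply: (le_Rint measurableT) => //.
  by rewrite /rint -restrict_EFin; exact: (integrable_mkcond _ (mitv a b)).1 (hN.1 a b).
by move=> x _; rewrite patchE; case: ifP => // _; exact: sqr_ge0.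
Qed.

(** Absolute continuity of the integral of f^2, uniformly on the line. *)
Lemma increment_uniform (e : R) : 0 < e -> exists2 d, 0 < d &
  forall x, N (x + d) - N (x - d) <= e.
Proof.
move=> e0; have [d [d0 hd]] := integral_normr_continuous i2 e0.
exists (d / 4) => [|x]; first by rewrite divr_gt0.
have xx : x - d / 4 <= x + d / 4 by rewrite lerD2l lerNl (le_trans (_ : _ <= 0))// ?oppr_le0 divr_ge0// ltW.
rewrite hN.2//; apply: ltW.
rewrite (_ : \int[mu]_(t in `[x - d / 4, x + d / 4]) _ =
  \int[mu]_(t in `[x - d / 4, x + d / 4]) `|f t ^+ 2|); last first.
  by apply: eq_Rint => t _; rewrite ger0_norm ?sqr_ge0.
apply: hd => //; rewrite [X in (X < _)%E]lebesgue_measure_itv/= lte_fin.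
case: ifP => _; last by rewrite lte_fin.
by rewrite -EFinB lte_fin; lra.
Qed.

(** Averaging an increment of N over a segment amounts to averaging N over two
    segments of length 2 d, where N is monotone. *)
Lemma increment_average (d K : R) : 0 <= d -> 0 <= K ->
  \int[mu]_(x in `[- K, K]) (N (x + d) - N (x - d)) <= 2 * d * \int[mu]_x (f x ^+ 2).
Proof.
move=> d0 K0; have cN := prim_continuous hN.
have [M [hM _]] := prim_exists (continuous_linc cN).
have dM := prim_is_derive cN hM.
have shift (c : R) : prim (fun x => M (x + c)) (fun x => N (x + c)).
  apply: prim_C1 => [x|x].
    have h1 : is_derive x 1 (fun x : R => x + c) 1.
      by have := is_der_affine 1 c x; congr (is_derive _ _ _ _); apply/funext => t; rewrite mul1r.
    by have := @is_der_comp _ M (fun x => x + c) _ _ _ (dM (x + c)) h1; rewrite mulr1.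
  apply: continuous_comp; last exact: cN.
  exact: (cvgD (@cvg_id _ _) (cvg_cst c)).
have KK : - K <= K by rewrite ge0_cp.
rewrite -(primB (shift d) (shift (- d))).2//.
have up a b : a <= b -> M b - M a <= (b - a) * N b.
  move=> ab; rewrite hM.2// -[X in _ <= X](_ : \int[mu]_(x in `[a, b]) cst (N b) x = _); last first.
    have h1 : prim (fun x => N b * x) (fun=> N b * 1).
      by apply: primZ; apply: prim_C1 => x; exact: cvg_cst.
    rewrite mulrC mulrBr h1.2//; apply: eq_Rint => x _ /=; by rewrite mulr1.
  apply: (le_Rint (mitv a b)); [exact: hM.1|by apply: continuous_linc => x; exact: cvg_cst|].
  by move=> x; rewrite /= in_itv/= => /andP[_]; exact: N_le.
have lo a b : a <= b -> (b - a) * N a <= M b - M a.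
  move=> ab; rewrite hM.2// -[X in X <= _](_ : \int[mu]_(x in `[a, b]) cst (N a) x = _); last first.
    have h1 : prim (fun x => N a * x) (fun=> N a * 1).
      by apply: primZ; apply: prim_C1 => x; exact: cvg_cst.
    rewrite mulrC mulrBr h1.2//; apply: eq_Rint => x _ /=; by rewrite mulr1.
  apply: (le_Rint (mitv a b)); [by apply: continuous_linc => x; exact: cvg_cst|exact: hM.1|].
  by move=> x; rewrite /= in_itv/= => /andP[+ _]; exact: N_le.
have h1 := up (K - d) (K + d); have h2 := lo (- K - d) (- K + d).
have h3 := @increment_le_total (- K - d) (K + d).
have {}h1 : M (K + d) - M (K - d) <= 2 * d * N (K + d).
  by have -> : 2 * d = K + d - (K - d) by [ring]; apply: h1; lra.
have {}h2 : 2 * d * N (- K - d) <= M (- K + d) - M (- K - d).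
  by have -> : 2 * d = - K + d - (- K - d) by [ring]; apply: h2; lra.
have {}h3 : 2 * d * (N (K + d) - N (- K - d)) <= 2 * d * \int[mu]_x (f x ^+ 2).
  by rewrite ler_wpM2l ?mulr_ge0//; apply: h3; lra.
lra.
Qed.

End Increments.

Section Flow.
Context {R : realType}.
Variables (X xi : R -> R) (M K s : R).
Hypothesis dX : forall x : R, is_derive x 1 X (xi x).
Hypothesis X_le : forall x, `|X x| <= M.
Hypothesis xi_le : forall x, `|xi x| <= M.
Hypothesis X0 : forall x, K < `|x| -> X x = 0 /\ xi x = 0.
Hypothesis sM : `|s| * M <= 2^-1.

Definition flow x := x + s * X x.
Definition dflow x := 1 + s * xi x.

Lemma flow_is_derive (x : R) : is_derive x 1 flow (dflow x).
Proof. exact: is_der_add (is_derive_id x 1) (is_der_scale s (dX x)). Qed.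

Lemma sxi_le x : `|s * xi x| <= 2^-1.
Proof. by rewrite normrM (le_trans _ sM)// ler_wpM2l. Qed.

Lemma dflow_bounds x : [/\ 0 < dflow x, dflow x <= 2 & 2^-1 <= dflow x].
Proof. by have := sxi_le x; rewrite ler_norml /dflow => /andP[]; split; lra. Qed.

Lemma flow_mono : {mono flow : x y / x < y}.
Proof.
apply: leW_mono; apply: le_mono => x y xy.
have [c _ hc] := @MVT_segment _ flow dflow x y (ltW xy) (fun x _ => flow_is_derive x)
  (continuous_subspaceT (is_derive_continuous flow_is_derive)).
by rewrite -subr_gt0 hc mulr_gt0// ?subr_gt0//; case: (dflow_bounds c).
Qed.

(** Psi increases strictly, as its derivative is at least 1/2, and it is onto
    because it differs from the identity by a bounded function. *)
Lemma inverse_flow : exists Phi, [/\ cancel flow Phi, cancel Phi flow,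
  forall y, `|Phi y - y| <= `|s| * M & forall y, K < `|y| -> Phi y = y].
Proof.
have cf := is_derive_continuous flow_is_derive.
have sX x : `|s * X x| <= 2^-1 by rewrite normrM (le_trans _ sM)// ler_wpM2l.
have surj y : exists x, flow x = y.
  have yy : y - 1 <= y + 1 by lra.
  have [||x _ hx] := @IVT R flow (y - 1) (y + 1) y yy; last by exists x.
    exact: continuous_subspaceT.
  have := sX (y - 1); have := sX (y + 1); rewrite !ler_norml /flow => /andP[a b] /andP[c d].
  rewrite ge_min le_max; apply/andP; split; apply/orP; [left|right]; lra.
pose Phi y := projT1 (cid (surj y)).
have PhiK : cancel Phi flow by move=> y; exact: projT2 (cid (surj y)).
have inj : injective flow.
  move=> x y e; apply/eqP; by rewrite eq_le !leNgt -[x < y]flow_mono -[y < x]flow_mono e ltxx.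
have flowK : cancel flow Phi by move=> x; apply: inj; rewrite PhiK.
exists Phi; split => // y.
  by rewrite -{2}(PhiK y) /flow opprD addNKr normrN normrM ler_wpM2l.
by move=> Ky; apply: inj; rewrite PhiK /flow (X0 Ky).1 mulr0 addr0.
Qed.

End Flow.

(** * Variation by truncated dilations *)

Section Dilation.
Context {R : realType}.
Notation mu := (@lebesgue_measure R).
Notation plane := (measurableTypeR R * measurableTypeR R)%type.
Notation mu2 := (@lebesgue_measure R \x @lebesgue_measure R)%E.
Notation D := (@hplane R).
Notation ip := (ip mu2 D).
Local Hint Resolve mitv : core.
Variables (h : R) (phi p : R -> R) (G : plane -> R * R).
Hypothesis adm : admissible h phi p.
Hypothesis sG : stray phi p G.

Let hp : prim phi p := let: And4 a _ _ _ := adm in a.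
Let sp : sqint mu setT p := let: And4 _ a _ _ := adm in a.
Let iW : rint mu setT (fun x => W h (angle_map phi x)) := let: And4 _ _ _ a := adm in a.
Let cphi : continuous phi := prim_continuous hp.
Let P0 : R := \int[mu]_x (p x ^+ 2).
Let mD := @measurable_half_plane R.

Variables (X xi : R -> R) (M K : R).
Hypothesis K0 : 0 <= K.
Hypothesis sxi : smooth xi.
Hypothesis dX : forall x : R, is_derive x 1 X (xi x).
Hypothesis X_le : forall x, `|X x| <= M.
Hypothesis xi_le : forall x, `|xi x| <= M.
Hypothesis X0 : forall x, K < `|x| -> X x = 0 /\ xi x = 0.

Let M0 : 0 <= M. Proof. exact: le_trans (normr_ge0 _) (X_le 0). Qed.
Let cxi : continuous xi := smooth_continuous sxi.
Let mxi : measurable_fun setT xi. Proof. exact: continuous_measurable_fun. Qed.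
Let mxi2 : measurable_fun D (fun z : plane => xi z.1).
Proof. by apply: measurable_funTS; exact: measurable_fst_comp. Qed.

(** The derivative at s = 0 of the energy of phi transported by id + s X, where
    xi is the derivative of X. In the stray field term 1 is the vertical
    stretching: only the deviation of xi from a dilation contributes. *)
Definition dilation_derivative : R :=
  - 2^-1 * \int[mu]_x (xi x * p x ^+ 2) + \int[mu]_x (xi x * W h (angle_map phi x)) +
  2^-1 * \int[mu2]_(z in D) ((xi z.1 - 1) * ((G z).1 ^+ 2 - (G z).2 ^+ 2)).

Section OneDilation.
Variables (s : R) (Phi : R -> R).
Hypothesis sM : `|s| * M <= 2^-1.
Hypothesis s1 : `|s| <= 2^-1.
Let Psi := flow X s.
Let psi := dflow xi s.
Hypothesis PsiK : cancel Psi Phi.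
Hypothesis PhiK : cancel Phi Psi.
Hypothesis Phi_near : forall y, `|Phi y - y| <= `|s| * M.
Hypothesis Phi_id : forall y, K < `|y| -> Phi y = y.

Let dPsi (x : R) : is_derive x 1 Psi (psi x) := flow_is_derive s dX x.
Let psiP x : [/\ 0 < psi x, psi x <= 2 & 2^-1 <= psi x] := dflow_bounds xi_le sM x.
Let psi_gt0 x : 0 < psi x. Proof. by case: (psiP x). Qed.
Let spsi : smooth psi.
Proof. by apply: smoothD; [exact: smooth_cst|exact: smoothZ]. Qed.
Let cpsi : continuous psi := smooth_continuous spsi.
Let mpsi : measurable_fun setT psi. Proof. exact: continuous_measurable_fun. Qed.
Let psiV_le2 x : (psi x)^-1 <= 2.
Proof. by have [? ? ?] := psiP x; rewrite invf_ple ?posrE. Qed.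
Let mpsiV : measurable_fun setT (fun x => (psi x)^-1).
Proof.
apply: continuous_measurable_fun => x; apply: (@cvgV _ _ _ _ psi); last exact: cpsi.
by rewrite gt_eqF.
Qed.

Let q y := p (Phi y) / psi (Phi y).
Let zeta y := phi (Phi y) - phi y.
Let z y := q y - p y.

Let CV := @inverse_change_of_variables R Psi Phi psi dPsi spsi psi_gt0 PsiK PhiK.

Lemma dil_prim : prim (fun y => phi (Phi y)) q.
Proof. exact: (prim_diffeo dPsi spsi psi_gt0 PsiK PhiK hp). Qed.

Let ip_psi : rint mu setT (fun x => p x ^+ 2 / psi x).
Proof.
have := @rintMb _ _ _ mu setT measurableT 2 (fun x => (psi x)^-1) (fun x => p x ^+ 2) mpsiV.
move=> hb; have {hb} : rint mu setT (fun x => (psi x)^-1 * p x ^+ 2).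
  by apply: hb => [x _|]; [rewrite ger0_norm// invr_ge0 ltW|exact: sp.2].
by congr rint; apply/funext => x; rewrite mulrC.
Qed.

(** Change of variables: one of the two factors 1 / psi is the Jacobian. *)
Lemma dil_sq : sqint mu setT q /\ \int[mu]_x (q x ^+ 2) = \int[mu]_x (p x ^+ 2 / psi x).
Proof.
have mq := linc_measurable dil_prim.1.
have [i e] := CV ip_psi.
have E : (fun y => q y ^+ 2) = (fun y => p (Phi y) ^+ 2 / psi (Phi y) / psi (Phi y)).
  by apply/funext => y; rewrite /q; field; rewrite gt_eqF.
by split; [split; rewrite ?E|rewrite -e E].
Qed.

Lemma dil_cprim : cprim zeta z.
Proof.
split; [exact: primB dil_prim hp|exact: sqintB dil_sq.1 sp|exists K => x Kx].
rewrite /zeta /z /q (Phi_id Kx) /psi /dflow (X0 Kx).2 mulr0 addr0 divr1.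
by rewrite !subrr.
Qed.

Lemma dil_z : \int[mu]_x (z x ^+ 2) <= 6 * P0.
Proof.
have [sq eq] := dil_sq; have sz := sqintB measurableT sq sp.
have i0 := rintD measurableT (rintZ measurableT 2 sq.2) (rintZ measurableT 2 sp.2).
have i1 : rint mu setT (fun x => 2 * p x ^+ 2) by exact: rintZ _ _ sp.2.
have le1 : \int[mu]_x (q x ^+ 2) <= 2 * P0.
  rewrite eq -(RintZ measurableT _ sp.2); apply: (le_Rint measurableT ip_psi i1) => x _.
  by rewrite mulrC ler_wpM2r ?sqr_ge0.
apply: (@le_trans _ _ (2 * \int[mu]_x (q x ^+ 2) + 2 * P0)); last by lra.
rewrite -(RintZ measurableT _ sq.2) -(RintZ measurableT _ sp.2) -(RintD measurableT); last 2 first.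
- exact: rintZ _ _ sq.2.
- exact: i1.
apply: (le_Rint measurableT sz.2 i0) => x _; rewrite /z.
by have := sqr_ge0 (q x + p x); lra.
Qed.

Variable N : R -> R.
Hypothesis hN : prim N (fun x => p x ^+ 2).

(** The flow moves points by at most |s| M. *)
Lemma dil_zeta_pointwise x :
  zeta x ^+ 2 <= `|s| * M * (N (x + `|s| * M) - N (x - `|s| * M)).
Proof. exact: (sq_increment_near hp sp hN (Phi_near x)). Qed.

Lemma dil_zeta : \int[mu]_x (zeta x ^+ 2) <= 2 * M ^+ 2 * P0 * `|s| ^+ 2.
Proof.
have cN := prim_continuous hN; have sz := cprim_sq dil_cprim.
have d0 : 0 <= `|s| * M by rewrite mulr_ge0.
rewrite (Rint_itv_support (a := - K) (b := K)); last first.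
  move=> x xK; rewrite /zeta Phi_id ?subrr ?expr0n//.
  by rewrite ltNge ler_norml; move: xK; rewrite in_itv.
have shift (c : R) : continuous (fun x => N (x + c)).
  by move=> x; apply: continuous_comp; [exact: (cvgD (@cvg_id _ _) (cvg_cst c))|exact: cN].
have iN : rint mu `[- K, K] (fun x => N (x + `|s| * M) - N (x - `|s| * M)).
  by apply: lincB; apply: continuous_linc; exact: shift.
apply: (@le_trans _ _ (`|s| * M * \int[mu]_(x in `[- K, K]) (N (x + `|s| * M) - N (x - `|s| * M)))).
  rewrite -(RintZ (mitv _ _) _ iN); apply: (le_Rint (mitv _ _)).
  - exact: rint_linc sz.2 _ _.
  - exact: rintZ.
  - by move=> x _; exact: dil_zeta_pointwise.
apply: (le_trans (ler_wpM2l d0 (increment_average sp hN d0 K0))).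
by rewrite -/P0 le_eqVlt; apply/orP; left; apply/eqP; ring.
Qed.

Let CC := 2 * (M + 1) ^+ 2.
Let lam := 1 + s.

Let lam_bounds : 2^-1 <= lam /\ 0 < lam.
Proof. by move: s1; rewrite ler_norml /lam => /andP[]; split; lra. Qed.

Let ratio1 x : psi x / lam <= 1 + s * (xi x - 1) + CC * s ^+ 2.
Proof.
have [l1 l2] := lam_bounds.
have -> : psi x / lam = 1 + s * (xi x - 1) + (1 - xi x) / lam * s ^+ 2.
  by rewrite /psi /dflow /lam; field; rewrite gt_eqF.
rewrite lerD2l ler_wpM2r ?sqr_ge0// ler_pdivrMr//.
have := xi_le x; rewrite ler_norml => /andP[x1 x2].
rewrite /CC; nra.
Qed.

Let ratio2 x : lam / psi x <= 1 + s * (1 - xi x) + CC * s ^+ 2.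
Proof.
have [q0 _ q2] := psiP x.
have -> : lam / psi x = 1 + s * (1 - xi x) + (xi x ^+ 2 - xi x) / psi x * s ^+ 2.
  by rewrite /psi /dflow /lam; field; rewrite gt_eqF.
rewrite lerD2l ler_wpM2r ?sqr_ge0// ler_pdivrMr//.
have := xi_le x; rewrite ler_norml => /andP[x1 x2].
have h1 : xi x ^+ 2 - xi x <= (M + 1) ^+ 2 by nra.
by rewrite (le_trans h1)// /CC mulrC mulrA ler_peMl ?sqr_ge0//; lra.
Qed.

Let ratio3 x : (psi x)^-1 <= 1 - s * xi x + 2 * M ^+ 2 * s ^+ 2.
Proof.
have [q0 _ q2] := psiP x.
have -> : (psi x)^-1 = 1 - s * xi x + (xi x ^+ 2 / psi x) * s ^+ 2.
  by rewrite /psi /dflow; field; rewrite gt_eqF.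
have h1 : xi x ^+ 2 <= M ^+ 2.
  by rewrite -(real_normK (num_real (xi x))) lerXn2r ?nnegrE.
have h2 : 0 <= (psi x)^-1 by rewrite invr_ge0 ltW.
by rewrite lerD2l ler_wpM2r ?sqr_ge0// mulrC ler_pM ?sqr_ge0.
Qed.

Let stray_upper G1 : stray (fun x => phi x + zeta x) (fun x => p x + z x) G1 ->
  ip G1 G1 <= ip G G + s * \int[mu2]_(z in D) ((xi z.1 - 1) * ((G z).1 ^+ 2 - (G z).2 ^+ 2)) +
    CC * s ^+ 2 * ip G G.
Proof.
move=> [cG1 nG1]; have [l1 l2] := lam_bounds.
have psi2 x : psi x <= 2 by case: (psiP x).
have psiV x : 2^-1 <= psi x by case: (psiP x).
have nG1' : neumann (fun y => - sin (phi (Phi y)) * p (Phi y) / psi (Phi y)) G1.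
  congr (neumann _ _) : nG1; apply/funext => y.
  have -> : phi y + zeta y = phi (Phi y) by rewrite /zeta; ring.
  have -> : p y + z y = q y by rewrite /z; ring.
  by rewrite /q mulrA.
apply: (le_trans (transport_bound dPsi spsi psi_gt0 PsiK PhiK l2 psi2 psiV
   (prim_cos hp) sG.1 sG.2 cG1 nG1')).
have [[m1 i1] [m2 i2]] := sG.1.1.
have id := rintB mD i1 i2.
have mx : measurable_fun D (fun z : plane => xi z.1 - 1) by exact: measurable_funB.
have bx z0 : D z0 -> `|xi z0.1 - 1| <= M + 1.
  by move=> _; rewrite (le_trans (ler_normB _ _))// normr1 lerD2r.
have ix := rintMb mD mx bx id.
have i0 := rint_dot mD sG.1.1 sG.1.1.
rewrite /ip -(RintZ mD s ix) -(RintZ mD _ i0) -(RintD mD i0 (rintZ mD s ix)).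
rewrite -(RintD mD (rintD mD i0 (rintZ mD s ix)) (rintZ mD _ i0)).
apply: (le_Rint mD).
- exact: (transport_rint spsi psi_gt0 l2 psi2 psiV sG.1.1).
- by apply: (rintD mD); [apply: (rintD mD) => //; exact: rintZ|exact: rintZ].
move=> z0 _; rewrite /dotp.
have h1 := ler_wpM2r (sqr_ge0 (G z0).1) (ratio1 z0.1).
have h2 := ler_wpM2r (sqr_ge0 (G z0).2) (ratio2 z0.1).
by apply: (le_trans (lerD h1 h2)); rewrite le_eqVlt; apply/orP; left; apply/eqP; ring.
Qed.

(** The exchange and anisotropy energies are computed exactly by the change of
    variables, the stray energy is bounded by transport_bound with the vertical
    stretching lam = 1 + s. *)
Lemma dil_upper G1 : stray (fun x => phi x + zeta x) (fun x => p x + z x) G1 ->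
  energy_value h (fun x => phi x + zeta x) (fun x => p x + z x) G1 <=
  energy_value h phi p G + s * dilation_derivative +
   (M ^+ 2 * P0 + (M + 1) ^+ 2 * ip G G) * s ^+ 2.
Proof.
move=> /stray_upper hG1.
have bxi x : [set: R] x -> `|xi x| <= M by move=> _; exact: xi_le.
have ixp : rint mu setT (fun x => xi x * p x ^+ 2).
  by apply: (@rintMb _ _ _ mu setT measurableT M) => //; exact: sp.2.
have ixW : rint mu setT (fun x => xi x * W h (angle_map phi x)).
  by apply: (@rintMb _ _ _ mu setT measurableT M).
have e1 : \int[mu]_x ((p x + z x) ^+ 2) <= P0 - s * \int[mu]_x (xi x * p x ^+ 2) +
    2 * M ^+ 2 * s ^+ 2 * P0.
  rewrite (_ : \int[mu]_x ((p x + z x) ^+ 2) = \int[mu]_x (q x ^+ 2)); last first.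
    by apply: eq_Rint => x _; rewrite /z addrC subrK.
  rewrite dil_sq.2 /P0 -(RintZ measurableT s ixp) -(RintZ measurableT _ sp.2).
  have j1 := rintZ measurableT s ixp.
  have j2 := rintZ measurableT (2 * M ^+ 2 * s ^+ 2) sp.2.
  rewrite -(RintB measurableT sp.2 j1) -(RintD measurableT (rintB measurableT sp.2 j1) j2).
  apply: (le_Rint measurableT ip_psi (rintD measurableT (rintB measurableT sp.2 j1) j2)) => x _.
  rewrite (mulrC (p x ^+ 2)); apply: (le_trans (ler_wpM2r (sqr_ge0 _) (ratio3 x))).
  by rewrite le_eqVlt; apply/orP; left; apply/eqP; ring.
have e2 : \int[mu]_x W h (angle_map (fun x => phi x + zeta x) x) =
    \int[mu]_x W h (angle_map phi x) + s * \int[mu]_x (xi x * W h (angle_map phi x)).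
  rewrite -(RintZ measurableT s ixW) -(RintD measurableT iW (rintZ measurableT s ixW)).
  rewrite -(CV (rintD measurableT iW (rintZ measurableT s ixW))).2.
  apply: eq_Rint => y _; rewrite /angle_map.
  have -> : phi y + zeta y = phi (Phi y) by rewrite /zeta; ring.
  rewrite (_ : _ + _ = W h (cos (phi (Phi y)), sin (phi (Phi y))) * psi (Phi y)).
    by rewrite mulfK// gt_eqF.
  by rewrite /psi /dflow; ring.
rewrite /energy_value /dilation_derivative e2 -/P0.
move: e1 hG1; rewrite /CC.
set a := \int[mu]_x _; set b := \int[mu]_x W _ _.
move=> e1 hG1; lra.
Qed.

End OneDilation.
Hypothesis stationary : forall zeta z, cprim zeta z -> first_variation h phi p G zeta z = 0.

(** E - del |s| <= E(phi \o Psi^-1) <= E + s T + O(s^2) for small s of both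
    signs. *)
Lemma dilation_identity : dilation_derivative = 0.
Proof.
have P00 : 0 <= P0 by exact: Rint_sq_ge0.
have G0 := ip_ge0 mu2 D G.
pose T := dilation_derivative; rewrite -/T.
have [N [hN _]] := prim_exists (rint_linc sp.2).
pose C2 : R := M ^+ 2 * P0 + (M + 1) ^+ 2 * ip G G.
have C20 : 0 <= C2 by exact: (addr_ge0 (mulr_ge0 (sqr_ge0 _) P00) (mulr_ge0 (sqr_ge0 _) G0)).
pose C : R := 6 * P0 + 2 * M ^+ 2 * P0.
have key del : 0 < del -> forall sgn : R, `|sgn| = 1 -> sgn * T <= 2 * del.
  move=> del0 sgn sgn1.
  have [eps eps0 heps] := energy_lower adm sG C del0.
  have M1 : 0 < M + 1 by rewrite ltr_wpDl.
  have [d d0 hd] := increment_uniform sp hN (divr_gt0 eps0 M1).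
  pose t := Num.min eps (Num.min (2^-1 / (M + 1)) (Num.min 2^-1
    (Num.min (d / (M + 1)) (del / (C2 + 1))))).
  have C21 : 0 < C2 + 1 by rewrite ltr_wpDl.
  have t0 : 0 < t by rewrite !lt_min eps0 !divr_gt0// invr_gt0 ltr0n.
  have teps : t <= eps by rewrite !ge_min lexx.
  have tM : t * (M + 1) <= 2^-1 by rewrite -ler_pdivlMr// /t !ge_min lexx !orbT.
  have t2 : t <= 2^-1 by rewrite !ge_min lexx !orbT.
  have td : t * (M + 1) <= d by rewrite -ler_pdivlMr// /t !ge_min lexx !orbT.
  have tC : t * (C2 + 1) <= del by rewrite -ler_pdivlMr// /t !ge_min lexx !orbT.
  have tMM : t * M <= t * (M + 1) by rewrite ler_pM2l// lerDl.
  (* the first order term s T is bounded from below, hence the sign *)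
  pose s := - sgn * t.
  have ns : `|s| = t by rewrite normrM normrN sgn1 mul1r gtr0_norm.
  have s2 : s ^+ 2 = t ^+ 2 by rewrite -(real_normK (num_real s)) ns.
  have sM : `|s| * M <= 2^-1 by rewrite ns (le_trans tMM).
  have s1 : `|s| <= 2^-1 by rewrite ns.
  have [Phi [PsiK PhiK near id]] := inverse_flow dX X_le xi_le X0 sM.
  have cz := dil_cprim sM PsiK PhiK id.
  have [G1 hG1] := admissible_stray (admissibleD adm cz).
  have up := dil_upper sM s1 PsiK PhiK hG1.
  have N_le a b : a <= b -> N a <= N b.
    by apply: prim_le hN _ => x; exact: sqr_ge0.
  have lo := heps t _ _ G1 _ cz _ _ _ hG1.
  move: lo; rewrite (stationary cz) addr0 => lo.
  have {}lo : energy_value h phi p G - del * t <= energy_value h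
      (fun x => phi x + (phi (Phi x) - phi x)) (fun x => p x + (p (Phi x) / dflow xi s (Phi x) - p x)) G1.
    apply: lo.
    - by rewrite t0.
    - move=> x; apply: (le_trans (dil_zeta_pointwise near hN x)).
      rewrite ns; have hx : N (x + t * M) - N (x - t * M) <= eps / (M + 1).
        apply: le_trans (hd x); apply: lerB; apply: N_le; first by rewrite lerD2l (le_trans tMM).
        by rewrite lerD2l lerN2 (le_trans tMM).
      apply: (@le_trans _ _ (t * (M + 1) * (eps / (M + 1)))); last first.
        by rewrite mulrAC -mulrA mulfVK ?gt_eqF// mulrC.
      apply: ler_pM => //; first by rewrite mulr_ge0// ltW.
      have t00 : 0 <= t * M by exact: (mulr_ge0 (ltW t0) M0).
      by rewrite subr_ge0; apply: N_le; rewrite lerD2l (le_trans _ t00)// oppr_le0.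
    - by apply: (le_trans (dil_z sM PsiK PhiK)); rewrite lerDl !mulr_ge0 ?sqr_ge0.
    - have := dil_zeta sM PsiK PhiK near id hN; rewrite ns => /le_trans; apply.
      by rewrite ler_wpM2r ?sqr_ge0// lerDr mulr_ge0.
  have := le_trans lo up; rewrite s2 -/T -/C2 => fin.
  have q1 : sgn * T * t <= del * t + C2 * t ^+ 2 by move: fin; rewrite /s; lra.
  have q2 : C2 * t ^+ 2 <= del * t.
    rewrite expr2 mulrA ler_pM2r// (le_trans _ tC)// mulrC ler_pM2l// lerDl//.
  have : sgn * T * t <= 2 * del * t by lra.
  by rewrite ler_pM2r.
apply/eqP; rewrite -normr_le0 leNgt; apply/negP => L0.
have d0 : 0 < `|T| / 4 by rewrite divr_gt0.
have := key _ d0 1 (normr1 _); have := key _ d0 (-1) (normrN1 _).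
rewrite mulN1r mul1r => k1 k2.
have : `|T| <= 2 * (`|T| / 4) by rewrite ler_norml k2 andbT lerNl.
lra.
Qed.

End Dilation.

(** * Equipartition of the energy *)

Section Cutoff.
Context {R : realType}.

(** X x = x * chi x for a bump chi with value 1 at 0. *)
Lemma cutoff_exists : exists (X xi : R -> R) (K B : R),
  [/\ smooth xi, forall x : R, is_derive x 1 X (xi x),
     forall x, `|X x| <= B /\ `|xi x| <= B,
     0 <= K /\ (forall x, K < `|x| -> X x = 0 /\ xi x = 0) & xi 0 = 1].
Proof.
pose c := (bump 0 (-1) 1 (0 : R))^-1.
pose chi x := c * bump 0 (-1) 1 (x : R).
have tchi : test_function chi by apply: test_functionZ; exact: test_bump.
have [K hK] := test_function_bound tchi; have [schi _] := tchi.
have [_ dchi schi'] := smoothP schi.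
have chi0 : chi 0 = 1.
  by rewrite /chi /c mulVf// gt_eqF// bump_gt0// in_itv/= ltrN10 ltr01.
pose X x := x * chi x; pose xi x := 1 * chi x + x * 'D_1 chi x.
have dX (x : R) : is_derive x 1 X (xi x).
  exact: (is_der_mul (is_derive_id x 1) (derivableP (dchi x 1))).
have sid : smooth (fun x : R => x).
  exact: (smooth_prim (fun x : R => is_derive_id x 1) (smooth_cst 1)).
have sxi : smooth xi.
  exact: (smoothD (smoothZ 1 schi) (smoothM sid (schi' 1))).
have X0 x : K < `|x| -> X x = 0 /\ xi x = 0.
  by move=> /hK[h1 h2]; rewrite /X /xi h1 h2 !mulr0 addr0.
have X0' x : `|K| < `|x| -> X x = 0 /\ xi x = 0.
  by move=> Kx; apply: X0; rewrite (le_lt_trans (ler_norm K)).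
have [M1 hM1] := continuous_bounded_itv (- `|K|) `|K| (is_derive_continuous dX).
have [M2 hM2] := continuous_bounded_itv (- `|K|) `|K| (smooth_continuous sxi).
exists X, xi, `|K|, (`|M1| + `|M2|); split => //; last by rewrite /xi chi0 mul1r mul0r addr0.
move=> x; have [xK|/X0'[-> ->]] := leP `|x| `|K|; last by rewrite normr0 addr_ge0.
have xin : x \in `[- `|K|, `|K|] by rewrite in_itv/= -ler_norml.
split.
  by rewrite (le_trans (hM1 _ xin))// (le_trans (ler_norm _))// lerDl.
by rewrite (le_trans (hM2 _ xin))// (le_trans (ler_norm _))// lerDr.
Qed.

End Cutoff.

Section Equipartition.
Context {R : realType}.
Notation mu := (@lebesgue_measure R).
Notation plane := (measurableTypeR R * measurableTypeR R)%type.
Notation mu2 := (@lebesgue_measure R \x @lebesgue_measure R)%E.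
Notation D := (@hplane R).
Variables (h : R) (phi p : R -> R) (G : plane -> R * R).
Hypothesis adm : admissible h phi p.
Hypothesis sG : stray phi p G.
Hypothesis stationary : forall zeta z, cprim zeta z -> first_variation h phi p G zeta z = 0.

Let sp : sqint mu setT p := let: And4 _ a _ _ := adm in a.
Let iW : rint mu setT (fun x => W h (angle_map phi x)) := let: And4 _ _ _ a := adm in a.
Let mD := @measurable_half_plane R.

(** The vector field X is dilated by the factor n + 1, which leaves the bound on
    its derivative unchanged. *)
Lemma scaled_identity (X xi : R -> R) (K B : R) : smooth xi ->
  (forall x : R, is_derive x 1 X (xi x)) -> (forall x, `|X x| <= B /\ `|xi x| <= B) ->
  0 <= K -> (forall x, K < `|x| -> X x = 0 /\ xi x = 0) ->
  forall n, dilation_derivative h phi p G (fun x => xi (n.+1%:R^-1 * x)) = 0.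
Proof.
move=> sxi dX hB K0 X0 n; set c : R := n.+1%:R^-1.
have c0 : 0 < c by rewrite invr_gt0.
have B0 : 0 <= B by have [h1 _] := hB 0; exact: le_trans (normr_ge0 _) h1.
have n1 : (1 : R) <= n.+1%:R by rewrite ler1n.
apply: (dilation_identity adm sG (X := fun x => n.+1%:R * X (c * x))
  (M := n.+1%:R * B) (K := n.+1%:R * K)) => //.
- by rewrite mulr_ge0.
- have := smooth_affine c 0 sxi; congr smooth; apply/funext => x.
  by rewrite addr0.
- move=> x; have h1 : is_derive x 1 (fun x => c * x) c.
    by have := is_der_scale c (is_derive_id x 1); rewrite mulr1.
  have := is_der_scale n.+1%:R (@is_der_comp _ X (fun x => c * x) _ _ _ (dX (c * x)) h1).
  by congr is_derive; rewrite mulrC mulfVK.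
- by move=> x; rewrite normrM normr_nat ler_wpM2l//; case: (hB (c * x)).
- by move=> x; case: (hB (c * x)) => _ /le_trans; apply; rewrite ler_peMl.
- move=> x Kx; have /X0[-> ->] : K < `|c * x|.
    by rewrite normrM gtr0_norm// mulrC ltr_pdivlMr// mulrC.
  by rewrite mulr0.
Qed.

(** The weights xi (x / (n + 1)) are bounded and tend to xi 0 = 1. In
    dilation_identity the stray field term disappears in the limit. *)
Lemma equipartition : \int[mu]_x (p x ^+ 2) = 2 * \int[mu]_x W h (angle_map phi x).
Proof.
have [X [xi [K [B [sxi dX hB [K0 X0] xi0]]]]] := @cutoff_exists R.
have T0 := scaled_identity sxi dX hB K0 X0.
pose xn (n : nat) (x : R) := xi (n.+1%:R^-1 * x).
have bxn n x : `|xn n x| <= B by case: (hB (n.+1%:R^-1 * x)).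
have cxn n : continuous (xn n).
  have -> : xn n = (fun x => xi (n.+1%:R^-1 * x + 0)).
    by apply/funext => x; rewrite /xn addr0.
  exact: smooth_continuous (smooth_affine n.+1%:R^-1 0 sxi).
have mxn n : measurable_fun setT (xn n) by exact: continuous_measurable_fun.
have lim x : xn ^~ x @ \oo --> (1 : R).
  rewrite -xi0; have h0 : (fun n : nat => n.+1%:R^-1 * x) @ \oo --> (0 : R).
    by rewrite -(mul0r x); apply: cvgMr_tmp; exact: cvg_harmonic.
  have cxi : continuous xi := smooth_continuous sxi.
  apply: (@cvg_comp _ _ _ (fun n : nat => n.+1%:R^-1 * x) xi _ _ _ h0); exact: cxi.
have mW := rint_measurable iW; have mp := rint_measurable sp.2.
have l1 : (fun n => \int[mu]_x (xn n x * p x ^+ 2)) @ \oo --> \int[mu]_x (p x ^+ 2).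
  apply: (Rdominated_cvg measurableT _ mp (rintZ measurableT B sp.2)).
  - by move=> n; apply: measurable_funM; [exact: mxn|exact: mp].
  - by move=> n x _; rewrite normrM (ger0_norm (sqr_ge0 _)) ler_wpM2r ?sqr_ge0.
  - move=> x _; rewrite -[X in _ --> X]mul1r; exact: cvgMr_tmp.
have l2 : (fun n => \int[mu]_x (xn n x * W h (angle_map phi x))) @ \oo -->
    \int[mu]_x W h (angle_map phi x).
  apply: (Rdominated_cvg measurableT _ mW (rintZ measurableT B (rint_norm iW))).
  - by move=> n; apply: measurable_funM; [exact: mxn|exact: mW].
  - by move=> n x _; rewrite normrM ler_wpM2r.
  - move=> x _; rewrite -[X in _ --> X]mul1r; exact: cvgMr_tmp.
have [[_ i1] [_ i2]] := sG.1.1.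
have id := rintB mD i1 i2; have md := rint_measurable id.
have l3 : (fun n => \int[mu2]_(z in D) ((xn n z.1 - 1) * ((G z).1 ^+ 2 - (G z).2 ^+ 2))) @ \oo -->
    \int[mu2]_(z in D) (cst 0 : plane -> R) z.
  apply: (Rdominated_cvg mD _ (measurable_cst _) (rintZ mD (B + 1) (rint_norm id))).
  - move=> n; apply: measurable_funM => //; apply: measurable_funB => //.
    by apply: measurable_funTS; exact: measurable_fst_comp.
  - move=> n z _; rewrite normrM ler_wpM2r//.
    by rewrite (le_trans (ler_normB _ _))// normr1 lerD2r.
  - move=> z _; rewrite -[X in _ --> X](mul0r ((G z).1 ^+ 2 - (G z).2 ^+ 2)).
    apply: cvgMr_tmp; rewrite -(subrr 1); apply: cvgB; [exact: lim|exact: cvg_cst].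
have I0 : \int[mu2]_(z in D) (cst 0 : plane -> R) z = 0.
  by rewrite /Rintegral integral0_eq.
rewrite I0 in l3.
have l : (fun n => dilation_derivative h phi p G (xn n)) @ \oo -->
   - 2^-1 * \int[mu]_x (p x ^+ 2) + \int[mu]_x W h (angle_map phi x) + 2^-1 * 0.
  apply: cvgD; [apply: cvgD => //; exact: cvgMl_tmp|exact: cvgMl_tmp].
have E : (fun n => dilation_derivative h phi p G (xn n)) = cst 0 by apply/funext => n; exact: T0.
rewrite E in l.
have := cvg_lim (@Rhausdorff R) l.
have -> : limn (cst 0 : nat -> R) = 0 by exact: lim_cst.
rewrite mulr0 addr0 => e; have {}e := e eventually_filter; lra.
Qed.

End Equipartition.

Theorem proposition4 (R : realType) (h : R) (m : R -> R * R)
  (h_ge0 : 0 <= h) (h_neq1 : h != 1)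
  (m_circle : forall x : R, unit_circle (m x))
  (m_H1loc : H1loc (component1 m) /\ H1loc (component2 m))
  (m_finite : finite_energy h m)
  (m_critical : critical_point h m) :
  (\int[@lebesgue_measure R]_x (sqnorm (mderiv m x))%:E =
   2%:E * \int[@lebesgue_measure R]_x (W h (m x))%:E)%E.
Proof.
case: m_critical => phi [cphi mphi crit].
have [p [hp sp sk i1 [m1 m2]]] := finite_energy_lifting cphi mphi m_finite.
have adm : admissible h phi p by split => //; exact: W_rint.
have [G sG] := admissible_stray adm.
have e := equipartition adm sG (critical_first_variation adm sG crit).
have [_ _ _ iW] := adm.
have [mS aS] := sqnorm_mderiv hp sp m1 m2 mphi.
rewrite (integral_ae_eq mS (measurable_funX 2 sp.1) aS).
have mW : measurable_fun setT (fun x => W h (m x)).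
  apply: measurable_funM => //; apply: measurable_funB => //; apply: measurable_funD => //.
  apply: measurable_funB; first exact: measurable_funX.
  exact: measurable_funM.
rewrite (integral_ae_eq mW (rint_measurable iW)); last by apply: aeS mphi => x ->.
by rewrite (EFin_Rint measurableT sp.2) (EFin_Rint measurableT iW) e EFinM.
Qed.
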